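(* Let $N\ge 1$, $s\in(0,1)$, $\mathscr L=\Delta-(-\Delta)^s$, and let $h(t)=t^\gamma\ell(t)$, where $-1<\gamma\le 0$ and $\ell:(0,\infty)\to(0,\infty)$ is a continuous, bounded function that is slowly varying at infinity. Let $-1<\varrho<0$ and suppose that $$0\le\frac{b}{1+\gamma}<2s<N .$$ Assume moreover that $p>p^*$, where $$p^*:=\frac{N-b-2s(\varrho-\gamma)}{N-2s(\varrho+1)} .$$ Set $$p_c:=\frac{N(p-1)}{2s(1+\gamma)-b},\qquad q_c:=\frac{N p_c}{N+2s(\varrho+1)p_c}.$$ Then there exists $\varepsilon>0$ such that, for every initial datum $u_0$ and forcing term $\mathbf w$ satisfying $$\|u_0\|_{L^{p_c}(\mathbb R^N)}+\|\mathbf w\|_{L^{q_c}(\mathbb R^N)}\le\varepsilon,$$ the problem $$\partial_t u-\mathscr L u=h(t)\,|x|^{-b}|u|^p+t^{\varrho}\,\mathbf w(x)\ \text{ in }\mathbb R^N\times(0,\infty),\qquad u(x,0)=u_0(x),$$ admits a global mild solution.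
   Context: **Slowly varying.** A measurable $\ell:(0,\infty)\to(0,\infty)$ is slowly varying at infinity if $\lim_{\lambda\to\infty}\ell(\lambda x)/\ell(\lambda)=1$ for every $x>0$. **Semigroup.** $e^{t\mathscr L}$ ($t>0$) denotes convolution with the kernel $\mathbf E_s(\cdot,t)\ge 0$ whose Fourier transform is $e^{-t(|\xi|^2+|\xi|^{2s})}$ (so $\int_{\mathbb R^N}\mathbf E_s(x,t)\,dx=1$). **Global mild solution.** A function $u$ on $\mathbb R^N\times(0,\infty)$ satisfying, for all $t>0$, the Duhamel formula (with all terms well defined) $$u(t)=e^{t\mathscr L}u_0+\int_0^t h(\sigma)\,e^{(t-\sigma)\mathscr L}\big(|\cdot|^{-b}|u(\sigma)|^p\big)\,d\sigma+\int_0^t\sigma^{\varrho}\,e^{(t-\sigma)\mathscr L}\mathbf w\,d\sigma .$$ *)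

(* Defs.v *)
From HB Require Import structures.
From mathcomp Require Import all_boot all_order all_algebra.
From mathcomp Require Import all_classical all_reals all_analysis.
From mathcomp Require Import complex.
Set Implicit Arguments.
Unset Strict Implicit.
Unset Printing Implicit Defensive.
Import Order.TTheory GRing.Theory Num.Theory.
Import numFieldNormedType.Exports.
Local Open Scope classical_set_scope.
Local Open Scope ring_scope.

(* R^N is N.-tuple R, which the library equips with the product of the Borel
   sigma-algebras, but with no vector-space structure and no norm. *)

Section euclidean.
Context {R : realType} {N : nat}.
Implicit Types x y : N.-tuple R.

Definition dot x y : R := \sum_(i < N) tnth x i * tnth y i.

Definition enorm x : R := Num.sqrt (dot x x).

Definition vsub x y : N.-tuple R := [tuple tnth x i - tnth y i | i < N].

End euclidean.

Section lebesgue_cons.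
Context {R : realType} (n : nat).
Variable m : {sigma_finite_measure set (n.-tuple R) -> \bar R}.

Definition tcons (z : measurableTypeR R * n.-tuple R) : n.+1.-tuple R :=
  [the n.+1.-tuple R of z.1 :: z.2].

Definition tuncons (x : n.+1.-tuple R) : measurableTypeR R * n.-tuple R :=
  (thead x, [tuple of behead x]).

Lemma tconsK : cancel tcons tuncons.
Proof. by case=> a b; congr (_, _); exact/val_inj. Qed.

Lemma measurable_tcons : measurable_fun [set: _] tcons.
Proof.
apply: (@measurable_cons _ _ (measurableTypeR R * n.-tuple R)%type R fst n snd).
  move=> mT A mA.
  have h := @measurable_fst _ _ (measurableTypeR R) (n.-tuple R) mT A mA.
  exact: h.
exact: measurable_snd.
Qed.

Lemma measurable_tuncons : measurable_fun [set: _] tuncons.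
Proof.
apply: (@measurable_fun_pair _ _ _ (n.+1.-tuple R) (measurableTypeR R)
  (n.-tuple R) (fun x => thead x) (fun x => [tuple of behead x])).
  by move=> mT A mA; exact: (@measurable_tnth _ R n.+1 ord0 mT A mA).
exact: measurable_behead.
Qed.

Definition lebesgue_cons : set (n.+1.-tuple R) -> \bar R :=
  pushforward (lebesgue_measure \x m)%E tcons.

Let lebesgue_cons0 : lebesgue_cons set0 = 0%E.
Proof. by rewrite /lebesgue_cons /pushforward preimage_set0 measure0. Qed.

Let lebesgue_cons_ge0 A : (0 <= lebesgue_cons A)%E.
Proof. by rewrite /lebesgue_cons /pushforward; apply: integral_ge0 => *. Qed.

Let lebesgue_cons_sigma_additive : semi_sigma_additive lebesgue_cons.
Proof.
move=> F mF tF mUF; rewrite /lebesgue_cons /pushforward preimage_bigcup.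
apply: (@measure_semi_sigma_additive _ _ _ (lebesgue_measure \x m)%E).
- by move=> k; rewrite -[X in measurable X]setTI; exact: measurable_tcons.
- apply/trivIsetP => /= i j _ _ ij; rewrite -preimage_setI.
  by move/trivIsetP : tF => /(_ _ _ _ _ ij) ->//; rewrite preimage_set0.
- by rewrite -preimage_bigcup -[X in measurable X]setTI; exact: measurable_tcons.
Qed.

HB.instance Definition _ := isMeasure.Build _ _ _ lebesgue_cons
  lebesgue_cons0 lebesgue_cons_ge0 lebesgue_cons_sigma_additive.

Lemma lebesgue_cons_tuncons (C : set (measurableTypeR R * n.-tuple R)) :
  lebesgue_cons (tuncons @^-1` C) = (lebesgue_measure \x m)%E C.
Proof.
rewrite /lebesgue_cons /pushforward -comp_preimage; congr (_ _).
by apply/seteqP; split => z /=; rewrite tconsK.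
Qed.

Let lebesgue_cons_sigma_finite : sigma_finite setT lebesgue_cons.
Proof.
have /sigma_finiteP[F [TF ndF Foo]] := sigma_finiteT (@lebesgue_measure R).
have /sigma_finiteP[G [TG ndG Goo]] := sigma_finiteT m.
exists (fun k => tuncons @^-1` (F k `*` G k)).
  apply/seteqP; split => // x _.
  have : [set: measurableTypeR R] (tuncons x).1 by [].
  have : [set: n.-tuple R] (tuncons x).2 by [].
  rewrite {1}TG {1}TF => -[j _ Gj] [i _ Fi]; exists (maxn i j) => //; split.
    by move: Fi; exact/subsetPset/ndF/leq_maxl.
  by move: Gj; exact/subsetPset/ndG/leq_maxr.
move=> k; have [mF Fk] := Foo k; have [mG Gk] := Goo k; split.
  by rewrite -[X in measurable X]setTI; apply: measurable_tuncons => //;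
     exact: measurableX.
rewrite lebesgue_cons_tuncons product_measure1E//.
by rewrite lte_mul_pinfty// ge0_fin_numE.
Qed.

HB.instance Definition _ := Measure_isSigmaFinite.Build _ _ _ lebesgue_cons
  lebesgue_cons_sigma_finite.

End lebesgue_cons.

Fixpoint lebesgue_tuple (R : realType) (N : nat) :
    {sigma_finite_measure set (N.-tuple R) -> \bar R} :=
  match N with
  | 0 => dirac ([tuple] : 0.-tuple R)
  | n.+1 => lebesgue_cons (lebesgue_tuple R n)
  end.

Lemma lebesgue_tuple_box (R : realType) (N : nat) (A : 'I_N -> set R) :
  (forall i, measurable (A i)) ->
  lebesgue_tuple R N [set x | forall i, A i (tnth x i)] =
  (\prod_(i < N) @lebesgue_measure R (A i))%E.
Proof.
elim: N A => [|n ih] A mA.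
  by rewrite big_ord0 /= diracE mem_set// => -[].
rewrite big_ord_recl -ih//.
set B := [set x : n.-tuple R | forall i, A (lift ord0 i) (tnth x i)].
have mB : measurable B.
  rewrite (_ : B = \bigcap_(i in [set: 'I_n])
      ((@tnth n R)^~ i @^-1` A (lift ord0 i))); last first.
    by apply/seteqP; split=> x Bx i => [_|]; exact: Bx.
  apply: fin_bigcap_measurable => // i _.
  by rewrite -[X in measurable X]setTI; exact: measurable_tnth.
rewrite -product_measure1E//; last exact: mA.
rewrite -lebesgue_cons_tuncons /=; congr (_ _).
have tnth_behead (x : n.+1.-tuple R) i :
    tnth [tuple of behead x] i = tnth x (lift ord0 i).
  by rewrite [in RHS](tuple_eta x) tnthS.
apply/seteqP; split => x /=.
  move=> Ax; split => [|i]; first exact: Ax.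
  by rewrite /B /= tnth_behead; exact: Ax.
move=> [Ax0 Ax] i; case: (unliftP ord0 i) => [j ->|->]; last exact: Ax0.
by have := Ax j; rewrite /= tnth_behead.
Qed.

Section heat_kernel.
Context {R : realType} {N : nat}.
Local Notation mu := (lebesgue_tuple R N).

(* xi |-> \int f(x) e^{- i x . xi} dx; this normalization is the one for which
   - \Delta + (- \Delta)^s has the symbol |xi|^2 + |xi|^{2s}. *)
Definition fourier (f : N.-tuple R -> R) (xi : N.-tuple R) : R[i] :=
  Complex (\int[mu]_x (f x * cos (dot x xi)))
          (- \int[mu]_x (f x * sin (dot x xi))).

(* These conditions determine each E t up to a Lebesgue-null set, hence
   determine the convolution by E t at every point. *)
Definition is_kernel (s : R) (E : R -> N.-tuple R -> R) : Prop :=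
  forall t, 0 < t ->
  [/\ forall x, 0 <= E t x,
      mu.-integrable [set: N.-tuple R] (EFin \o E t) &
      forall xi, fourier (E t) xi =
        Complex (expR (- (t * (enorm xi ^+ 2 + enorm xi `^ (2 * s))))) 0].

Definition convolvable (k f : N.-tuple R -> R) (x : N.-tuple R) : Prop :=
  mu.-integrable [set: N.-tuple R] (fun y => (k (vsub x y) * f y)%:E).

Definition convolution (k f : N.-tuple R -> R) (x : N.-tuple R) : R :=
  \int[mu]_y (k (vsub x y) * f y).

Definition duhamel_defined (E : R -> N.-tuple R -> R) (a : R -> R)
    (F : R -> N.-tuple R -> R) (t : R) (x : N.-tuple R) : Prop :=
  {ae @lebesgue_measure R, forall sigma : R, 0 < sigma < t ->
    convolvable (E (t - sigma)) (F sigma) x} /\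
  (@lebesgue_measure R).-integrable `]0, t[
    (fun sigma => (a sigma * convolution (E (t - sigma)) (F sigma) x)%:E).

Definition duhamel (E : R -> N.-tuple R -> R) (a : R -> R)
    (F : R -> N.-tuple R -> R) (t : R) (x : N.-tuple R) : R :=
  \int[@lebesgue_measure R]_(sigma in `]0, t[)
    (a sigma * convolution (E (t - sigma)) (F sigma) x).

(* |x|^{-b} |v|^p; powR makes 0 `^ (- b) = 0 for b != 0, which only affects the
   null set {0}. *)
Definition weighted_power (b p : R) (v : N.-tuple R -> R) : N.-tuple R -> R :=
  fun x => enorm x `^ (- b) * `|v x| `^ p.

(* As usual for functions with data in Lebesgue spaces, the Duhamel formula is
   an identity between measurable functions of x modulo null sets. *)
Definition global_mild_solution (E : R -> N.-tuple R -> R) (h : R -> R)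
    (b p rho : R) (u0 w : N.-tuple R -> R) (u : R -> N.-tuple R -> R) : Prop :=
  let f sigma := weighted_power b p (u sigma) in
  measurable_fun [set z : R * N.-tuple R | 0 < z.1]
    (fun z : R * N.-tuple R => u z.1 z.2) /\
  forall t, 0 < t -> {ae mu, forall x,
    [/\ convolvable (E t) u0 x,
        duhamel_defined E h f t x,
        duhamel_defined E (fun sigma => sigma `^ rho) (fun=> w) t x &
        u t x = convolution (E t) u0 x + duhamel E h f t x
                + duhamel E (fun sigma => sigma `^ rho) (fun=> w) t x]}.

End heat_kernel.

Section parameters.
Context {R : realType}.

Definition slowly_varying (l : R -> R) : Prop :=
  [/\ measurable_fun [set t : R | 0 < t] l,
      forall t, 0 < t -> 0 < l t &
      forall x, 0 < x -> l (lambda * x) / l lambda @[lambda --> +oo] --> (1 : R)].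

Definition p_star (N : nat) (s gamma rho b : R) : R :=
  (N%:R - b - 2 * s * (rho - gamma)) / (N%:R - 2 * s * (rho + 1)).

Definition p_crit (N : nat) (s gamma b p : R) : R :=
  N%:R * (p - 1) / (2 * s * (1 + gamma) - b).

Definition q_crit (N : nat) (s gamma rho b p : R) : R :=
  let pc := p_crit N s gamma b p in
  N%:R * pc / (N%:R + 2 * s * (rho + 1) * pc).

End parameters.

(* Main.v *)
(** The solution is found by monotone iteration in the weighted space of functions with
    [|u(t)|_r <= B t^(-beta)], where [beta = N/(2s) (1/p_c - 1/r)]; the hypothesis [p > p^*] is
    what leaves room for an admissible exponent [r]. The semigroup satisfies the heat-type
    estimates of the fractional Laplacian because its symbol dominates [|xi|^(2s)], so that its
    kernel is at most [C t^(-N/(2s))]; together with Jensen's inequality and Tonelli's theorem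
    this gives the smoothing estimates, with and without the weight [|x|^(-b)]. For small data
    the increasing iteration started from the absolute values of the data stays in a ball of the
    weighted space, and its limit [V] is a supersolution that is finite almost everywhere. The
    signed Picard iterates then converge pointwise below [V], since each of their increments is
    dominated by the corresponding increment of the nonnegative iteration. As the kernel is only
    given through its Fourier transform, it is first identified with the inverse Fourier integral
    of the symbol, by testing against products of trapezoid functions. *)

Require Import Defs.
From HB Require Import structures.
From mathcomp Require Import all_boot all_order all_algebra.
From mathcomp Require Import all_classical all_reals all_analysis.
From mathcomp Require Import complex measurable_realfun ring lra.
Set Implicit Arguments.
Unset Strict Implicit.
Unset Printing Implicit Defensive.
Import Order.TTheory GRing.Theory Num.Theory.
Import numFieldNormedType.Exports.
Local Open Scope classical_set_scope.
Local Open Scope ring_scope.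

(** * Lebesgue integration on R^N *)

(** The Duhamel term is written as one integral over space-time against the nonnegative kernel
    [dker], so that the problem becomes [u = a + \int k |u|^p] on a sigma-finite measure space.
    There Tonelli's theorem with monotone and dominated convergence is enough, and the solution is a
    jointly measurable function that satisfies the formula at every point where the majorant is
    finite, not a curve of classes in L^r. Size estimates are stated for nonnegative functions with
    extended real values, in the form [\int g^r <= c^r], so that they apply before any finiteness is
    known. The exponent [beta] is dictated by scaling. If [t^(-eta)] is the rate at which the
    semigroup smooths the weighted nonlinearity, the identity [gamma - beta p - eta + 1 = - beta]
    says that the Duhamel map reproduces the weight [t^(-beta)] with the same constant at all times;
    this is what makes the solution global. As the bound in L^r holds at each time separately, the
    majorant is finite at almost every [x] for every [t > 0], not merely for almost every [t]. *)

Lemma measurable_powR_fun (R : realType) d (T : measurableType d) (f : T -> R) (a : R) :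
  measurable_fun setT f -> measurable_fun setT (fun x => f x `^ a).
Proof. exact: measurableT_comp (measurable_powR a). Qed.

Section affine_change_of_variables.
Context {R : realType}.
Local Notation leb := (@lebesgue_measure R).
Local Open Scope ereal_scope.

Lemma measurable_affine (a b : R) :
  measurable_fun [set: measurableTypeR R]
    (fun x => (a * x + b)%R : measurableTypeR R).
Proof.
apply: measurable_funD; last exact: measurable_cst.
by apply: measurable_funM => //; exact: measurable_cst.
Qed.

(** Uniqueness of Lebesgue measure: [a] times the pushforward under the affine map is a measure, and
    it has the right value on half-open intervals. *)
Lemma lebesgue_measure_affine (a b : R) (A : set R) : (0 < a)%R ->
  measurable A ->
  leb A = a%:E * leb ((fun x => a * x + b)%R @^-1` A).
Proof.
move=> a0 mA.
have mf := measurable_affine a b.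
pose pf := measure_function_pushforward__canonical__measure_function_Measure
  leb mf.
rewrite -[RHS]/(mscale (NngNum (ltW a0)) pf A).
apply: lebesgue_measure_unique => //= _ [[u v]] _ <-.
rewrite -[RHS]/(a%:E * leb ((fun x : R => a * x + b)%R @^-1` `]u, v]%classic)).
rewrite (_ : _ @^-1` _ = `](u - b) / a, (v - b) / a]%classic)%R; last first.
  apply/seteqP; split=> x /=; rewrite !in_itv/= ltr_pdivrMr// ler_pdivlMr//;
  by rewrite ltrBlDr lerBrDr ![(x * a)%R]mulrC.
rewrite !lebesgue_measure_itv/= !lte_fin ltr_pM2r ?invr_gt0// ltrD2r.
case: ifPn => _; last by rewrite mule0.
rewrite -!EFinD -EFinM -mulrBl opprD addrACA subrr addr0.
by rewrite mulrCA divff ?mulr1// gt_eqF.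
Qed.

Lemma ge0_integral_affine (a b : R) (f : R -> \bar R) : (0 < a)%R ->
  measurable_fun [set: R] f -> (forall x, 0 <= f x) ->
  \int[leb]_x f x = a%:E * \int[leb]_x f (a * x + b)%R.
Proof.
move=> a0 mf f0.
have mphi := measurable_affine a b.
have h : \int[pushforward leb (fun x : measurableTypeR R => (a * x + b)%R : measurableTypeR R)]_x f x
   = \int[leb]_x f (a * x + b)%R.
  rewrite (@ge0_integral_pushforward _ _ _ _ _ _ mphi leb setT f measurableT)//.
rewrite -h -(@ge0_integral_mscale _ _ _ _ setT measurableT (NngNum (ltW a0)))//.
apply: eq_measure_integral => A mA _.
exact: lebesgue_measure_affine.
Qed.

Lemma ge0_integral_oppr (f : R -> \bar R) :
  measurable_fun [set: R] f -> (forall x, 0 <= f x) ->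
  \int[leb]_x f x = \int[leb]_x f (- x)%R.
Proof.
move=> mf f0.
have mphi : measurable_fun [set: measurableTypeR R] (-%R : _ -> measurableTypeR R).
  exact: oppr_measurable.
have h : \int[pushforward leb (-%R : _ -> measurableTypeR R)]_x f x
   = \int[leb]_x f (- x)%R.
  by rewrite (@ge0_integral_pushforward _ _ _ _ _ _ mphi leb setT f measurableT).
by rewrite -h; apply: eq_measure_integral => A mA _; rewrite [RHS]lebesgue_measureN.
Qed.

Lemma ge0_integral_subr (a : R) (f : R -> \bar R) :
  measurable_fun [set: R] f -> (forall x, 0 <= f x) ->
  \int[leb]_x f (a - x)%R = \int[leb]_x f x.
Proof.
move=> mf f0.
rewrite [RHS](ge0_integral_affine a ltr01)// mul1e [RHS]ge0_integral_oppr//.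
  by apply: eq_integral => x _; congr f; rewrite mul1r addrC.
apply: measurableT_comp => //.
by have := measurable_affine 1 a.
Qed.

Lemma ge0_integral_subl (a : R) (f : R -> \bar R) :
  measurable_fun [set: R] f -> (forall x, 0 <= f x) ->
  \int[leb]_x f (x - a)%R = \int[leb]_x f x.
Proof.
move=> mf f0; rewrite [RHS](ge0_integral_affine (- a) ltr01)// mul1e.
by apply: eq_integral => x _; rewrite mul1r.
Qed.

End affine_change_of_variables.

Section euclidean_measurability.
Context {R : realType} {N : nat}.

Lemma measurable_tnthT (i : 'I_N) :
  measurable_fun [set: N.-tuple R] (fun x : N.-tuple R => tnth x i : R).
Proof. exact: measurable_tnth. Qed.

Lemma measurable_vsub d (T : measurableType d) (f g : T -> N.-tuple R) :
  measurable_fun [set: T] f -> measurable_fun [set: T] g ->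
  measurable_fun [set: T] (fun z => vsub (f z) (g z)).
Proof.
move=> mf mg; apply/measurable_fun_tnthP => i.
rewrite (_ : _ \o _ = fun z => tnth (f z) i - tnth (g z) i); last first.
  by apply/funext => z /=; rewrite tnth_mktuple.
by apply: measurable_funB; apply: (measurableT_comp (measurable_tnthT i)).
Qed.

Lemma measurable_dot d (T : measurableType d) (f g : T -> N.-tuple R) :
  measurable_fun [set: T] f -> measurable_fun [set: T] g ->
  measurable_fun [set: T] (fun z => dot (f z) (g z)).
Proof.
move=> mf mg; apply: measurable_sum => i.
by apply: measurable_funM; apply: (measurableT_comp (measurable_tnthT i)).
Qed.

Lemma measurable_enorm : measurable_fun [set: N.-tuple R] (@enorm R N).
Proof.
apply: (@measurableT_comp _ _ _ _ _ _ (@Num.sqrt R)).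
  by apply: continuous_measurable_fun; exact: sqrt_continuous.
by apply: measurable_dot; exact: measurable_id.
Qed.

Lemma enorm_ge0 (x : N.-tuple R) : 0 <= enorm x.
Proof. exact: sqrtr_ge0. Qed.

Lemma normr_tnth_le_enorm (x : N.-tuple R) i : `|tnth x i| <= enorm x.
Proof.
rewrite -sqrtr_sqr ler_wsqrtr// /dot (bigD1 i)//= -expr2 lerDl.
by apply: sumr_ge0 => j _; rewrite -expr2 sqr_ge0.
Qed.

End euclidean_measurability.

(** * Tonelli's theorem and translation invariance in N dimensions *)

Section tuple_integral.
Context {R : realType}.
Local Open Scope ereal_scope.
Local Notation leb := (@lebesgue_measure R).
Local Notation mu := (lebesgue_tuple R).

Lemma measurable_comp_tcons n (f : n.+1.-tuple R -> \bar R) :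
  measurable_fun [set: n.+1.-tuple R] f ->
  measurable_fun [set: measurableTypeR R * n.-tuple R] (f \o @tcons R n).
Proof. by move=> mf; apply: measurableT_comp => //; exact: measurable_tcons. Qed.

Lemma ge0_integral_tcons n (f : n.+1.-tuple R -> \bar R) :
  measurable_fun [set: n.+1.-tuple R] f -> (forall x, 0 <= f x) ->
  \int[mu n.+1]_x f x = \int[leb]_a \int[mu n]_y f (tcons (a, y)).
Proof.
move=> mf f0; rewrite [mu _]/=.
transitivity (\int[pushforward (leb \x mu n) (@tcons R n)]_x f x) => //.
rewrite (@ge0_integral_pushforward _ _ _ _ _ _ (@measurable_tcons R n) (leb \x mu n) setT f measurableT)//.
rewrite preimage_setT (fubini_tonelli1 (f \o @tcons R n))//.
  exact: measurable_comp_tcons.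
by move=> x; exact: f0.
Qed.

Lemma measurable_integral_tcons n (f : n.+1.-tuple R -> \bar R) :
  measurable_fun [set: n.+1.-tuple R] f -> (forall x, 0 <= f x) ->
  measurable_fun [set: measurableTypeR R] (fun a => \int[mu n]_y f (tcons (a, y))).
Proof.
move=> mf f0; apply: (measurable_fun_fubini_tonelli_F (f \o @tcons R n)).
  exact: measurable_comp_tcons.
by move=> x; exact: f0.
Qed.

Lemma tcons_vsub n (a b : R) (x y : n.-tuple R) :
  vsub (tcons (a, x)) (tcons (b, y)) = tcons ((a - b)%R, vsub x y).
Proof.
apply: eq_from_tnth => i; rewrite tnth_mktuple.
case: (unliftP ord0 i) => [j ->|->]; last by rewrite !tnth0.
by rewrite !tnthS tnth_mktuple.
Qed.

Lemma tconsP n (x : n.+1.-tuple R) : exists (a : R) y, x = tcons (a, y) :> n.+1.-tuple R.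
Proof. by exists (thead x), [tuple of behead x]; rewrite [LHS]tuple_eta. Qed.

(** Induction on the dimension: [ge0_integral_tcons] splits off the first coordinate, the inductive
    hypothesis treats the inner integral and one-dimensional translation the outer one. *)
Lemma ge0_integral_vsubl n (y : n.-tuple R) (f : n.-tuple R -> \bar R) :
  measurable_fun [set: n.-tuple R] f -> (forall x, 0 <= f x) ->
  \int[mu n]_x f (vsub x y) = \int[mu n]_x f x.
Proof.
elim: n y f => [|n ih] y f mf f0.
  by apply: eq_integral => x _; congr f; apply: val_inj; case: (vsub x y) => -[]//; case: x => -[].
have mfv : measurable_fun [set: n.+1.-tuple R] (fun x => f (vsub x y)).
  by apply: measurableT_comp => //; apply: measurable_vsub => //; exact: measurable_cst.
rewrite (ge0_integral_tcons mfv (fun=> f0 _)) (ge0_integral_tcons mf f0).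
have [b [z ->]] := tconsP y.
transitivity (\int[leb]_a \int[mu n]_x f (tcons ((a - b)%R, x))).
  apply: eq_integral => a _.
  under eq_integral do rewrite tcons_vsub.
  apply: (ih z (fun x => f (tcons ((a - b)%R, x)))) => //.
  apply: (measurableT_comp (measurable_comp_tcons mf)).
  exact: pair1_measurable.
apply: (ge0_integral_subl b (f := fun a => \int[mu n]_x f (tcons (a, x)))).
  exact: measurable_integral_tcons.
by move=> a; apply: integral_ge0.
Qed.

Lemma ge0_integral_vsubr n (y : n.-tuple R) (f : n.-tuple R -> \bar R) :
  measurable_fun [set: n.-tuple R] f -> (forall x, 0 <= f x) ->
  \int[mu n]_x f (vsub y x) = \int[mu n]_x f x.
Proof.
elim: n y f => [|n ih] y f mf f0.
  by apply: eq_integral => x _; congr f; apply: val_inj; case: (vsub y x) => -[]//; case: x => -[].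
have mfv : measurable_fun [set: n.+1.-tuple R] (fun x => f (vsub y x)).
  by apply: measurableT_comp => //; apply: measurable_vsub => //; exact: measurable_cst.
rewrite (ge0_integral_tcons mfv (fun=> f0 _)) (ge0_integral_tcons mf f0).
have [b [z ->]] := tconsP y.
transitivity (\int[leb]_a \int[mu n]_x f (tcons ((b - a)%R, x))).
  apply: eq_integral => a _.
  under eq_integral do rewrite tcons_vsub.
  apply: (ih z (fun x => f (tcons ((b - a)%R, x)))) => //.
  apply: (measurableT_comp (measurable_comp_tcons mf)).
  exact: pair1_measurable.
apply: (ge0_integral_subr b (f := fun a => \int[mu n]_x f (tcons (a, x)))).
  exact: measurable_integral_tcons.
by move=> a; apply: integral_ge0.
Qed.

Lemma measurable_prode d (T : measurableType d) n (h : 'I_n -> T -> \bar R) :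
  (forall i, measurable_fun [set: T] (h i)) ->
  measurable_fun [set: T] (fun x => \prod_(i < n) h i x).
Proof.
elim: n h => [|n ih] h mh.
  under eq_fun do rewrite big_ord0; exact: measurable_cst.
under eq_fun do rewrite big_ord_recl.
by apply: emeasurable_funM => //; exact: ih.
Qed.

Lemma ge0_integral_prod n (f : 'I_n -> R -> \bar R) :
  (forall i, measurable_fun [set: R] (f i)) -> (forall i x, 0 <= f i x) ->
  \int[mu n]_x (\prod_(i < n) f i (tnth x i)) = \prod_(i < n) \int[leb]_a f i a.
Proof.
elim: n f => [|n ih] f mf f0.
  under eq_integral do rewrite big_ord0.
  by rewrite big_ord0 integral_cst//= diracE mem_set// mul1e.
have mP m (g : 'I_m -> R -> \bar R) : (forall i, measurable_fun [set: R] (g i)) ->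
    measurable_fun [set: m.-tuple R] (fun x : m.-tuple R => \prod_(i < m) g i (tnth x i)).
  by move=> mg; apply: measurable_prode => i; apply: measurableT_comp => //; exact: measurable_tnthT.
rewrite ge0_integral_tcons//; last 2 first.
- exact: mP.
- by move=> x; apply: prode_ge0 => i.
rewrite big_ord_recl -ih//.
have P0 : 0 <= \int[mu n]_x \prod_(i < n) f (lift ord0 i) (tnth x i).
  by apply: integral_ge0 => x _; apply: prode_ge0 => i.
rewrite -ge0_integralZr//; last exact: mf.
apply: eq_integral => a _.
transitivity (\int[mu n]_x (f ord0 a * \prod_(i < n) f (lift ord0 i) (tnth x i))).
  apply: eq_integral => x _; rewrite big_ord_recl tnth0; congr (_ * _).
  by apply: eq_bigr => i _; rewrite tnthS.
rewrite ge0_integralZl//; first exact: (mP n (fun i => f (lift ord0 i))).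
by move=> x _; apply: prode_ge0 => i.
Qed.

End tuple_integral.

(** * Measures on R^N are determined by closed boxes *)

Section box_uniqueness.
Context {R : realType} {n : nat}.
Local Open Scope ereal_scope.

(** Closed boxes are stable under intersection, and their indicators are pointwise limits of
    products of trapezoids, which is how integrals over them are reached in the inversion
    formula. *)
Definition cbox (a b : 'I_n -> R) : set (n.-tuple R) :=
  [set x | forall i, a i <= tnth x i <= b i]%R.

Lemma cbox_bigcap a b :
  cbox a b = \bigcap_(i in [set: 'I_n])
    ((fun x : n.-tuple R => tnth x i) @^-1` `[a i, b i]%classic).
Proof.
apply/seteqP; split=> x abx i => [_|]; rewrite /= ?in_itv/=; first exact: abx.
by have := abx i I; rewrite /= in_itv.
Qed.

Lemma measurable_cbox a b : measurable (cbox a b).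
Proof.
rewrite cbox_bigcap; apply: fin_bigcap_measurable => // i _.
by rewrite -[X in measurable X]setTI; apply: measurable_tnthT => //; exact: measurable_itv.
Qed.

Lemma bigcup_cbox : \bigcup_k cbox (fun=> - k%:R)%R (fun=> k%:R) = setT.
Proof.
apply/seteqP; split => // x _.
exists (Num.truncn (\sum_(i < n) `|tnth x i|)).+1 => // i; rewrite -ler_norml.
apply: le_trans (ltW (truncnS_gt _)).
by rewrite (bigD1 i)//= lerDl sumr_ge0.
Qed.

Let G : set (set (n.-tuple R)) := [set B | exists a b, B = cbox a b].

Lemma measurable_tuple_cbox : @measurable _ (n.-tuple R) = <<s G >>.
Proof.
apply/seteqP; split; last first.
  apply: smallest_sub; first exact: sigma_algebra_measurable.
  by move=> _ [a [b ->]]; exact: measurable_cbox.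
apply: smallest_sub; first exact: smallest_sigma_algebra.
elim/big_ind: _ => [B []|A B sA sB C [/sA|/sB]//|i _ B].
suff mi : measurable_fun [set: g_sigma_algebraType G]
    ((fun x => tnth x i) : g_sigma_algebraType G -> R).
  by move=> [A mA <-]; exact: mi.
apply: (measurability (@RGenCInfty.G R)) => [|/= _ [_] [r] -> <-].
  exact: RGenCInfty.measurableE.
rewrite setTI.
(* The half-space [r <= x_i] is the union over [k] of the boxes with lower side [r] in direction
   [i], lower side [-k] in the other directions, and upper sides [k]. *)
pose a k j := if j == i then r else (- k%:R)%R.
rewrite (_ : _ @^-1` _ = \bigcup_k cbox (a k) (fun=> k%:R)); last first.
  apply/seteqP; split=> x /=; rewrite in_itv/= andbT; last first.
    by move=> [k _ /(_ i)]; rewrite /a eqxx => /andP[].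
  move=> rx; have : [set: n.-tuple R] x by [].
  rewrite -bigcup_cbox => -[k _ kx]; exists k => // j.
  by rewrite /a; case: eqP => [->|_]; last exact: kx; rewrite rx; case/andP: (kx i).
apply: bigcupT_measurable => k; apply: sub_sigma_algebra.
by exists (a k), (fun=> k%:R).
Qed.

Lemma cbox_measure_unique (m1 m2 : {measure set (n.-tuple R) -> \bar R}) :
  (forall a b, m1 (cbox a b) = m2 (cbox a b)) ->
  (forall a b, m1 (cbox a b) < +oo) ->
  forall A, measurable A -> m1 A = m2 A.
Proof.
move=> m12 m1oo; apply: (measure_unique G (fun k => cbox (fun=> - k%:R)%R (fun=> k%:R))).
- exact: measurable_tuple_cbox.
- move=> _ _ [a [b ->]] [c [d ->]].
  exists (fun i => Num.max (a i) (c i)), (fun i => Num.min (b i) (d i)).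
  apply/seteqP; split=> x.
    by move=> [abx cdx] i; rewrite ge_max le_min; move: (abx i) (cdx i) => /andP[-> ->] /andP[-> ->].
  by move=> h; split=> i; move: (h i); rewrite ge_max le_min => /andP[/andP[? ?] /andP[? ?]]; apply/andP.
- by move=> k; exists (fun=> - k%:R)%R, (fun=> k%:R).
- exact: bigcup_cbox.
- by move=> _ [a [b ->]].
- by move=> k; exact: m1oo.
Qed.

End box_uniqueness.

(** * Fubini's theorem with a bounded kernel *)

Section bounded_kernel.
Context {R : realType}.

Lemma integrable_EFin_measurable d (T : measurableType d)
    (m : {measure set T -> \bar R}) (D : set T) (f : T -> R) :
  m.-integrable D (EFin \o f) -> measurable_fun D f.
Proof. by move=> /(measurable_int m)/measurable_EFinP. Qed.

Lemma ae_eq_Rintegral d (T : measurableType d)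
    (m : {measure set T -> \bar R}) (f g : T -> R) :
  measurable_fun setT f -> measurable_fun setT g ->
  {ae m, forall x, f x = g x} -> \int[m]_x f x = \int[m]_x g x.
Proof.
move=> /measurable_EFinP mf /measurable_EFinP mg fg; rewrite /Rintegral; congr fine.
by apply: ae_eq_integral mf mg _ => //; apply: filterS fg => x fgx _ /=; rewrite fgx.
Qed.

Lemma integrable_EFinZl d (T : measurableType d)
    (m : {measure set T -> \bar R}) (k : R) (f : T -> R) :
  m.-integrable setT (EFin \o f) ->
  m.-integrable setT (EFin \o (fun x => k * f x)).
Proof. by move=> /(integrableZl measurableT k). Qed.

Lemma integrable_EFinD d (T : measurableType d)
    (m : {measure set T -> \bar R}) (f g : T -> R) :
  m.-integrable setT (EFin \o f) -> m.-integrable setT (EFin \o g) ->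
  m.-integrable setT (EFin \o (fun x => f x + g x)).
Proof. by move=> intf intg; have := integrableD measurableT intf intg. Qed.

Lemma integrable_EFinB d (T : measurableType d)
    (m : {measure set T -> \bar R}) (f g : T -> R) :
  m.-integrable setT (EFin \o f) -> m.-integrable setT (EFin \o g) ->
  m.-integrable setT (EFin \o (fun x => f x - g x)).
Proof.
move=> intf intg; have := integrable_EFinD intf (integrable_EFinZl (-1) intg).
by under eq_fun do rewrite mulN1r.
Qed.

Lemma integrableM_le1 d (T : measurableType d)
    (m : {measure set T -> \bar R}) (f h : T -> R) :
  m.-integrable setT (EFin \o f) -> measurable_fun setT h ->
  (forall x, `|h x| <= 1) -> m.-integrable setT (EFin \o (fun x => f x * h x)).
Proof.
move=> intf mh h1; apply: (le_integrable measurableT _ _ intf).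
  by apply/measurable_EFinP/measurable_funM => //;
     exact: integrable_EFin_measurable intf.
by move=> x _ /=; rewrite lee_fin normrM ler_piMr.
Qed.

Context d1 d2 (T1 : measurableType d1) (T2 : measurableType d2).
Variables (m1 : {sigma_finite_measure set T1 -> \bar R})
          (m2 : {sigma_finite_measure set T2 -> \bar R}).
Variables (f : T1 -> R) (g : T2 -> R) (h : T1 * T2 -> R).
Hypotheses (intf : m1.-integrable setT (EFin \o f))
           (intg : m2.-integrable setT (EFin \o g))
           (mh : measurable_fun setT h) (h1 : forall z, `|h z| <= 1).

Let F z := f z.1 * (g z.2 * h z).

Let mf : measurable_fun setT f.
Proof. exact: integrable_EFin_measurable intf. Qed.

Let mg : measurable_fun setT g.
Proof. exact: integrable_EFin_measurable intg. Qed.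

Let mF : measurable_fun setT F.
Proof.
apply: measurable_funM; first exact: (measurableT_comp mf measurable_fst).
by apply: measurable_funM => //; exact: (measurableT_comp mg measurable_snd).
Qed.

Lemma integrable_prod_kernel : (m1 \x m2)%E.-integrable setT (EFin \o F).
Proof.
apply/integrable12ltyP; first exact/measurable_EFinP.
have fy : (\int[m1]_x `|(f x)%:E| < +oo)%E by case/integrableP : intf.
have gy : (\int[m2]_x `|(g x)%:E| < +oo)%E by case/integrableP : intg.
apply: (@le_lt_trans _ _ (\int[m1]_x (`|(f x)%:E| * \int[m2]_y `|(g y)%:E|))%E).
  apply: ge0_le_integral => //.
  - by move=> x _; apply: integral_ge0.
  - apply: (measurable_fun_fubini_tonelli_F (abse \o (EFin \o F))) => //.
      by apply: measurableT_comp => //; exact/measurable_EFinP.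
    by move=> z; exact: abse_ge0.
  - apply: emeasurable_funM => //; apply: measurableT_comp => //.
    exact/measurable_EFinP.
  - move=> x _; rewrite -ge0_integralZl//; last first.
      by apply: measurableT_comp => //; exact/measurable_EFinP.
    apply: ge0_le_integral => //.
    + have mF1 : measurable_fun setT (fun y => F (x, y)).
        by apply: (measurableT_comp mF); exact: pair1_measurable.
      apply: (@measurableT_comp _ _ _ _ _ _ (@abse R)) => //.
      exact/measurable_EFinP.
    + apply: emeasurable_funM => //; apply: measurableT_comp => //.
      exact/measurable_EFinP.
    + move=> y _; rewrite /F/= lee_fin !normrM ler_wpM2l// ler_piMr//.
rewrite ge0_integralZr//; last 2 first.
- by apply: measurableT_comp => //; exact/measurable_EFinP.
- exact: integral_ge0.
by rewrite lte_mul_pinfty// ?integral_ge0// ge0_fin_numE// integral_ge0.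
Qed.

(** With [h] a cosine, this exchange moves the Fourier transform from one factor of a pairing to the
    other; the bound on [h] makes the double integral absolutely convergent. *)
Lemma Rintegral_swap_kernel :
  \int[m1]_x (f x * \int[m2]_y (g y * h (x, y))) =
  \int[m2]_y (g y * \int[m1]_x (f x * h (x, y))).
Proof.
have mh1 x : measurable_fun setT (fun y => h (x, y)).
  by apply: (measurableT_comp mh); exact: pair1_measurable.
have mh2 y : measurable_fun setT (fun x => h (x, y)).
  by apply: (measurableT_comp mh); exact: pair2_measurable.
rewrite /Rintegral; congr fine.
transitivity (\int[m1]_x \int[m2]_y (F (x, y))%:E)%E.
  apply: eq_integral => x _.
  have ig := integrableM_le1 intg (mh1 x) (fun y => h1 (x, y)).
  rewrite EFinM fineK; last exact: integrable_fin_num ig.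
  by rewrite -integralZl.
rewrite (Fubini integrable_prod_kernel); apply: eq_integral => y _.
have ig := integrableM_le1 intf (mh2 y) (fun x => h1 (x, y)).
rewrite EFinM fineK; last exact: integrable_fin_num ig.
rewrite -integralZl//; apply: eq_integral => x _; rewrite ?funeposE ?funenegE.
by rewrite /F/= -EFinM; congr EFin; ring.
Qed.

End bounded_kernel.

(** * Signed integrals of product functions *)

Section tuple_Rintegral.
Context {R : realType}.
Local Notation mu := (lebesgue_tuple R).
Local Notation leb := (@lebesgue_measure R).

Lemma integrable_vsubl n (y : n.-tuple R) (f : n.-tuple R -> R) :
  (mu n).-integrable setT (EFin \o f) ->
  (mu n).-integrable setT (EFin \o (fun x => f (vsub x y))).
Proof.
move=> /integrableP[mf fy]; apply/integrableP; split.
  by apply: (measurableT_comp mf); apply: measurable_vsub => //; exact: measurable_cst.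
rewrite (ge0_integral_vsubl y (f := fun x => `|(EFin \o f) x|%E))//.
exact: measurableT_comp.
Qed.

Lemma Rintegral_vsubl n (y : n.-tuple R) (f : n.-tuple R -> R) :
  (mu n).-integrable setT (EFin \o f) ->
  \int[mu n]_x f (vsub x y) = \int[mu n]_x f x.
Proof.
move=> /measurable_int mf; rewrite /Rintegral; congr fine.
rewrite integralE [in RHS]integralE; congr (_ - _)%E.
  by rewrite -(ge0_integral_vsubl y (measurable_funepos mf))//; apply: eq_integral => x _; rewrite ?funeposE ?funenegE.
by rewrite -(ge0_integral_vsubl y (measurable_funeneg mf))//; apply: eq_integral => x _; rewrite ?funeposE ?funenegE.
Qed.

Section tcons_mul.
Variables (n : nat) (f : R -> R) (g : n.-tuple R -> R).
Hypotheses (intf : leb.-integrable setT (EFin \o f))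
           (intg : (mu n).-integrable setT (EFin \o g)).

Let F (x : n.+1.-tuple R) := f (tuncons x).1 * g (tuncons x).2.

Let F_tcons z : F (tcons z) = f z.1 * g z.2.
Proof. by rewrite /F tconsK. Qed.

Let intFc : (leb \x mu n)%E.-integrable setT (EFin \o F \o @tcons R n).
Proof.
have h := integrable_prod_kernel intf intg (@measurable_cst _ _ _ _ setT (1:R)).
have := h _; under eq_fun do rewrite mulr1.
move=> /(_ _); rewrite (_ : EFin \o F \o _ = EFin \o (fun z => f z.1 * g z.2)).
  by apply=> z; rewrite normr1.
by apply/funext => z /=; rewrite F_tcons.
Qed.

Let mF : measurable_fun setT (EFin \o F).
Proof.
have mf := integrable_EFin_measurable intf.
have mg := integrable_EFin_measurable intg.
apply/measurable_EFinP/measurable_funM.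
  apply: (measurableT_comp mf); apply: (measurableT_comp measurable_fst).
  exact: measurable_tuncons.
apply: (measurableT_comp mg); apply: (measurableT_comp measurable_snd).
exact: measurable_tuncons.
Qed.

Lemma integrable_tcons_mul : (mu n.+1).-integrable setT (EFin \o F).
Proof.
apply/integrableP; split => //.
rewrite ge0_integral_tcons//; last exact: measurableT_comp.
move/integrableP : intFc => [mFc].
by rewrite fubini_tonelli1//; exact: measurableT_comp.
Qed.

Lemma Rintegral_tcons_mul :
  \int[mu n.+1]_x F x = \int[leb]_a f a * \int[mu n]_y g y.
Proof.
rewrite {1}/Rintegral.
have -> : (\int[mu n.+1]_x (F x)%:E = \int[leb \x mu n]_z (F (tcons z))%:E)%E.
  transitivity (\int[pushforward (leb \x mu n)%E (@tcons R n)]_x (F x)%:E)%E => //.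
  by rewrite (integral_pushforward (@measurable_tcons R n) mF intFc).
rewrite -(integral12_prod_meas1 intFc) /fubini_F.
have -> : (\int[leb]_a \int[mu n]_y ((EFin \o F \o @tcons R n) (a, y)) =
   \int[leb]_a ((f a)%:E * (\int[mu n]_y g y)%:E))%E.
  apply: eq_integral => a _; rewrite {1}/Rintegral fineK; last exact: integrable_fin_num.
  rewrite -integralZl//; apply: eq_integral => y _.
  by rewrite /= F_tcons EFinM.
by rewrite integralZr// fineM//; exact: integrable_fin_num.
Qed.

End tcons_mul.

Lemma dot_tcons n (x y : n.+1.-tuple R) :
  dot x y = (tuncons x).1 * (tuncons y).1 + dot (tuncons x).2 (tuncons y).2.
Proof.
have [a [u ->]] := tconsP x; have [b [v ->]] := tconsP y.
by rewrite !tconsK /dot big_ord_recl !tnth0; under eq_bigr do rewrite !tnthS.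
Qed.

Definition prodr n (f : 'I_n -> R -> R) (x : n.-tuple R) : R :=
  \prod_(i < n) f i (tnth x i).

Lemma prodr_tcons n (f : 'I_n.+1 -> R -> R) (x : n.+1.-tuple R) :
  prodr f x = f ord0 (tuncons x).1 * prodr (fun i => f (lift ord0 i)) (tuncons x).2.
Proof.
have [a [u ->]] := tconsP x.
by rewrite tconsK /prodr big_ord_recl tnth0; under eq_bigr do rewrite tnthS.
Qed.

Lemma integrable_prodr n (f : 'I_n -> R -> R) :
  (forall i, leb.-integrable setT (EFin \o f i)) ->
  (mu n).-integrable setT (EFin \o prodr f).
Proof.
elim: n f => [|n ih] f intf.
  rewrite (_ : EFin \o _ = cst 1%E); last first.
    by apply/funext => x; rewrite /= /prodr big_ord0.
  apply/integrableP; split; first exact: measurable_cst.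
  by rewrite integral_cst//= diracE mem_set// mule1 normr1 ltry.
rewrite (_ : EFin \o _ = EFin \o (fun x => f ord0 (tuncons x).1 *
    prodr (fun i => f (lift ord0 i)) (tuncons x).2)); last first.
  by apply/funext => x /=; rewrite prodr_tcons.
by apply: integrable_tcons_mul => //; apply: ih => i.
Qed.

(** The addition formulas split [cos] and [sin] of [dot x xi] along the first coordinate. Each
    formula involves both functions, so the two conclusions go through a common induction; the
    vanishing sine transforms of the factors remove the cross terms. *)
Lemma Rintegral_prodr_cos_sin n (f : 'I_n -> R -> R) (xi : n.-tuple R) :
  (forall i, leb.-integrable setT (EFin \o f i)) ->
  (forall i, \int[leb]_a (f i a * sin (a * tnth xi i)) = 0) ->
  \int[mu n]_x (prodr f x * cos (dot x xi)) =
    \prod_(i < n) \int[leb]_a (f i a * cos (a * tnth xi i)) /\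
  \int[mu n]_x (prodr f x * sin (dot x xi)) = 0.
Proof.
elim: n f xi => [|n ih] f xi intf fsin.
  rewrite big_ord0; split.
    rewrite (@eq_Rintegral _ _ _ _ _ (cst 1)).
      by rewrite Rintegral_cst//= indicE mem_set// mulr1.
    by move=> x _; rewrite /prodr /dot !big_ord0 cos0 mulr1.
  rewrite (@eq_Rintegral _ _ _ _ _ (cst 0)); first by rewrite Rintegral_cst// mul0r.
  by move=> x _; rewrite /dot !big_ord0 sin0 mulr0.
have [b [v xiE]] := tconsP xi.
pose g : n.-tuple R -> R := prodr (fun i => f (lift ord0 i)).
have mb (h : R -> R) : continuous h ->
    measurable_fun [set: measurableTypeR R] (fun a : R => h (a * b)).
  move=> ch; apply: measurableT_comp; first exact: continuous_measurable_fun.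
  by apply: measurable_funM => //; exact: measurable_cst.
have mv (h : R -> R) : continuous h ->
    measurable_fun setT (fun y : n.-tuple R => h (dot y v)).
  move=> ch; apply: measurableT_comp; first exact: continuous_measurable_fun.
  by apply: measurable_dot => //; exact: measurable_cst.
have intg : (mu n).-integrable setT (EFin \o g) by apply: integrable_prodr => i.
have ifc := integrableM_le1 (intf ord0) (mb _ (@continuous_cos R)) (fun a => cos_max _).
have ifs := integrableM_le1 (intf ord0) (mb _ (@continuous_sin R)) (fun a => sin_max _).
have igc := integrableM_le1 intg (mv _ (@continuous_cos R)) (fun a => cos_max _).
have igs := integrableM_le1 intg (mv _ (@continuous_sin R)) (fun a => sin_max _).
have fsin' i : \int[leb]_a (f (lift ord0 i) a * sin (a * tnth v i)) = 0.
  rewrite -[RHS](fsin (lift ord0 i)) xiE; apply: eq_Rintegral => a _.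
  by rewrite tnthS.
have [ihc ihs] := ih (fun i => f (lift ord0 i)) v (fun i => intf _) fsin'.
have f0s : \int[leb]_a (f ord0 a * sin (a * b)) = 0.
  by rewrite -[RHS](fsin ord0) xiE tnth0.
split.
  rewrite big_ord_recl.
  have -> : \prod_(i < n) \int[leb]_a (f (lift ord0 i) a * cos (a * tnth xi (lift ord0 i)))
      = \int[mu n]_y (g y * cos (dot y v)).
    rewrite ihc; apply: eq_bigr => i _; apply: eq_Rintegral => a _.
    by rewrite xiE tnthS.
  rewrite xiE tnth0 -(Rintegral_tcons_mul ifc igc).
  rewrite -[RHS]subr0 -(mul0r (\int[mu n]_y (g y * sin (dot y v)))) -f0s.
  rewrite -(Rintegral_tcons_mul ifs igs) -RintegralB//; last 2 first.
  - exact: integrable_tcons_mul ifc igc.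
  - exact: integrable_tcons_mul ifs igs.
  apply: eq_Rintegral => x _; rewrite dot_tcons tconsK/= prodr_tcons cosD /g.
  by ring.
rewrite -[RHS]addr0 -[X in _ = X + _](mul0r (\int[mu n]_y (g y * cos (dot y v)))) -{1}f0s.
rewrite -[X in _ = _ + X](mulr0 (\int[leb]_a (f ord0 a * cos (a * b)))) -ihs.
rewrite -(Rintegral_tcons_mul ifs igc) -(Rintegral_tcons_mul ifc igs) -RintegralD//; last 2 first.
- exact: integrable_tcons_mul ifs igc.
- exact: integrable_tcons_mul ifc igs.
apply: eq_Rintegral => x _; rewrite xiE dot_tcons tconsK/= prodr_tcons sinD /g.
by ring.
Qed.

End tuple_Rintegral.

(** * Fourier inversion *)

Section odd_integral.
Context {R : realType}.
Local Notation leb := (@lebesgue_measure R).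

Lemma Rintegral_oppr (f : R -> R) : measurable_fun [set: R] f ->
  \int[leb]_x f (- x) = \int[leb]_x f x.
Proof.
move=> /measurable_EFinP mf; rewrite /Rintegral; congr fine.
rewrite integralE [in RHS]integralE; congr (_ - _)%E.
  rewrite [RHS]ge0_integral_oppr//; last exact: measurable_funepos.
  by apply: eq_integral => x _; rewrite !funeposE.
rewrite [RHS]ge0_integral_oppr//; last exact: measurable_funeneg.
by apply: eq_integral => x _; rewrite !funenegE.
Qed.

Lemma Rintegral_odd (f : R -> R) : leb.-integrable setT (EFin \o f) ->
  (forall x, f (- x) = - f x) -> \int[leb]_x f x = 0.
Proof.
move=> intf fN; have mf := integrable_EFin_measurable intf.
have : \int[leb]_x f x = - 1 * \int[leb]_x f x.
  rewrite -RintegralZl// -[LHS]Rintegral_oppr//.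
  by apply: eq_Rintegral => x _; rewrite fN mulN1r.
lra.
Qed.

Lemma integrable_invD1sqr : leb.-integrable setT (EFin \o (fun x : R => (1 + x ^+ 2)^-1)).
Proof.
have h0 (x : R) : 0 <= (oneDsqr x)^-1 by rewrite invr_ge0 (le_trans ler01) ?oneDsqr_ge1.
apply/integrableP; split.
  apply/measurable_EFinP; apply: continuous_measurable_fun.
  exact: (@continuous_oneDsqrV R).
under eq_integral do rewrite /= ger0_norm ?h0//.
rewrite (@ge0_symfun_integralT _ (fun x : R => (oneDsqr x)^-1))//; last 2 first.
- exact: (@continuous_oneDsqrV R).
- by move=> x /=; rewrite /oneDsqr sqrrN.
by rewrite -set_itvcy integral0y_oneDsqr -EFinM ltry.
Qed.

Lemma normr_sin_le (x : R) : `|sin x| <= `|x|.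
Proof.
wlog x0 : x / 0 <= x.
  move=> h; have [/h//|/ltW] := leP 0 x.
  by rewrite -oppr_ge0 => /h; rewrite sinN !normrN.
have [c _] := @MVT_segment R sin cos 0 x x0 (fun y _ => is_derive_sin y)
  (continuous_subspaceT (@continuous_sin R)).
rewrite sin0 !subr0 => ->; rewrite normrM ler_piMl//; exact: cos_max.
Qed.

Lemma onem_cosE (x : R) : 1 - cos x = 2 * sin (x / 2) ^+ 2.
Proof.
have -> : cos x = cos ((x / 2) *+ 2) by congr cos; rewrite mulr2n; lra.
by rewrite cos_mulr2n cos2sin2; ring.
Qed.

Lemma onem_cos_le (x : R) : 1 - cos x <= x ^+ 2 / 2.
Proof.
rewrite onem_cosE.
have : sin (x / 2) ^+ 2 <= (x / 2) ^+ 2.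
  by rewrite -[leLHS]real_normK ?num_real// -[leRHS]real_normK ?num_real// lerXn2r ?nnegrE// normr_sin_le.
by rewrite expr_div_n; lra.
Qed.

End odd_integral.

(** * Fejer kernels, tents and trapezoids on the line *)

Section fejer_kernel.
Context {R : realType}.
Local Notation leb := (@lebesgue_measure R).

(** The Fejer kernel up to normalization. At [x = 0] the division returns 0 instead of the limit
    [a^2/2], which matters only on a null set. *)
Definition qker (a x : R) : R := (1 - cos (a * x)) / x ^+ 2.

Lemma qker_ge0 a x : 0 <= qker a x.
Proof. by rewrite /qker divr_ge0 ?sqr_ge0// subr_ge0 cos_le1. Qed.

Lemma qkerN a x : qker (- a) x = qker a x.
Proof. by rewrite /qker mulNr cosN. Qed.

Lemma qker_even a x : qker a (- x) = qker a x.
Proof. by rewrite /qker mulrN cosN sqrrN. Qed.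

Lemma measurable_qker a : measurable_fun [set: R] (qker a).
Proof.
apply: measurable_funM.
  apply: measurable_funB => //; apply: measurableT_comp.
    by apply: continuous_measurable_fun; exact: continuous_cos.
  by apply: measurable_funM.
rewrite (_ : (fun x : R => _) = (fun x => (x ^+ 2) `^ (-1))).
  apply: (@measurableT_comp _ _ _ _ _ _ (fun y : R => y `^ (-1))).
    exact: measurable_powR.
  exact: exprn_measurable.
by apply/funext => x; rewrite powR_inv1// sqr_ge0.
Qed.

Lemma qker1_le x : qker 1 x <= 4 * (1 + x ^+ 2)^-1.
Proof.
have x1 : 0 < 1 + x ^+ 2 by rewrite ltr_pwDl// sqr_ge0.
have [->|x0] := eqVneq x 0.
  by rewrite /qker expr0n invr0 mulr0 mulr_ge0// invr_ge0 ltW.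
have x2 : 0 < x ^+ 2 by rewrite exprn_even_gt0.
rewrite /qker mul1r ler_pdivrMr// mulrAC ler_pdivlMr//.
have h1 := onem_cos_le x; have h2 := cos_geN1 x; have h3 := cos_le1 x.
nra.
Qed.

Lemma integrable_qker1 : leb.-integrable setT (EFin \o qker 1).
Proof.
apply: (le_integrable measurableT _ _ (integrableZl measurableT 4 integrable_invD1sqr)).
  by apply/measurable_EFinP; exact: measurable_qker.
move=> x _; rewrite /= lee_fin ger0_norm ?qker_ge0// ger0_norm ?qker1_le//.
by rewrite mulr_ge0// invr_ge0 addr_ge0// sqr_ge0.
Qed.

(** The substitution [x -> a x] turns [qker 1] into [qker a] up to the factor [a], for [a > 0];
    evenness in [a] produces the absolute value. *)
Lemma ge0_integral_qker a :
  (\int[leb]_x (qker a x)%:E = `|a|%:E * \int[leb]_x (qker 1 x)%:E)%E.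
Proof.
wlog a0 : a / 0 <= a.
  move=> h; have [/h//|/ltW] := leP 0 a.
  rewrite -oppr_ge0 => /h; rewrite normrN => <-.
  by under [RHS]eq_integral do rewrite qkerN.
rewrite ger0_norm//; move: a0; rewrite le_eqVlt => /predU1P[<-|a0].
  rewrite mul0e; under eq_integral do rewrite /qker mul0r cos0 subrr mul0r.
  by rewrite integral0.
rewrite [in RHS](ge0_integral_affine 0 a0); last 2 first.
- by apply/measurable_EFinP; exact: measurable_qker.
- by move=> x; rewrite lee_fin qker_ge0.
rewrite muleA -EFinM -ge0_integralZl//; last 3 first.
- apply/measurable_EFinP; apply: (measurableT_comp (measurable_qker 1)).
  exact: measurable_affine.
- by move=> x _; rewrite lee_fin qker_ge0.
- by rewrite lee_fin mulr_ge0// ltW.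
apply: eq_integral => x _; rewrite -EFinM; congr EFin.
have [->|x0] := eqVneq (x : R) 0.
  by rewrite /qker !mulr0 addr0 mulr0 cos0 subrr !mul0r mulr0.
by rewrite /qker addr0 mul1r; field; rewrite x0 gt_eqF.
Qed.

Lemma integrable_qker a : leb.-integrable setT (EFin \o qker a).
Proof.
apply/integrableP; split; first by apply/measurable_EFinP; exact: measurable_qker.
under eq_integral do rewrite /= ger0_norm ?qker_ge0//.
rewrite ge0_integral_qker; case/integrableP : integrable_qker1 => _.
under eq_integral do rewrite /= ger0_norm ?qker_ge0//.
by move=> h; apply: lte_mul_pinfty.
Qed.

(** This is the number pi, kept as an abstract positive constant: [2 * cfejer] plays the role of
    [2 pi] in the inversion formula. *)
Definition cfejer : R := \int[leb]_x qker 1 x.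

Lemma Rintegral_qker a : \int[leb]_x qker a x = `|a| * cfejer.
Proof.
rewrite /Rintegral ge0_integral_qker fineM//.
exact: integrable_fin_num integrable_qker1.
Qed.

Lemma cfejer_gt0 : 0 < cfejer.
Proof.
have cos1 : cos 1 < 1 :> R.
  rewrite -[ltRHS]cos0 ltr_cos ?in_itv/= ?lexx ?ler01 ?pi_ge0//.
  by rewrite (le_trans _ (pi_ge2 R))// ler1n.
have m12 : leb `[1%R, 2%R] = 1%E.
  rewrite lebesgue_measure_itv/= lte_fin ifT; last by rewrite ltr1n.
  by rewrite -EFinD; congr EFin; lra.
have iq : leb.-integrable `[1%R, 2%R] (EFin \o qker 1).
  exact: (integrableS measurableT) integrable_qker1.
(* On [[1, 2]] the cosine decreases, because [2 <= pi], and [x^2 <= 4]; this bounds the integrand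
   below. *)
have : (1 - cos 1) / 4 <= \int[leb]_(x in `[1%R, 2%R]) qker 1 x.
  apply: (@le_trans _ _ (\int[leb]_(x in `[1%R, 2%R]) ((1 - cos 1) / 4))).
    by rewrite Rintegral_cst// [X in fine X]m12 mulr1.
  apply: le_Rintegral => //.
    apply: measurable_bounded_integrable => //.
      by rewrite [X in (X < _)%E]m12 ltry.
    exact: bounded_cst.
  move=> x; rewrite /= in_itv/= => /andP[x1 x2].
  rewrite /qker mul1r ler_pM ?invr_ge0 ?subr_ge0 ?cos_le1//.
    have pi2 := pi_ge2 R.
    rewrite lerB//; move: x1; rewrite le_eqVlt => /predU1P[<-//|x1].
    by rewrite ltW// ltr_cos// in_itv/=; apply/andP; split; lra.
  by rewrite lef_pV2 ?posrE// ?exprn_gt0//; nra.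
move=> h; apply: lt_le_trans (_ : \int[leb]_(x in `[1%R, 2%R]) qker 1 x <= _).
  by apply: lt_le_trans h; rewrite divr_gt0 ?subr_gt0.
rewrite /cfejer Rintegral_mkcond; apply: le_Rintegral => //.
- by rewrite -restrict_EFin; apply: (proj1 (integrable_mkcond _ _)).
- exact: integrable_qker1.
- by move=> x _; rewrite patchE; case: ifP => // _; exact: qker_ge0.
Qed.

Definition tent (z x : R) : R := Num.max (z - `|x|) 0.

(** The Fourier transform of [tent z] away from [xi = 0]. *)
Definition fejer (z xi : R) : R := 2 * qker z xi.

Lemma tent_even z x : tent z (- x) = tent z x.
Proof. by rewrite /tent normrN. Qed.

Lemma tent_ge0 z x : 0 <= tent z x.
Proof. by rewrite /tent le_max lexx orbT. Qed.

Lemma continuous_tent z : continuous (tent z).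
Proof.
move=> x; apply: (@continuous_max R R (fun x => z - `|x|) (fun=> 0) x).
  by apply: continuousB; [exact: cvg_cst|exact: norm_continuous].
exact: cvg_cst.
Qed.

Lemma measurable_tent z : measurable_fun [set: R] (tent z).
Proof. by apply: continuous_measurable_fun; exact: continuous_tent. Qed.

Lemma integrable_tent (z : R) : 0 <= z -> leb.-integrable setT (EFin \o tent z).
Proof.
move=> z0.
have ib : leb.-integrable setT (fun x : R => z%:E * (\1_`[- z, z]%classic x)%:E)%E.
  by apply: integrableZl => //; exact: integrable_indic_itv.
apply: (le_integrable measurableT _ _ ib).
  by apply/measurable_EFinP; exact: measurable_tent.
move=> x _; rewrite /= lee_fin ger0_norm ?tent_ge0// indicE.
rewrite mem_setE in_itv/= -ler_norml /tent.
have [xz|xz] := leP `|x| z.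
  by rewrite mulr1 [leRHS]ger0_norm// ge_max z0 andbT lerBlDr lerDl.
by rewrite mulr0 normr0 ge_max lexx andbT subr_le0 ltW.
Qed.

(** An inversion formula obtained without a limit: the product-to-sum formula writes the integrand
    as a combination of [qker (z + x)], [qker (z - x)] and [qker x], each integrating to an absolute
    value times [cfejer], and [|z + x| + |z - x| - 2 |x|] is twice the tent. *)
Lemma Rintegral_fejer (z x : R) : 0 <= z ->
  \int[leb]_xi (fejer z xi * cos (xi * x)) = 2 * cfejer * tent z x.
Proof.
move=> z0.
have fE (xi : R) : fejer z xi * cos (xi * x) =
    qker (z + x) xi + qker (z - x) xi - 2 * qker x xi.
  rewrite /fejer /qker (mulrDl z) (mulrBl xi z) cosD cosB (mulrC xi x).
  by move: (xi ^+ 2)^-1 => v; ring.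
transitivity (\int[leb]_xi (qker (z + x) xi + qker (z - x) xi - 2 * qker x xi)).
  by apply: eq_Rintegral => xi _; exact: fE.
have i2 : leb.-integrable setT (EFin \o (fun xi => 2 * qker x xi)).
  by apply: integrable_EFinZl; exact: integrable_qker.
have i1 : leb.-integrable setT (EFin \o (fun xi => qker (z + x) xi + qker (z - x) xi)).
  by apply: integrable_EFinD; exact: integrable_qker.
rewrite RintegralB// RintegralD//; last 2 first.
- exact: integrable_qker.
- exact: integrable_qker.
rewrite RintegralZl//; last exact: integrable_qker.
rewrite !Rintegral_qker /tent.
suff -> : Num.max (z - `|x|) 0 = (`|z + x| + `|z - x|) / 2 - `|x|.
  by move: cfejer => c; lra.
wlog x0 : x {fE i2 i1} / 0 <= x.
  move=> h; have [/h//|/ltW] := leP 0 x.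
  by rewrite -oppr_ge0 => /h; rewrite normrN opprK => ->; rewrite [in RHS]addrC; lra.
rewrite (ger0_norm x0) (ger0_norm (addr_ge0 z0 x0)).
have [xz|xz] := leP x z.
  rewrite (ger0_norm (x := z - x)) ?subr_ge0//.
  by rewrite max_l ?subr_ge0//; lra.
by rewrite ltr0_norm ?subr_lt0// max_r ?subr_le0 ?ltW//; lra.
Qed.

Lemma Rintegral_segment_FTC2 (f F : R -> R) (a b : R) : a <= b ->
  continuous f -> (forall x : R, is_derive x 1 F (f x)) ->
  \int[leb]_(x in `[a, b]) f x = F b - F a.
Proof.
move=> ab cf dF; have cF : continuous F.
  by move=> x; apply: differentiable_continuous; apply/derivable1_diffP; case: (dF x).
move: ab; rewrite le_eqVlt => /predU1P[<-|ab].
  by rewrite set_itv1 Rintegral_set1 subrr.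
rewrite /Rintegral (@continuous_FTC2 _ f F)//.
- exact: continuous_subspaceT.
- split=> [x _| |]; first by case: (dF x).
  + by apply: cvg_at_right_filter; exact: cF.
  + by apply: cvg_at_left_filter; exact: cF.
- by move=> x _; rewrite derive1E; apply: derive_val; exact: dF.
Qed.

(** At [xi = 0] the left side is the area [z^2] of the tent, whereas [fejer z 0] is the default
    value 0; hence the condition on [xi]. *)
Lemma Rintegral_tent (z xi : R) : 0 <= z -> xi != 0 ->
  \int[leb]_x (tent z x * cos (x * xi)) = fejer z xi.
Proof.
move=> z0 xi0.
pose f x := tent z x * cos (x * xi).
have mcos : continuous (fun x : R => cos (x * xi)).
  move=> x; apply: continuous_comp; last exact: continuous_cos.
  by apply: mulrr_continuous.
have intf : leb.-integrable setT (EFin \o f).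
  apply: integrableM_le1 => //; first exact: integrable_tent.
    exact: continuous_measurable_fun.
  by move=> x; exact: cos_max.
have fE : \int[leb]_x f x = \int[leb]_(x in `[- z, z]) f x.
  rewrite [RHS]Rintegral_mkcond; apply: eq_Rintegral => x _.
  rewrite patchE mem_setE in_itv/= -ler_norml; case: leP => // zx.
  by rewrite /f /tent max_r ?mul0r// subr_le0 ltW.
have ints : leb.-integrable `[- z, z] (EFin \o f).
  exact: (integrableS measurableT) intf.
have Nz : - z <= 0 by rewrite oppr_le0.
(* An antiderivative of [(z + e x) cos (x xi)], found by integration by parts; [e = 1] serves the
   left half of the tent and [e = -1] the right half. *)
pose F (e x : R) := (z + e * x) * sin (x * xi) / xi + e * cos (x * xi) / xi ^+ 2.
have dF (e x : R) : is_derive x 1 (F e) ((z + e * x) * cos (x * xi)).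
  apply: is_derive_eq; rewrite /GRing.scale/= /GRing.scale/=.
  by field.
have cdF e : continuous (fun x : R => (z + e * x) * cos (x * xi)).
  move=> x; apply: cvgM; last exact: mcos.
  by apply: cvgD; [exact: cvg_cst|exact: mulrl_continuous].
rewrite -/(f _) fE.
have := Rintegral_itvB ints (_ : BLeft (- z) <= BRight 0)%O (_ : BRight 0 <= BRight z)%O.
rewrite !bnd_simp => /(_ Nz z0) /eqP; rewrite subr_eq => /eqP ->.
rewrite Rintegral_itv_obnd_cbnd; last first.
  apply: (integrableS measurableT) intf => //.
have -> : \int[leb]_(x in `[0, z]) f x = F (-1) z - F (-1) 0.
  rewrite -(Rintegral_segment_FTC2 z0 (cdF (-1)) (dF (-1))); apply: eq_Rintegral => x.
  rewrite inE/= in_itv/= => /andP[x0 xz].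
  by rewrite /f /tent mulN1r ger0_norm// max_l// subr_ge0.
have -> : \int[leb]_(x in `[- z, 0]) f x = F 1 0 - F 1 (- z).
  rewrite -(Rintegral_segment_FTC2 Nz (cdF 1) (dF 1)); apply: eq_Rintegral => x.
  rewrite inE/= in_itv/= => /andP[x0 xz].
  by rewrite /f /tent mul1r ler0_norm// opprK max_l// -lerBlDl sub0r.
rewrite /F /fejer /qker !mulr0 !mul0r !mul1r subrr !mul0r mulN1r subrr !mul0r.
rewrite sin0 cos0 (mulNr z xi) cosN.
by field.
Qed.

Lemma qker_fejer_even z x : fejer z (- x) = fejer z x.
Proof. by rewrite /fejer qker_even. Qed.

Lemma integrable_fejer z : leb.-integrable setT (EFin \o fejer z).
Proof. by apply: integrable_EFinZl; exact: integrable_qker. Qed.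

Lemma measurable_cosM (xi : R) : measurable_fun [set: R] (fun x => cos (x * xi)).
Proof.
apply: (@measurableT_comp _ _ _ _ _ _ (@cos R)); last exact: mulrr_measurable.
by apply: continuous_measurable_fun; exact: continuous_cos.
Qed.

Lemma measurable_sinM (xi : R) : measurable_fun [set: R] (fun x => sin (x * xi)).
Proof.
apply: (@measurableT_comp _ _ _ _ _ _ (@sin R)); last exact: mulrr_measurable.
by apply: continuous_measurable_fun; exact: continuous_sin.
Qed.

(** A difference quotient of tents is a continuous substitute for the indicator of [[-w, w]]. Unlike
    that of the indicator, its Fourier transform [ftrap] is integrable. *)
Definition trap (w d x : R) : R := d^-1 * (tent (w + d) x - tent w x).

Definition ftrap (w d x : R) : R := d^-1 * (fejer (w + d) x - fejer w x).

Section trapezoid.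
Variables w d : R.
Hypotheses (w0 : 0 <= w) (d0 : 0 < d).

Let wd0 : 0 <= w + d. Proof. by rewrite addr_ge0// ltW. Qed.

Lemma integrable_trap : leb.-integrable setT (EFin \o trap w d).
Proof.
by apply: integrable_EFinZl; apply: integrable_EFinB; exact: integrable_tent.
Qed.

Lemma integrable_ftrap : leb.-integrable setT (EFin \o ftrap w d).
Proof.
by apply: integrable_EFinZl; apply: integrable_EFinB; exact: integrable_fejer.
Qed.

Let integrable_cos (f : R -> R) xi : leb.-integrable setT (EFin \o f) ->
  leb.-integrable setT (EFin \o (fun x => f x * cos (x * xi))).
Proof.
move=> intf; apply: integrableM_le1 => //; first exact: measurable_cosM.
by move=> x; exact: cos_max.
Qed.

Let Rintegral_even_sin (f : R -> R) xi : leb.-integrable setT (EFin \o f) ->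
  (forall x, f (- x) = f x) -> \int[leb]_x (f x * sin (x * xi)) = 0.
Proof.
move=> intf fN; apply: Rintegral_odd.
  apply: integrableM_le1 => //; first exact: measurable_sinM.
  by move=> x; exact: sin_max.
by move=> x; rewrite fN mulNr sinN mulrN.
Qed.

Lemma Rintegral_trap_sin xi : \int[leb]_x (trap w d x * sin (x * xi)) = 0.
Proof.
apply: Rintegral_even_sin; first exact: integrable_trap.
by move=> x; rewrite /trap !tent_even.
Qed.

Lemma Rintegral_ftrap_sin x : \int[leb]_xi (ftrap w d xi * sin (xi * x)) = 0.
Proof.
apply: Rintegral_even_sin; first exact: integrable_ftrap.
by move=> xi; rewrite /ftrap !qker_fejer_even.
Qed.

Lemma Rintegral_trap_cos xi : xi != 0 ->
  \int[leb]_x (trap w d x * cos (x * xi)) = ftrap w d xi.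
Proof.
move=> xi0; transitivity (\int[leb]_x (d^-1 *
   (tent (w + d) x * cos (x * xi) - tent w x * cos (x * xi)))).
  by apply: eq_Rintegral => x _; rewrite /trap; ring.
have it z : 0 <= z -> leb.-integrable setT (EFin \o (fun x => tent z x * cos (x * xi))).
  by move=> z0; apply: integrable_cos; exact: integrable_tent.
rewrite RintegralZl//; last by apply: integrable_EFinB; exact: it.
rewrite RintegralB//; [|exact: it|exact: it].
by rewrite !Rintegral_tent.
Qed.

Lemma Rintegral_ftrap_cos x :
  \int[leb]_xi (ftrap w d xi * cos (xi * x)) = 2 * cfejer * trap w d x.
Proof.
transitivity (\int[leb]_xi (d^-1 *
   (fejer (w + d) xi * cos (xi * x) - fejer w xi * cos (xi * x)))).
  by apply: eq_Rintegral => xi _; rewrite /ftrap; ring.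
have it z : leb.-integrable setT (EFin \o (fun xi => fejer z xi * cos (xi * x))).
  by apply: integrable_cos; exact: integrable_fejer.
rewrite RintegralZl//; last by apply: integrable_EFinB; exact: it.
rewrite RintegralB//.
by rewrite !Rintegral_fejer// /trap; ring.
Qed.

Lemma trap_eq1 x : `|x| <= w -> trap w d x = 1.
Proof.
move=> xw; rewrite /trap /tent !max_l ?subr_ge0//; last first.
  by rewrite (le_trans xw)// lerDl ltW.
by field; rewrite gt_eqF.
Qed.

Lemma trap_eq0 x : w + d <= `|x| -> trap w d x = 0.
Proof.
move=> xw; rewrite /trap /tent !max_r ?subr_le0//; last first.
  by rewrite (le_trans _ xw)// lerDl ltW.
by rewrite subrr mulr0.
Qed.

Lemma trap_ge0_le1 x : 0 <= trap w d x <= 1.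
Proof.
have [/trap_eq1->|wx] := leP `|x| w; first by rewrite ler01 lexx.
have [/trap_eq0->|xwd] := leP (w + d) `|x|; first by rewrite lexx ler01.
rewrite /trap /tent max_l ?subr_ge0 ?(ltW xwd)// max_r ?subr_le0 ?(ltW wx)// subr0.
rewrite mulrC ler_pdivlMr// mul0r ler_pdivrMr// mul1r; apply/andP; split; lra.
Qed.

End trapezoid.

End fejer_kernel.

Section ae_eq_boxes.
Context {R : realType} {n : nat}.
Local Notation mu := (lebesgue_tuple R n).
Local Open Scope ereal_scope.

(** Viewed as densities, [f] and [g] define measures that agree on closed boxes, hence on all
    measurable sets. On each cube of an exhaustion the integrals are finite, and functions with the
    same integrals over all subsets agree almost everywhere. *)
Lemma ge0_ae_eq_cbox (f g : n.-tuple R -> \bar R) :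
  measurable_fun setT f -> measurable_fun setT g ->
  (forall x, 0 <= f x) -> (forall x, 0 <= g x) ->
  (forall a b, \int[mu]_(x in cbox a b) f x < +oo) ->
  (forall a b, \int[mu]_(x in cbox a b) f x = \int[mu]_(x in cbox a b) g x) ->
  {ae mu, forall x, f x = g x}.
Proof.
move=> mf mg f0 g0 foo fg.
have density h : (forall x, 0 <= h x) -> measurable_fun setT h ->
    {m : {measure set (n.-tuple R) -> \bar R} | forall A, m A = \int[mu]_(t in A) h t}.
  move=> h0 mh.
  have i0 : \int[mu]_(t in set0) h t = 0 by rewrite integral_set0.
  have ige0 A : 0 <= \int[mu]_(t in A) h t by apply: integral_ge0.
  have isa := semi_sigma_additive_nng_induced (mu := mu) mh h0.
  pose m : {measure set (n.-tuple R) -> \bar R} :=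
    HB.pack (fun A => \int[mu]_(t in A) h t)
      (isMeasure.Build _ _ _ (fun A => \int[mu]_(t in A) h t) i0 ige0 isa).
  by exists m.
have [m1 m1E] := density f f0 mf; have [m2 m2E] := density g g0 mg.
have fgA A : measurable A -> \int[mu]_(x in A) f x = \int[mu]_(x in A) g x.
  move=> mA; rewrite -m1E -m2E; apply: cbox_measure_unique mA => a b; last by rewrite m1E.
  by rewrite m1E m2E.
pose B k : set (n.-tuple R) := cbox (fun=> - k%:R)%R (fun=> k%:R).
have fgB k : ae_eq mu (B k) f g.
  apply: integral_ae_eq.
  - exact: measurable_cbox.
  - apply/integrableP; split; first exact: measurable_funTS.
    under eq_integral do rewrite gee0_abs//.
    exact: foo.
  - exact: measurable_funTS.
  - by move=> E _; exact: fgA.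
have := ae_foralln fgB; apply: filterS => x fgx.
have : [set: n.-tuple R] x by [].
by rewrite -bigcup_cbox => -[k _ /fgx].
Qed.

End ae_eq_boxes.

(** Tonelli's theorem applies to the positive and negative parts separately. At parameters where the
    integral is infinite [fine] returns 0, so the function stays measurable on the whole space. *)
Lemma measurable_Rintegral_param (R : realType) d1 d2 (T1 : measurableType d1)
    (T2 : measurableType d2) (m : {sigma_finite_measure set T2 -> \bar R})
    (F : T1 * T2 -> R) :
  measurable_fun setT F -> measurable_fun setT (fun x => \int[m]_y F (x, y)).
Proof.
move=> mF; apply: measurableT_comp; first exact: fine_measurable.
rewrite (_ : (fun x => _) = (fun x => \int[m]_y (EFin \o F)^\+ (x, y) -
    \int[m]_y (EFin \o F)^\- (x, y))%E).
  have mF' : measurable_fun setT (EFin \o F) by exact/measurable_EFinP.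
  apply: emeasurable_funB.
    by apply: (measurable_fun_fubini_tonelli_F (EFin \o F)^\+%E) => //;
      exact: measurable_funepos.
  by apply: (measurable_fun_fubini_tonelli_F (EFin \o F)^\-%E) => //;
    exact: measurable_funeneg.
apply/funext => x; rewrite integralE; congr (_ - _)%E; apply: eq_integral => y _;
  by rewrite ?funeposE ?funenegE.
Qed.

Section fourier_inversion.
Context {R : realType} {n : nat}.
Local Notation mu := (lebesgue_tuple R n).
Variables (f fh : n.-tuple R -> R).
Hypotheses (intf : mu.-integrable setT (EFin \o f))
           (intfh : mu.-integrable setT (EFin \o fh))
           (fcos : forall xi, \int[mu]_x (f x * cos (dot x xi)) = fh xi)
           (fsin : forall xi, \int[mu]_x (f x * sin (dot x xi)) = 0).

Definition inverse_fourier (x : n.-tuple R) : R :=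
  (2 * cfejer) ^- n * \int[mu]_xi (fh xi * cos (dot x xi)).

Let c : R := 2 * cfejer.

Let c0 : c != 0. Proof. by rewrite mulf_neq0// gt_eqF// cfejer_gt0. Qed.

Lemma dotC (x y : n.-tuple R) : dot x y = dot y x.
Proof. by apply: eq_bigr => i _; rewrite mulrC. Qed.

Lemma dot_vsubl (x y z : n.-tuple R) : dot (vsub x y) z = dot x z - dot y z.
Proof.
rewrite /dot -sumrB; apply: eq_bigr => i _.
by rewrite tnth_mktuple mulrBl.
Qed.

Lemma measurable_cos_dot (y : n.-tuple R) :
  measurable_fun setT (fun x : n.-tuple R => cos (dot x y)).
Proof.
apply: (@measurableT_comp _ _ _ _ _ _ (@cos R)).
  by apply: continuous_measurable_fun; exact: continuous_cos.
by apply: measurable_dot; [exact: measurable_id|exact: measurable_cst].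
Qed.

Lemma measurable_sin_dot (y : n.-tuple R) :
  measurable_fun setT (fun x : n.-tuple R => sin (dot x y)).
Proof.
apply: (@measurableT_comp _ _ _ _ _ _ (@sin R)).
  by apply: continuous_measurable_fun; exact: continuous_sin.
by apply: measurable_dot; [exact: measurable_id|exact: measurable_cst].
Qed.

Lemma measurable_cos_dot2 :
  measurable_fun setT (fun z : n.-tuple R * n.-tuple R => cos (dot z.1 z.2)).
Proof.
apply: (@measurableT_comp _ _ _ _ _ _ (@cos R)).
  by apply: continuous_measurable_fun; exact: continuous_cos.
by apply: measurable_dot; [exact: measurable_fst|exact: measurable_snd].
Qed.

(** Serves twice to discard the coordinate hyperplanes: the transform of a trapezoid is only known
    for a nonzero frequency, and the product bound for [|y|^(-e)] needs every coordinate of [y] to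
    be nonzero. *)
Lemma ae_tnth_neq0 : {ae mu, forall x : n.-tuple R, forall i, tnth x i != 0}.
Proof.
apply: filter_forall => i.
exists [set x : n.-tuple R | forall j, (if j == i then [set 0] else setT) (tnth x j)].
split.
- rewrite (_ : mkset _ = \bigcap_(j in [set: 'I_n])
    ((fun x : n.-tuple R => tnth x j) @^-1` (if j == i then [set 0] else setT))); last first.
    by apply/seteqP; split=> [x h j _|x h j]; exact: h.
  apply: fin_bigcap_measurable => // j _.
  rewrite -[X in measurable X]setTI; apply: measurable_tnthT => //.
  by case: ifP.
- rewrite (@lebesgue_tuple_box R n (fun j => if j == i then [set 0] else setT)); last first.
    by move=> j; case: ifP.
  by rewrite (bigD1 i)//= eqxx [X in (X * _)%E](lebesgue_measure_set1 0) mul0e.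
- by move=> x /= /negP; rewrite negbK => /eqP xi0 j; case: ifPn => // /eqP ->.
Qed.

Lemma Rintegral_cos_vsub y xi :
  \int[mu]_x (f x * cos (dot (vsub x y) xi)) = fh xi * cos (dot y xi).
Proof.
transitivity (\int[mu]_x (cos (dot y xi) * (f x * cos (dot x xi)) +
    sin (dot y xi) * (f x * sin (dot x xi)))).
  by apply: eq_Rintegral => x _; rewrite dot_vsubl cosB; ring.
have ic : mu.-integrable setT (EFin \o (fun x => f x * cos (dot x xi))).
  by apply: integrableM_le1 => //; [exact: measurable_cos_dot|move=> x; exact: cos_max].
have is' : mu.-integrable setT (EFin \o (fun x => f x * sin (dot x xi))).
  by apply: integrableM_le1 => //; [exact: measurable_sin_dot|move=> x; exact: sin_max].
rewrite RintegralD//; [|exact: integrable_EFinZl|exact: integrable_EFinZl].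
by rewrite !RintegralZl// fcos fsin mulr0 addr0 mulrC.
Qed.

Lemma measurable_inverse_fourier : measurable_fun setT inverse_fourier.
Proof.
apply: measurable_funM => //.
apply: (measurable_Rintegral_param _ (F := fun z => fh z.2 * cos (dot z.1 z.2))).
apply: measurable_funM; last exact: measurable_cos_dot2.
by apply: measurableT_comp => //; exact: integrable_EFin_measurable intfh.
Qed.

Lemma normr_inverse_fourier_le x :
  `|inverse_fourier x| <= c ^- n * \int[mu]_xi `|fh xi|.
Proof.
have cn0 : 0 <= c ^- n.
  by rewrite invr_ge0 exprn_ge0// mulr_ge0// ltW// cfejer_gt0.
rewrite normrM ger0_norm// ler_wpM2l//.
have mcos : measurable_fun setT (fun xi => cos (dot x xi)).
  apply: (@measurableT_comp _ _ _ _ _ _ (@cos R)).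
    by apply: continuous_measurable_fun; exact: continuous_cos.
  by apply: measurable_dot; [exact: measurable_cst|exact: measurable_id].
have ic := integrableM_le1 intfh mcos (fun x => cos_max _).
apply: (le_trans (le_normr_Rintegral measurableT ic)).
apply: (le_Rintegral measurableT).
- exact: (integrable_norm ic).
- exact: (integrable_norm intfh).
- by move=> xi _; rewrite normrM ler_piMr// cos_max.
Qed.

Section against_trapezoids.
Variables (y : n.-tuple R) (w : 'I_n -> R) (d : R).
Hypotheses (w0 : forall i, 0 <= w i) (d0 : 0 < d).

Let P := prodr (fun i => trap (w i) d).
Let G := prodr (fun i => ftrap (w i) d).

Let intP : mu.-integrable setT (EFin \o P).
Proof. by apply: integrable_prodr => i; exact: integrable_trap. Qed.

Let intG : mu.-integrable setT (EFin \o G).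
Proof. by apply: integrable_prodr => i; exact: integrable_ftrap. Qed.

Let GcosE z : \int[mu]_xi (G xi * cos (dot xi z)) = c ^+ n * P z.
Proof.
have [-> _] := @Rintegral_prodr_cos_sin R n (fun i => ftrap (w i) d) z
  (fun i => integrable_ftrap _ _) (fun i => Rintegral_ftrap_sin _ _ _).
under eq_bigr do rewrite Rintegral_ftrap_cos//.
by rewrite big_split/= prodr_const card_ord.
Qed.

Let P_ge0_le1 x : 0 <= P x <= 1.
Proof.
apply/andP; split; first by apply: prodr_ge0 => i _; have /andP[] := trap_ge0_le1 (w i) d0 (tnth x i).
by apply: prodr_ile1 => i _; exact: trap_ge0_le1.
Qed.

Let measurable_Pv : measurable_fun setT (fun x => P (vsub x y)).
Proof. exact: integrable_EFin_measurable (integrable_vsubl y intP). Qed.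

Let normr_Pv x : `|P (vsub x y)| <= 1.
Proof. by have /andP[P0 P1] := P_ge0_le1 (vsub x y); rewrite ger0_norm. Qed.

(** By [GcosE], [c^n P] is the cosine transform of [G]. Exchanging the integrals puts the cosine on
    [f], whose transform is [fh]. *)
Lemma Rintegral_mul_trap :
  c ^+ n * \int[mu]_x (f x * P (vsub x y)) =
  \int[mu]_xi (G xi * (fh xi * cos (dot y xi))).
Proof.
have mh : measurable_fun setT (fun z : n.-tuple R * n.-tuple R => cos (dot (vsub z.1 y) z.2)).
  apply: (@measurableT_comp _ _ _ _ _ _ (@cos R)).
    by apply: continuous_measurable_fun; exact: continuous_cos.
  by apply: measurable_dot => //; apply: measurable_vsub => //; exact: measurable_cst.
have swap := Rintegral_swap_kernel intf intG mh (fun z => cos_max _).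
have ifP := integrableM_le1 intf measurable_Pv normr_Pv.
rewrite -(RintegralZl _ measurableT ifP).
transitivity (\int[mu]_x (f x * \int[mu]_xi (G xi * cos (dot (vsub x y) xi)))).
  apply: eq_Rintegral => x _; rewrite mulrCA -GcosE; congr (_ * _).
  by apply: eq_Rintegral => xi _; rewrite dotC.
rewrite [LHS]swap; apply: eq_Rintegral => xi _.
by rewrite -Rintegral_cos_vsub.
Qed.

Let Pcos xi : \int[mu]_x (P (vsub x y) * cos (dot x xi)) =
  cos (dot y xi) * \int[mu]_x (P x * cos (dot x xi)).
Proof.
have mcyx : measurable_fun setT (fun x => cos (dot x xi + dot y xi)).
  apply: (@measurableT_comp _ _ _ _ _ _ (@cos R)).
    by apply: continuous_measurable_fun; exact: continuous_cos.
  apply: measurable_funD => //.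
  by apply: measurable_dot; [exact: measurable_id|exact: measurable_cst].
transitivity (\int[mu]_x (P x * cos (dot x xi + dot y xi))).
  have := Rintegral_vsubl y (integrableM_le1 intP mcyx (fun x => cos_max _)).
  move=> <-; apply: eq_Rintegral => x _.
  by rewrite dot_vsubl subrK.
transitivity (\int[mu]_x (cos (dot y xi) * (P x * cos (dot x xi)) -
    sin (dot y xi) * (P x * sin (dot x xi)))).
  by apply: eq_Rintegral => x _; rewrite cosD; ring.
have ic := integrableM_le1 intP (measurable_cos_dot xi) (fun x => cos_max _).
have is' := integrableM_le1 intP (measurable_sin_dot xi) (fun x => sin_max _).
rewrite (RintegralB measurableT (integrable_EFinZl _ ic) (integrable_EFinZl _ is')).
rewrite (RintegralZl _ measurableT ic) (RintegralZl _ measurableT is').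
have [_ ->] := @Rintegral_prodr_cos_sin R n (fun i => trap (w i) d) xi
  (fun i => integrable_trap (w0 i) d0) (fun i => Rintegral_trap_sin (w0 i) d0 _).
by rewrite mulr0 subr0.
Qed.

Let PcosG : {ae mu, forall xi, \int[mu]_x (P x * cos (dot x xi)) = G xi}.
Proof.
have := ae_tnth_neq0; apply: filterS => xi xi0.
have [-> _] := @Rintegral_prodr_cos_sin R n (fun i => trap (w i) d) xi
  (fun i => integrable_trap (w0 i) d0) (fun i => Rintegral_trap_sin (w0 i) d0 _).
by apply: eq_bigr => i _; rewrite Rintegral_trap_cos.
Qed.

(** The same right-hand side as for [f], reached from the other end: here the cosine in
    [inverse_fourier] is put on [P], whose transform is [G] almost everywhere. *)
Lemma Rintegral_inverse_fourier_mul_trap :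
  c ^+ n * \int[mu]_x (inverse_fourier x * P (vsub x y)) =
  \int[mu]_xi (G xi * (fh xi * cos (dot y xi))).
Proof.
have intPv := integrable_vsubl y intP.
have iKP : mu.-integrable setT (EFin \o (fun x => inverse_fourier x * P (vsub x y))).
  pose M := c ^- n * \int[mu]_xi `|fh xi|.
  apply: (le_integrable measurableT _ _ (integrable_EFinZl M intPv)).
    by apply/measurable_EFinP/measurable_funM => //; exact: measurable_inverse_fourier.
  move=> x _ /=; rewrite lee_fin (normrM (inverse_fourier x)) (normrM M) ler_wpM2r//.
  by rewrite (le_trans (normr_inverse_fourier_le x)) ?ler_norm.
rewrite -(RintegralZl _ measurableT iKP).
have swap := Rintegral_swap_kernel intPv intfh measurable_cos_dot2 (fun z => cos_max _).
transitivity (\int[mu]_x (P (vsub x y) * \int[mu]_xi (fh xi * cos (dot x xi)))).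
  apply: eq_Rintegral => x _; rewrite /inverse_fourier -/c mulrA.
  by rewrite (mulVKf (expf_neq0 n c0)) mulrC.
rewrite [LHS]swap /=.
under eq_Rintegral do rewrite Pcos.
have mfh := integrable_EFin_measurable intfh.
have mcos : measurable_fun setT (fun xi => cos (dot y xi)).
  apply: (@measurableT_comp _ _ _ _ _ _ (@cos R)).
    by apply: continuous_measurable_fun; exact: continuous_cos.
  by apply: measurable_dot; [exact: measurable_cst|exact: measurable_id].
have mPc : measurable_fun setT (fun xi => \int[mu]_x (P x * cos (dot x xi))).
  apply: (measurable_Rintegral_param _ (F := fun z => P z.2 * cos (dot z.2 z.1))).
  apply: measurable_funM.
    exact: (measurableT_comp (integrable_EFin_measurable intP) measurable_snd).
  apply: (measurableT_comp measurable_cos_dot2 (g := fun z => (z.2, z.1))).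
  by apply: measurable_fun_pair; [exact: measurable_snd|exact: measurable_fst].
apply: ae_eq_Rintegral.
- exact: measurable_funM mfh (measurable_funM mcos mPc).
- exact: measurable_funM (integrable_EFin_measurable intG) (measurable_funM mfh mcos).
- by apply: filterS PcosG => xi ->; ring.
Qed.

Lemma Rintegral_mul_trap_inverse_fourier :
  \int[mu]_x (f x * P (vsub x y)) = \int[mu]_x (inverse_fourier x * P (vsub x y)).
Proof.
apply: (mulfI (expf_neq0 n c0)).
by rewrite Rintegral_mul_trap Rintegral_inverse_fourier_mul_trap.
Qed.

End against_trapezoids.

Let box_center (a b : 'I_n -> R) : n.-tuple R := [tuple (a i + b i) / 2 | i < n].

Let box_radius (a b : 'I_n -> R) i : R := (b i - a i) / 2.

Let Phi a b (k : nat) (x : n.-tuple R) : R :=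
  prodr (fun i => trap (box_radius a b i) k.+1%:R^-1) (vsub x (box_center a b)).

Let cbox_radius a b x : cbox a b x <->
  forall i, `|tnth (vsub x (box_center a b)) i| <= box_radius a b i.
Proof.
split=> h i; move: (h i); rewrite !tnth_mktuple ler_norml /box_radius;
  by move=> /andP[h1 h2]; apply/andP; split; lra.
Qed.

Let Phi_in a b k x : cbox a b x -> Phi a b k x = 1.
Proof.
move=> /cbox_radius abx; rewrite /Phi /prodr big1// => i _.
by rewrite trap_eq1.
Qed.

Let Phi_cvg a b x : Phi a b k x @[k --> \oo] --> (\1_(cbox a b) x : R).
Proof.
have [abx|abx] := pselect (cbox a b x).
  rewrite indicE mem_set//; under eq_cvg do rewrite Phi_in//.
  exact: cvg_cst.
rewrite indicE memNset//=.
have [i xi] : exists i, box_radius a b i < `|tnth (vsub x (box_center a b)) i|.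
  apply: contrapT => /forallNP h; apply: abx; apply/cbox_radius => i.
  by rewrite leNgt; apply/negP; exact: h.
apply: cvg_near_cst.
pose e := `|tnth (vsub x (box_center a b)) i| - box_radius a b i.
have e0 : 0 < e by rewrite subr_gt0.
near=> k; rewrite /Phi /prodr (bigD1 i)//= trap_eq0 ?mul0r//.
rewrite -lerBrDl -/e ltW//.
near: k; exact: (near_infty_natSinv_lt (PosNum e0)).
Unshelve. all: by end_near. Qed.

(** A single wider product of trapezoids that dominates [Phi a b k] for all [k], since [Phi a b k]
    is supported within distance [1/(k+1) <= 1] of the box in each direction. *)
Let Phi0 a b (x : n.-tuple R) : R :=
  prodr (fun i => trap (box_radius a b i + 1) 1) (vsub x (box_center a b)).

Let Phi_le a b k x : (forall i, a i <= b i) -> 0 <= Phi a b k x <= Phi0 a b x.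
Proof.
move=> ab; have k0 : 0 < k.+1%:R^-1 :> R by rewrite invr_gt0.
rewrite /Phi prodr_ge0//=; last first.
  by move=> i _; have /andP[] := trap_ge0_le1 (box_radius a b i) k0
    (tnth (vsub x (box_center a b)) i).
apply: ler_prod => i _; have /andP[-> h1] := trap_ge0_le1 (box_radius a b i) k0
    (tnth (vsub x (box_center a b)) i).
have [xi|xi] := leP `|tnth (vsub x (box_center a b)) i| (box_radius a b i + 1).
  by rewrite [leRHS]trap_eq1.
rewrite trap_eq0//; first by have /andP[] := trap_ge0_le1 (box_radius a b i + 1)
  ltr01 (tnth (vsub x (box_center a b)) i).
by rewrite (le_trans _ (ltW xi))// lerD2l invf_le1// ler1n.
Qed.

Let M : R := c ^- n * \int[mu]_xi `|fh xi|.

Let M0 : 0 <= M.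
Proof. exact: le_trans (normr_ge0 _) (normr_inverse_fourier_le [tuple 0 | i < n]). Qed.

Let intPhi0 a b : (forall i, a i <= b i) ->
  mu.-integrable setT (EFin \o Phi0 a b).
Proof.
move=> ab; apply: integrable_vsubl; apply: integrable_prodr => i.
by apply: integrable_trap => //; rewrite addr_ge0// divr_ge0// subr_ge0.
Qed.

Let mPhi a b k : (forall i, a i <= b i) -> measurable_fun setT (Phi a b k).
Proof.
move=> ab; apply: (@integrable_EFin_measurable _ _ _ mu).
apply: integrable_vsubl; apply: integrable_prodr => i.
by apply: integrable_trap => //; rewrite ?invr_gt0// divr_ge0// subr_ge0.
Qed.

(** On the box it is at least [|f| + 2 M]. The factor 2 is there for the functions shifted by [M] in
    [fourier_inversion_ae]: [inverse_fourier + M] can be as large as [2 M]. *)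
Let dom a b x : R := `|f x| + 2 * M * Phi0 a b x.

Let intdom a b : (forall i, a i <= b i) -> mu.-integrable setT (EFin \o dom a b).
Proof.
move=> ab; apply: integrable_EFinD; first exact: (integrable_norm intf).
by apply: integrable_EFinZl; exact: intPhi0.
Qed.

Let h x := f x - inverse_fourier x.

Let mf := integrable_EFin_measurable intf.

Let mh : measurable_fun setT h.
Proof. exact: measurable_funB mf measurable_inverse_fourier. Qed.

(** The integrals of [h] against all [Phi a b k] vanish because [f] and its inverse transform have
    the same pairings with trapezoids; dominated convergence replaces [Phi a b k] by the indicator
    of the box. *)
Let Rintegral_h_cbox a b : (forall i, a i <= b i) ->
  \int[mu]_(x in cbox a b) h x = 0.
Proof.
move=> ab; rewrite Rintegral_mkcond.
have hPhi k : (\int[mu]_x (h x * Phi a b k x)%:E = 0)%E.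
  have Phi1 x : `|Phi a b k x| <= 1.
    have k0 : 0 < k.+1%:R^-1 :> R by rewrite invr_gt0.
    rewrite ger0_norm; last by have /andP[] := Phi_le k x ab.
    by apply: prodr_ile1 => i _; exact: trap_ge0_le1.
  have dPhi0 x : 0 <= M * Phi0 a b x.
    by rewrite mulr_ge0//; have /andP[p0] := Phi_le k x ab; exact: le_trans.
  have i1 := integrableM_le1 intf (mPhi k ab) Phi1.
  have i2 : mu.-integrable setT (EFin \o (fun x => inverse_fourier x * Phi a b k x)).
    apply: (le_integrable measurableT _ _ (integrable_EFinZl M (intPhi0 ab))).
      by apply/measurable_EFinP; exact: measurable_funM measurable_inverse_fourier (mPhi k ab).
    move=> x _ /=; rewrite lee_fin [leRHS]ger0_norm// normrM ler_pM//.
      exact: normr_inverse_fourier_le.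
    by have /andP[p0 p1] := Phi_le k x ab; rewrite ger0_norm.
  under eq_integral do rewrite /h mulrBl EFinB.
  rewrite integralB_EFin//; apply/eqP; rewrite sube_eq; last 2 first.
  - exact: integrable_fin_num i1.
  - by rewrite fin_num_adde_defl//; exact: integrable_fin_num i2.
  rewrite add0e -[eqbLHS]fineK; last exact: integrable_fin_num i1.
  rewrite -[eqbRHS]fineK; last exact: integrable_fin_num i2.
  apply/eqP; congr EFin; apply: Rintegral_mul_trap_inverse_fourier.
    by move=> i; rewrite divr_ge0// subr_ge0.
  by rewrite invr_gt0.
have hcvg x : (h x * Phi a b k x)%:E @[k --> \oo] --> ((h \_ (cbox a b)) x)%:E.
  apply: cvg_EFin; first exact: nearW.
  rewrite (_ : (h \_ _) x = h x * \1_(cbox a b) x); last first.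
    by rewrite patchE indicE; case: ifP => _; rewrite ?mulr1 ?mulr0.
  by apply: cvgM; [exact: cvg_cst|exact: Phi_cvg].
have hbound k x : (`|(h x * Phi a b k x)%:E| <= (dom a b x)%:E)%E.
  rewrite lee_fin normrM /dom.
  have /andP[p0 p1] := Phi_le k x ab.
  have Phi1 : Phi a b k x <= 1.
    by apply: prodr_ile1 => i _; apply: trap_ge0_le1; rewrite invr_gt0.
  have hM : `|h x| <= `|f x| + M.
    by rewrite (le_trans (ler_normB _ _))// lerD2l normr_inverse_fourier_le.
  rewrite (ger0_norm p0) (le_trans (ler_wpM2r p0 hM))// mulrDl lerD//.
    by rewrite ler_piMr.
  rewrite (le_trans (ler_wpM2l M0 p1))// ler_wpM2r//; first exact: le_trans p1.
  by rewrite ler_peMl// ler1n.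
have := dominated_cvg measurableT (f_ := fun k x => (h x * Phi a b k x)%:E)
  (f := EFin \o (h \_ (cbox a b))) (g := EFin \o dom a b)
  (fun k => proj2 (measurable_EFinP _ _) (measurable_funM mh (mPhi k ab)))
  (fun x _ => hcvg x) (fun x _ => isT) (intdom ab) (fun k x _ => hbound k x).
under eq_cvg do rewrite hPhi.
move=> /(cvg_unique _ (cvg_cst 0%E)) h0.
by rewrite /Rintegral -h0.
Qed.

Lemma fourier_inversion_ae : (forall x, 0 <= f x) ->
  {ae mu, forall x, f x = inverse_fourier x}.
Proof.
move=> f0.
(* A priori [inverse_fourier] may be negative, but it is at least [-M]. Adding [M] to both functions
   makes them nonnegative densities, as the comparison on boxes requires. *)
have mfM : measurable_fun setT (EFin \o (fun x => f x + M)).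
  by apply/measurable_EFinP; exact: measurable_funD mf (measurable_cst _).
have mKM : measurable_fun setT (EFin \o (fun x => inverse_fourier x + M)).
  by apply/measurable_EFinP; exact: measurable_funD measurable_inverse_fourier (measurable_cst _).
have fM0 x : 0 <= f x + M by rewrite addr_ge0.
have KM0 x : 0 <= inverse_fourier x + M.
  by have := normr_inverse_fourier_le x; rewrite ler_norml -/M => /andP[+ _]; rewrite -lerBlDr sub0r.
have Phi01 a b x : (forall i, a i <= b i) -> cbox a b x -> Phi0 a b x >= 1.
  by move=> ab abx; rewrite -(Phi_in 0 abx); have /andP[] := Phi_le 0 x ab.
have dom_ge a b x : (forall i, a i <= b i) -> cbox a b x -> `|f x| + 2 * M <= dom a b x.
  move=> ab abx; rewrite /dom lerD2l.
  have M2 : 0 <= 2 * M by rewrite mulr_ge0.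
  exact: ler_peMr M2 (Phi01 _ _ _ ab abx).
have itf a b : (forall i, a i <= b i) -> mu.-integrable (cbox a b) (EFin \o (fun x => f x + M)).
  move=> ab; have mc := measurable_cbox a b.
  apply: (le_integrable mc (measurable_funTS mfM) _ (integrableS measurableT mc (@subsetT _ _) (intdom ab))).
  move=> x abx /=; rewrite lee_fin ger0_norm// (le_trans _ (ler_norm _))//.
  by rewrite (le_trans _ (dom_ge _ _ _ ab abx))// ger0_norm// lerD2l ler_peMl// ler1n.
have itK a b : (forall i, a i <= b i) -> mu.-integrable (cbox a b) (EFin \o (fun x => inverse_fourier x + M)).
  move=> ab; have mc := measurable_cbox a b.
  apply: (le_integrable mc (measurable_funTS mKM) _ (integrableS measurableT mc (@subsetT _ _) (intdom ab))).
  move=> x abx /=; rewrite lee_fin ger0_norm// (le_trans _ (ler_norm _))//.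
  rewrite (le_trans _ (dom_ge _ _ _ ab abx))// ger0_norm//.
  have := normr_inverse_fourier_le x; rewrite ler_norml -/M => /andP[_].
  by have := f0 x; lra.
suff : {ae mu, forall x, (f x + M)%:E = (inverse_fourier x + M)%:E}.
  by apply: filterS => x [] /addIr.
have empty a b : ~ (forall i, a i <= b i) -> cbox a b = set0.
  move=> nab; apply/seteqP; split => // x abx; apply: nab => i.
  by have /andP[] := abx i; exact: le_trans.
apply: ge0_ae_eq_cbox mfM mKM _ _ _ _ => [x|x|a b|a b].
- by rewrite lee_fin.
- by rewrite lee_fin.
- have [ab|/empty->] := pselect (forall i, a i <= b i); last by rewrite integral_set0.
  by have := integrable_fin_num (measurable_cbox a b) (itf _ _ ab); rewrite fin_numElt => /andP[_].
- have [ab|/empty->] := pselect (forall i, a i <= b i); last by rewrite !integral_set0.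
  have F1 := integrable_fin_num (measurable_cbox a b) (itf _ _ ab).
  have F2 := integrable_fin_num (measurable_cbox a b) (itK _ _ ab).
  rewrite -(fineK F1) -(fineK F2).
  congr EFin; apply/eqP; rewrite -subr_eq0.
  rewrite -[X in X == _](RintegralB (measurable_cbox a b) (itf _ _ ab) (itK _ _ ab)).
  rewrite -[X in _ == X](Rintegral_h_cbox ab); apply/eqP.
  by apply: eq_Rintegral => x _; rewrite /h; ring.
Qed.

End fourier_inversion.

(** * The heat kernel *)

Section stretched_exponential.
Context {R : realType}.
Local Notation leb := (@lebesgue_measure R).

Lemma measurable_expRN_powR (a c : R) :
  measurable_fun [set: R] (fun x : R => expR (- (c * `|x| `^ a))).
Proof.
apply: (@measurableT_comp _ _ _ _ _ _ (@expR R)); first exact: measurable_expR.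
apply: measurable_funN; apply: measurable_funM => //.
apply: measurable_powR_fun.
exact: normr_measurable.
Qed.

Lemma expRN_powR_le (a : R) : 0 < a ->
  exists2 C : R, 0 < C & forall x, expR (- `|x| `^ a) <= C * (1 + x ^+ 2)^-1.
Proof.
(* With [a (n + 1) >= 2], the term of order [n + 1] in the exponential series of [u = |x|^a] already
   dominates [x^2] for [|x| > 1], up to a factorial. *)
move=> a0; pose n := Num.truncn (2 / a).
have an : 2 <= a * n.+1%:R.
  by rewrite -ler_pdivrMl// mulrC ltW// truncnS_gt.
have F1 : 1 <= n.+1`!%:R :> R by rewrite ler1n fact_gt0.
exists (2 * n.+1`!%:R); first by rewrite mulr_gt0// (lt_le_trans ltr01).
move=> x; have x2 : 0 < 1 + x ^+ 2 by rewrite ltr_pwDl// sqr_ge0.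
rewrite ler_pdivlMr//; set u := `|x| `^ a.
have u0 : 0 <= u by exact: powR_ge0.
have [x1|x1] := leP `|x| 1.
  have e1 : expR (- u) <= 1 by rewrite -expR0 ler_expR oppr_le0.
  have : x ^+ 2 <= 1 by rewrite -[_ ^+ 2]real_normK ?num_real// expr_le1.
  have := expR_ge0 (- u); nra.
have ux : x ^+ 2 <= u ^+ n.+1.
  rewrite -powR_mulrn// -powRrM -[leLHS]real_normK ?num_real// -powR_mulrn//.
  by apply: ler_powR => //; exact: ltW.
have h := expR_ge1Dxn n u0.
have x21 : 1 <= x ^+ 2 by rewrite -[_ ^+ 2]real_normK ?num_real// expr_ge1// ltW.
have F0 : 0 < n.+1`!%:R :> R by rewrite (lt_le_trans ltr01).
have h2 : x ^+ 2 <= n.+1`!%:R * expR u.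
  rewrite mulrC -ler_pdivrMr// (le_trans _ h)// (le_trans (ler_wpM2r _ ux)) ?invr_ge0 ?(ltW F0)//.
  by rewrite lerDr.
rewrite expRN mulrC ler_pdivrMr ?expR_gt0//; nra.
Qed.

(** The substitution [x -> c^(-1/a) x] removes [c] from the exponent and accounts for the power of
    [c]. *)
Lemma integral_expRN_powR (a : R) : 0 < a ->
  exists2 C : R, 0 < C & forall c, 0 < c ->
    (\int[leb]_x (expR (- (c * `|x| `^ a)))%:E <= (C * c `^ (- a^-1))%:E)%E.
Proof.
move=> a0; have [C C0 hC] := expRN_powR_le a0.
pose J : R := \int[leb]_x (C * (1 + x ^+ 2)^-1).
have iJ : leb.-integrable setT (EFin \o (fun x : R => C * (1 + x ^+ 2)^-1)).
  by apply: integrable_EFinZl; exact: integrable_invD1sqr.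
have J0 : 0 <= J.
  apply: Rintegral_ge0 => x _; by rewrite divr_ge0 ?addr_ge0 ?sqr_ge0// ltW.
have h1 : (\int[leb]_x (expR (- (`|x| `^ a)))%:E <= J%:E)%E.
  rewrite /J /Rintegral fineK; last exact: integrable_fin_num iJ.
  apply: ge0_le_integral => //.
  - apply/measurable_EFinP; have := measurable_expRN_powR a 1.
    by under eq_fun do rewrite mul1r.
  - exact: measurable_int iJ.
  - by move=> x _; rewrite lee_fin hC.
exists (J + 1); first by rewrite ltr_wpDl.
move=> c c0; pose B := c `^ (- a^-1).
have B0 : 0 < B by rewrite powR_gt0.
rewrite (ge0_integral_affine 0 B0); last 2 first.
- by apply/measurable_EFinP; exact: measurable_expRN_powR.
- by move=> x; rewrite lee_fin expR_ge0.
have -> : (\int[leb]_x (expR (- (c * `|B * x + 0| `^ a)))%:E =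
    \int[leb]_x (expR (- (`|x| `^ a)))%:E)%E.
  apply: eq_integral => x _; congr (expR (- _))%:E.
  rewrite addr0 normrM (gtr0_norm B0) powRM ?normr_ge0 ?(ltW B0)//.
  rewrite mulrA /B -powRrM mulNr mulVf ?gt_eqF//.
  by rewrite powR_inv1 ?(ltW c0)// mulfV ?mul1r// gt_eqF.
rewrite muleC [leRHS]EFinM; apply: lee_wpmul2r; first by rewrite lee_fin ltW.
by rewrite (le_trans h1)// lee_fin lerDl.
Qed.

End stretched_exponential.

Lemma lee_prod_ord (R : realDomainType) n (f g : 'I_n -> \bar R) :
  (forall i, 0 <= f i <= g i)%E -> (\prod_(i < n) f i <= \prod_(i < n) g i)%E.
Proof.
move=> fg; suff : (0 <= \prod_(i < n) f i <= \prod_(i < n) g i)%E by case/andP.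
elim/big_ind2 : _ => [|x x' y y' /andP[x0 xx'] /andP[y0 yy']|i _]; last exact: fg.
  by rewrite lee01 lexx.
by rewrite mule_ge0//= lee_pmul.
Qed.

Section symbol.
Context {R : realType} {N : nat}.
Local Notation mu := (lebesgue_tuple R N).

Definition symbol (s : R) (xi : N.-tuple R) : R := enorm xi ^+ 2 + enorm xi `^ (2 * s).

Lemma measurable_symbol s : measurable_fun setT (symbol s).
Proof.
apply: measurable_funD; first by apply: measurable_funX; exact: measurable_enorm.
apply: measurable_powR_fun.
exact: measurable_enorm.
Qed.

(** Each [|xi_i|] is at most [|xi|], so the mean of the [|xi_i|^(2s)] is at most the symbol. The
    resulting majorant is a product over coordinates, which Tonelli's theorem integrates. *)
Lemma expRN_symbol_le s t xi : (0 < N)%N -> 0 < s -> 0 < t ->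
  expR (- (t * symbol s xi)) <= \prod_(i < N) expR (- (t / N%:R * `|tnth xi i| `^ (2 * s))).
Proof.
move=> N0 s0 t0; rewrite -expR_sum ler_expR sumrN lerN2 -mulr_sumr mulrAC -mulrA.
rewrite ler_wpM2l ?(ltW t0)// /symbol.
rewrite ler_pdivrMr ?ltr0n// (le_trans (_ : _ <= \sum_(i < N) enorm xi `^ (2 * s)))//.
  have s2 : 0 <= 2 * s by rewrite mulr_ge0// ltW.
  by apply: ler_sum => i _; rewrite ge0_ler_powR ?nnegrE ?enorm_ge0 ?normr_tnth_le_enorm.
rewrite sumr_const card_ord -[leLHS]mulr_natr ler_wpM2r// lerDr sqr_ge0//.
Qed.

Lemma integral_expRN_symbol s : (0 < N)%N -> 0 < s ->
  exists2 C : R, 0 < C & forall t, 0 < t ->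
    (\int[mu]_xi (expR (- (t * symbol s xi)))%:E <= (C * t `^ (- (N%:R / (2 * s))))%:E)%E.
Proof.
move=> N0 s0; have s2 : 0 < 2 * s by rewrite mulr_gt0.
have [C C0 hC] := integral_expRN_powR s2.
pose D := (C * N%:R `^ (2 * s)^-1).
exists (D ^+ N).
  by rewrite exprn_gt0// mulr_gt0// powR_gt0// ltr0n.
move=> t t0.
have m1 : measurable_fun [set: R] (fun x : R => expR (- (t / N%:R * `|x| `^ (2 * s)))).
  exact: measurable_expRN_powR.
apply: (@le_trans _ _ (\int[mu]_xi (\prod_(i < N)
    (expR (- (t / N%:R * `|tnth xi i| `^ (2 * s))))%:E))%E).
  apply: ge0_le_integral => //.
  - apply/measurable_EFinP; apply: (@measurableT_comp _ _ _ _ _ _ (@expR R)).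
      exact: measurable_expR.
    by apply: measurable_funN; apply: measurable_funM => //; exact: measurable_symbol.
  - apply: measurable_prode => i; apply/measurable_EFinP.
    by apply: (measurableT_comp m1); exact: measurable_tnthT.
  - by move=> xi _; rewrite prodEFin lee_fin expRN_symbol_le.
rewrite (ge0_integral_prod (f := fun _ x => (expR (- (t / N%:R * `|x| `^ (2 * s))))%:E)); last 2 first.
- by move=> i; apply/measurable_EFinP.
- by move=> i x; rewrite lee_fin expR_ge0.
have tN : 0 < t / N%:R by rewrite divr_gt0// ltr0n.
apply: (@le_trans _ _ (\prod_(i < N) (C * (t / N%:R) `^ (- (2 * s)^-1))%:E)%E).
  apply: lee_prod_ord => i; rewrite hC// andbT.
  by apply: integral_ge0 => x _; rewrite lee_fin expR_ge0.
rewrite prodEFin lee_fin prodr_const card_ord /D le_eqVlt; apply/orP; left; apply/eqP.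
have -> : (t / N%:R) `^ (- (2 * s)^-1) = t `^ (- (2 * s)^-1) * N%:R `^ (2 * s)^-1.
  rewrite powRM ?invr_ge0 ?(ltW t0)//; congr (_ * _).
  by rewrite -(powR_inv1 (ler0n R N)) -powRrM mulN1r opprK.
rewrite mulrCA [X in X ^+ N]mulrC exprMn; congr (_ * _).
by rewrite -powR_mulrn ?powR_ge0// -powRrM; congr (_ `^ _); rewrite mulNr mulrC.
Qed.

Lemma integrable_expRN_symbol s t : (0 < N)%N -> 0 < s -> 0 < t ->
  mu.-integrable setT (EFin \o (fun xi => expR (- (t * symbol s xi)))).
Proof.
move=> N0 s0 t0; have [C _ hC] := integral_expRN_symbol N0 s0.
apply/integrableP; split.
  apply/measurable_EFinP; apply: (@measurableT_comp _ _ _ _ _ _ (@expR R)).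
    exact: measurable_expR.
  by apply: measurable_funN; apply: measurable_funM => //; exact: measurable_symbol.
under eq_integral do rewrite /= ger0_norm ?expR_ge0//.
by apply: le_lt_trans (hC t t0) _; rewrite ltry.
Qed.

End symbol.

(** * A jointly measurable representative of the kernel *)

Section heat_density.
Context {R : realType} {N : nat}.
Local Notation mu := (lebesgue_tuple R N).
Implicit Types x y : N.-tuple R.

(* The continuous representative of the kernel at time [t], truncated at 0 because the kernel is
   only known to agree with the inverse Fourier integral almost everywhere. *)
Definition hk (s t : R) (x : N.-tuple R) : R :=
  Num.max (inverse_fourier (fun xi => expR (- (t * symbol s xi))) x) 0.

Lemma hk_ge0 s t x : 0 <= hk s t x.
Proof. by rewrite /hk le_max lexx orbT. Qed.

Lemma measurable_hk s :
  measurable_fun [set: R * N.-tuple R] (fun z => hk s z.1 z.2).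
Proof.
apply: measurable_maxr; last exact: measurable_cst.
apply: measurable_funM; first exact: measurable_cst.
apply: (@measurable_Rintegral_param R _ _ (R * N.-tuple R)%type (N.-tuple R) mu
  (fun z => expR (- (z.1.1 * symbol s z.2)) * cos (dot z.1.2 z.2))).
apply: measurable_funM.
  apply: (@measurableT_comp _ _ _ _ _ _ (@expR R)); first exact: measurable_expR.
  apply: measurable_funN; apply: measurable_funM.
    exact: (measurableT_comp measurable_fst measurable_fst).
  exact: (measurableT_comp (measurable_symbol s) measurable_snd).
apply: (measurableT_comp measurable_cos_dot2 (g := fun z => (z.1.2, z.2))).
apply: measurable_fun_pair; last exact: measurable_snd.
exact: (measurableT_comp measurable_snd measurable_fst).
Qed.

Lemma measurable_hk_fun s d (T : measurableType d) (f : T -> R) (g : T -> N.-tuple R) :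
  measurable_fun setT f -> measurable_fun setT g -> measurable_fun setT (fun z => hk s (f z) (g z)).
Proof.
move=> mf mg; apply: (measurableT_comp (measurable_hk s) (g := fun z => (f z, g z))).
exact: measurable_fun_pair.
Qed.

Lemma hk_le s : (0 < N)%N -> 0 < s ->
  exists2 C : R, 0 < C & forall t x, 0 < t -> hk s t x <= C * t `^ (- (N%:R / (2 * s))).
Proof.
move=> N0 s0; have [C C0 hC] := @integral_expRN_symbol R N s N0 s0.
exists ((2 * cfejer) ^- N * C).
  by rewrite mulr_gt0// invr_gt0 exprn_gt0// mulr_gt0// cfejer_gt0.
move=> t x t0; rewrite /hk ge_max; apply/andP; split; last first.
  rewrite mulr_ge0 ?powR_ge0// mulr_ge0 ?(ltW C0)// invr_ge0 exprn_ge0//.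
  by rewrite mulr_ge0// ltW// cfejer_gt0.
have ie := integrable_expRN_symbol N0 s0 t0.
rewrite (le_trans (ler_norm _))// (le_trans (normr_inverse_fourier_le ie x))//.
rewrite -mulrA ler_wpM2l//.
  by rewrite invr_ge0 exprn_ge0// mulr_ge0// ltW// cfejer_gt0.
rewrite -lee_fin (le_trans _ (hC t t0))// /Rintegral.
under eq_integral do rewrite ger0_norm ?expR_ge0//.
by rewrite fineK//; exact: integrable_fin_num ie.
Qed.

Section kernel.
Variables (s : R) (E : R -> N.-tuple R -> R).
Hypotheses (N0 : (0 < N)%N) (s0 : 0 < s) (kE : is_kernel s E).

Lemma kernel_ae_hk t : 0 < t -> {ae mu, forall x, E t x = hk s t x}.
Proof.
move=> t0; have [E0 iE FE] := kE t0.
have ie := integrable_expRN_symbol N0 s0 t0.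
have Fcos xi : \int[mu]_x (E t x * cos (dot x xi)) = expR (- (t * symbol s xi)).
  by have := FE xi; rewrite /fourier => -[].
have Fsin xi : \int[mu]_x (E t x * sin (dot x xi)) = 0.
  by have := FE xi; rewrite /fourier => -[_ /eqP]; rewrite oppr_eq0 => /eqP.
have := fourier_inversion_ae iE ie Fcos Fsin E0.
apply: filterS => x Ex; rewrite /hk max_l//.
by rewrite -Ex.
Qed.

(** A convolution at [x] evaluates the kernel at [x - y], so null sets must survive this reflection.
    Consequently the convolutions with [E t] and with [hk s t] agree at every [x], not only almost
    everywhere. *)
Lemma negligible_vsubr (A : set (N.-tuple R)) x :
  mu.-negligible A -> mu.-negligible [set y | A (vsub x y)].
Proof.
move=> [B [mB B0 AB]].
have mv : measurable_fun setT (fun y => vsub x y).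
  by apply: measurable_vsub; [exact: measurable_cst|exact: measurable_id].
have mBv : measurable [set y | B (vsub x y)].
  by rewrite -[X in measurable X]setTI; exact: mv.
exists [set y | B (vsub x y)]; split => //; last by move=> y; exact: AB.
have mB1 : measurable_fun setT (fun y => (\1_B y)%:E : \bar R).
  by apply/measurable_EFinP; exact: measurable_indic.
have B1 y : (0 <= (\1_B y : R)%:E)%E by rewrite lee_fin.
rewrite -[LHS]/(mu ([set y | B (vsub x y)])) -[X in mu X]setIT -integral_indic//.
have := ge0_integral_vsubr x mB1 B1.
have -> : (\int[mu]_y (\1_B y)%:E = 0)%E by rewrite integral_indic// setIT.
by [].
Qed.

Lemma ae_vsubr (P : N.-tuple R -> Prop) x :
  {ae mu, forall y, P y} -> {ae mu, forall y, P (vsub x y)}.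
Proof. exact: negligible_vsubr. Qed.

Lemma integrable_hk t : 0 < t -> mu.-integrable setT (EFin \o hk s t).
Proof.
move=> t0; have [_ iE _] := kE t0.
have mh : measurable_fun setT (EFin \o hk s t).
  by apply/measurable_EFinP; apply: measurable_hk_fun; [exact: measurable_cst|exact: measurable_id].
apply/integrableP; split => //; case/integrableP : iE => mE; apply: le_lt_trans.
rewrite le_eqVlt; apply/orP; left; apply/eqP.
apply: ae_eq_integral => //.
- exact: measurableT_comp.
- exact: measurableT_comp.
- by apply: filterS (kernel_ae_hk t0) => x Ex _ /=; rewrite Ex.
Qed.

(** The prescribed Fourier transform evaluated at [xi = 0]. *)
Lemma integral_hk t : 0 < t -> (\int[mu]_x (hk s t x)%:E = 1)%E.
Proof.
move=> t0; have [E0 iE FE] := kE t0; have ih := integrable_hk t0.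
have := FE [tuple 0 | i < N]; rewrite /fourier => -[+ _].
have d0 x : dot x [tuple 0 | i < N] = 0.
  by rewrite /dot big1// => i _; rewrite tnth_mktuple mulr0.
have -> : enorm [tuple (0 : R) | i < N] = 0.
  by rewrite /enorm d0 sqrtr0.
rewrite expr0n powR0 ?mulf_neq0 ?gt_eqF// addr0 mulr0 oppr0 expR0.
under eq_Rintegral do rewrite d0 cos0 mulr1.
move=> E1; rewrite -(fineK (integrable_fin_num measurableT ih)); congr EFin.
rewrite -[RHS]E1; apply: ae_eq_Rintegral.
- exact: integrable_EFin_measurable ih.
- exact: integrable_EFin_measurable iE.
- by apply: filterS (kernel_ae_hk t0) => x.
Qed.

Lemma convolution_hk t (g : N.-tuple R -> R) x : 0 < t -> measurable_fun setT g ->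
  convolution (E t) g x = convolution (hk s t) g x.
Proof.
move=> t0 mg; have [_ iE _] := kE t0.
have mv : measurable_fun setT (fun y => vsub x y).
  by apply: measurable_vsub; [exact: measurable_cst|exact: measurable_id].
apply: ae_eq_Rintegral.
- by apply: measurable_funM => //; exact: measurableT_comp (integrable_EFin_measurable iE) mv.
- apply: measurable_funM => //.
  exact: measurableT_comp (integrable_EFin_measurable (integrable_hk t0)) mv.
- by apply: filterS (ae_vsubr x (kernel_ae_hk t0)) => y ->.
Qed.

Lemma convolvable_hk t (g : N.-tuple R -> R) x : 0 < t -> measurable_fun setT g ->
  convolvable (hk s t) g x -> convolvable (E t) g x.
Proof.
move=> t0 mg; have [_ iE _] := kE t0.
have mv : measurable_fun setT (fun y => vsub x y).
  by apply: measurable_vsub; [exact: measurable_cst|exact: measurable_id].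
have mE : measurable_fun setT (fun y => (E t (vsub x y) * g y)%:E).
  apply/measurable_EFinP; apply: measurable_funM => //.
  exact: measurableT_comp (integrable_EFin_measurable iE) mv.
move=> /integrableP[mh hoo]; apply/integrableP; split => //.
apply: le_lt_trans hoo; rewrite le_eqVlt; apply/orP; left; apply/eqP.
apply: ae_eq_integral => //.
- exact: measurableT_comp.
- exact: measurableT_comp.
- by apply: filterS (ae_vsubr x (kernel_ae_hk t0)) => y -> _.
Qed.

End kernel.
End heat_density.

(** * Smoothing estimates *)

Section power_integrals.
Context {R : realType}.
Local Notation leb := (@lebesgue_measure R).
Local Open Scope ereal_scope.

Lemma measurable_powRl (a : R) (D : set R) : measurable_fun D (fun x : R => (x `^ a)%R).
Proof. by apply: measurable_funTS; exact: measurable_powR. Qed.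

(** For [a < 0] the integrand is singular at 0, so the fundamental theorem is applied on
    [[rho/(n+1), rho]] and monotone convergence does the rest. *)
Lemma integral_powR_le (a rho : R) : (-1 < a)%R -> (0 < rho)%R ->
  \int[leb]_(x in `]0%R, rho]) ((x `^ a)%R)%:E <= ((rho `^ (a + 1)) / (a + 1))%:E.
Proof.
move=> a1 rho0; have a10 : (0 < a + 1)%R by lra.
pose S n : set R := `[(rho / n.+1%:R)%R, rho]%classic.
have SE : `]0%R, rho]%classic = \bigcup_n S n.
  apply/seteqP; split=> x /=; last first.
    move=> [n _]; rewrite /S /= !in_itv/= => /andP[h ->]; rewrite andbT.
    by rewrite (lt_le_trans _ h)// divr_gt0.
  rewrite in_itv/= => /andP[x0 xr]; exists (Num.truncn (rho / x)) => //.
  rewrite /S /= in_itv/= xr andbT ler_pdivrMr ?ltr0n// mulrC -ler_pdivrMr//.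
  by rewrite ltW// truncnS_gt.
have cvg : \int[leb]_(x in S n) ((x `^ a)%R)%:E @[n --> \oo] -->
    \int[leb]_(x in \bigcup_n S n) ((x `^ a)%R)%:E.
  apply: ge0_nondecreasing_set_cvg_integral => //.
  - move=> m n mn; apply/subsetPset => x; rewrite /S /= !in_itv/= => /andP[h ->].
    rewrite andbT (le_trans _ h)// ler_wpM2l ?(ltW rho0)// lef_pV2 ?posrE ?ltr0n//.
    by rewrite ler_nat.
  - by move=> n; exact: measurable_itv.
  - by move=> n; apply/measurable_EFinP; exact: measurable_powRl.
  - by move=> n x _; rewrite lee_fin powR_ge0.
rewrite SE -(cvg_lim _ cvg)//; apply: lime_le.
  by apply/cvg_ex; eexists; exact: cvg.
apply: nearW => n; pose u := (rho / n.+1%:R)%R.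
have u0 : (0 < u)%R by rewrite divr_gt0.
have : (u <= rho)%R by rewrite ler_pdivrMr ?ltr0n// ler_peMr ?(ltW rho0)// ler1n.
rewrite le_eqVlt => /predU1P[urho|urho].
  rewrite /S -/u urho set_itv1 integral_set1 lee_fin divr_ge0 ?powR_ge0//.
  exact: ltW.
pose F (x : R) : R := ((a + 1)^-1 * x `^ (a + 1))%R.
have dF (x : R) : (0 < x)%R -> is_derive x 1%R F (x `^ a)%R.
  move=> x0; have := is_derive1_powR (a + 1) x0 => h.
  apply: is_derive_eq; rewrite addrK /GRing.scale/=.
  by field; rewrite gt_eqF.
have cF (x : R) : (0 < x)%R -> {for x, continuous F}.
  by move=> x0; apply: differentiable_continuous; apply/derivable1_diffP; case: (dF x x0).
rewrite /S -/u (@continuous_FTC2 _ _ F)//.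
- rewrite -EFinB lee_fin /F mulrC lerBlDr lerDl mulr_ge0 ?powR_ge0// invr_ge0.
  exact: ltW.
- apply: continuous_in_subspaceT => x; rewrite inE/= in_itv/= => /andP[ux _].
  have x0 : (0 < x)%R := lt_le_trans u0 ux.
  have := is_derive1_powR a x0 => -[+ _] => dx.
  by apply: differentiable_continuous; apply/derivable1_diffP.
- split => [x| |].
  + by rewrite in_itv/= => /andP[ux _]; case: (dF x (lt_trans u0 ux)).
  + by apply: cvg_at_right_filter; exact: cF.
  + by apply: cvg_at_left_filter; apply: cF; exact: lt_trans urho.
- move=> x; rewrite in_itv/= => /andP[ux _]; rewrite derive1E.
  by apply: derive_val; exact: (dF x (lt_trans u0 ux)).
Qed.

Lemma integral_normr_powR_le (a : R) : (-1 < a)%R ->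
  exists2 C : R, (0 < C)%R & forall rho, (0 < rho)%R ->
  \int[leb]_x ((`|x| `^ a * \1_`[(- rho)%R, rho] x)%R)%:E <= (C * rho `^ (a + 1))%:E.
Proof.
move=> a1; have a10 : (0 < a + 1)%R by lra.
exists (2 / (a + 1))%R; first by rewrite divr_gt0.
move=> rho rho0.
pose f (x : R) : \bar R := ((x `^ a * \1_`]0%R, rho] x)%R)%:E.
have mf : measurable_fun [set: R] f.
  apply/measurable_EFinP; apply: measurable_funM; first exact: measurable_powRl.
  exact: measurable_indic.
have f0 x : 0 <= f x by rewrite lee_fin mulr_ge0// powR_ge0.
have If : \int[leb]_x f x <= ((rho `^ (a + 1)) / (a + 1))%:E.
  apply: le_trans (integral_powR_le a1 rho0).
  rewrite [leRHS]integral_mkcond le_eqVlt; apply/orP; left; apply/eqP.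
  apply: eq_integral => x _; rewrite /f patchE indicE.
  by case: ifP => _; rewrite ?mulr1 ?mulr0.
apply: (@le_trans _ _ (\int[leb]_x (f x + f (- x)%R))).
  apply: ae_ge0_le_integral => //.
  - apply/measurable_EFinP; apply: measurable_funM; last exact: measurable_indic.
    apply: measurable_powR_fun.
    exact: normr_measurable.
  - by move=> x _; rewrite adde_ge0.
  - by apply: emeasurable_funD => //; apply: measurableT_comp => //; exact: oppr_measurable.
  (* The origin is excluded because for [a = 0] the left side equals 1 there, while both half-line
     terms vanish. *)
  - exists [set 0%R]; split; [exact: measurable_set1|exact: lebesgue_measure_set1|].
    move=> x; apply: contra_notP => /eqP x0 _.
    rewrite /f -EFinD lee_fin !indicE !mem_setE !in_itv/=.
    have [xp|xn|x0'] := ltgtP 0%R x; last by rewrite x0' eqxx in x0.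
    + rewrite (gtr0_norm xp) oppr_gt0 (ltNge x) (ltW xp) /= mulr0 addr0.
      rewrite ler_wpM2l ?powR_ge0// ler_nat.
      by case: (- rho <= x)%R; case: (x <= rho)%R.
    + rewrite (ltr0_norm xn) oppr_gt0 xn /= mulr0 add0r.
      rewrite ler_wpM2l ?powR_ge0// ler_nat lerNl.
      by case: (- x <= rho)%R; case: (x <= rho)%R.
rewrite ge0_integralD//; last first.
  by apply: measurableT_comp => //; exact: oppr_measurable.
rewrite -ge0_integral_oppr//.
have -> : (2 / (a + 1) * rho `^ (a + 1) = rho `^ (a + 1) / (a + 1) + rho `^ (a + 1) / (a + 1))%R.
  by field; rewrite gt_eqF.
by rewrite EFinD leeD.
Qed.

(** On each half of []0, t[] one of the two factors is comparable to the same power of [t], and the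
    other is integrated by [integral_powR_le]. *)
Lemma integral_beta_le (a b : R) : (-1 < a)%R -> (-1 < b)%R ->
  exists2 C : R, (0 < C)%R & forall t, (0 < t)%R ->
  \int[leb]_(x in `]0%R, t[) ((x `^ a * (t - x) `^ b)%R)%:E <= (C * t `^ (a + b + 1))%:E.
Proof.
move=> a1 b1; have a10 : (0 < a + 1)%R by lra. have b10 : (0 < b + 1)%R by lra.
(* For [u] in [[1/2, 1]], [u^e] is at most 1 if [e >= 0] and at most [2^(-e)] otherwise; the sum
   covers both signs. *)
pose k (e : R) : R := (1 + 2 `^ (- e))%R.
have k0 e : (0 < k e)%R by rewrite ltr_pwDl// powR_ge0.
have kP (e t x : R) : (0 < t)%R -> (t / 2 <= x <= t)%R -> (x `^ e <= k e * t `^ e)%R.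
  move=> t0 /andP[tx xt]; have x0 : (0 < x)%R by lra.
  have xE : x = (t * (x / t))%R by field; rewrite gt_eqF.
  have u0 : (0 < x / t)%R by rewrite divr_gt0.
  have u1 : (x / t <= 1)%R by rewrite ler_pdivrMr// mul1r.
  have u2 : (2^-1 <= x / t)%R by rewrite ler_pdivlMr//; lra.
  rewrite [in leLHS]xE powRM ?(ltW t0) ?(ltW u0)// mulrC ler_wpM2r ?powR_ge0//.
  have [e0|e0] := leP 0%R e.
    rewrite /k (le_trans (_ : _ <= 1)%R) ?lerDl ?powR_ge0//.
    have <- : (1 `^ e = 1 :> R)%R by rewrite powR1.
    by rewrite ge0_ler_powR ?nnegrE ?(ltW u0).
  rewrite /k (le_trans (_ : _ <= 2 `^ (- e))%R) ?lerDr//.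
  rewrite -[(x / t)%R]invrK -(powR_inv1 (a := (x / t)^-1)) ?invr_ge0 ?(ltW u0)//.
  rewrite -powRrM mulN1r ge0_ler_powR ?nnegrE ?invr_ge0 ?(ltW u0)// ?oppr_ge0 ?(ltW e0)//.
  by rewrite -[leRHS]invrK lef_pV2 ?posrE ?invr_gt0.
exists (k b / (a + 1) + k a / (b + 1))%R; first by rewrite addr_gt0// divr_gt0.
move=> t t0.
pose f (e x : R) : \bar R := ((x `^ e * \1_`]0%R, t[ x)%R)%:E.
have mf e : measurable_fun [set: R] (f e).
  apply/measurable_EFinP; apply: measurable_funM; first exact: measurable_powRl.
  exact: measurable_indic.
have f0 e x : 0 <= f e x by rewrite lee_fin mulr_ge0// powR_ge0.
have If e : (-1 < e)%R -> \int[leb]_x f e x <= ((t `^ (e + 1)) / (e + 1))%:E.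
  move=> e1; apply: le_trans (integral_powR_le e1 t0).
  rewrite [leRHS]integral_mkcond; apply: ge0_le_integral => //.
  - exact: mf.
  - apply/(measurable_restrictT _ _).1 => //; apply/measurable_EFinP; exact: measurable_powRl.
  - move=> x _; rewrite /f patchE indicE !mem_setE !in_itv/=.
    case: (ltP 0%R x) => x0 /=; last by rewrite mulr0.
    case: (ltP x t) => xt /=; first by rewrite (ltW xt) mulr1.
    by rewrite mulr0; case: ifP => _; rewrite lee_fin// powR_ge0.
rewrite integral_mkcond.
apply: (@le_trans _ _ (\int[leb]_x ((k b * t `^ b)%:E * f a x + (k a * t `^ a)%:E * f b (t - x)%R))).
  apply: ge0_le_integral => //.
  - by move=> x _; apply: erestrict_ge0 => y _; rewrite lee_fin mulr_ge0 ?powR_ge0.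
  - apply/(measurable_restrictT _ _).1 => //; apply/measurable_EFinP.
    apply: measurable_funM; first exact: measurable_powRl.
    apply: (@measurable_comp _ _ _ _ _ _ setT (fun x : R => x `^ b)%R) => //.
    exact: measurable_funB.
  - apply: emeasurable_funD; apply: emeasurable_funM => //.
      exact: mf.
    apply: (measurableT_comp (mf b)).
    by have := @measurable_affine R (-1) t; under eq_fun do rewrite mulN1r addrC.
  - move=> x _; rewrite patchE mem_setE; case: ifPn => [xt|_]; last first.
      by rewrite adde_ge0// mule_ge0// lee_fin mulr_ge0 ?powR_ge0// ltW.
    move: (xt); rewrite in_itv/= => /andP[x0 xlt].
    have txt : (t - x)%R \in `]0%R, t[ by rewrite in_itv/= subr_gt0 xlt ltrBlDr ltrDl.
    rewrite /f -!EFinM -EFinD lee_fin !indicE !mem_setE xt txt !mulr1.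
    have [xh|xh] := leP x (t / 2)%R.
      rewrite (le_trans (_ : _ <= x `^ a * (k b * t `^ b))%R)//.
        by rewrite ler_wpM2l ?powR_ge0// kP//; apply/andP; split; lra.
      by rewrite mulrC lerDl !mulr_ge0 ?powR_ge0// ltW.
    rewrite (le_trans (_ : _ <= (k a * t `^ a) * (t - x) `^ b)%R)//.
      by rewrite ler_wpM2r ?powR_ge0// kP//; apply/andP; split; lra.
    by rewrite lerDr !mulr_ge0 ?powR_ge0// ltW.
have mfb : measurable_fun [set: R] (fun x => f b (t - x)%R).
  apply: (measurableT_comp (mf b)).
  by have := @measurable_affine R (-1) t; under eq_fun do rewrite mulN1r addrC.
have kt e d : 0 <= (k e * t `^ d)%:E by rewrite lee_fin mulr_ge0 ?powR_ge0// ltW.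
rewrite ge0_integralD//; last 4 first.
- by move=> x _; rewrite mule_ge0.
- by apply: emeasurable_funM => //; exact: mf.
- by move=> x _; rewrite mule_ge0.
- exact: emeasurable_funM.
rewrite ge0_integralZl//; last exact: mf.
rewrite ge0_integralZl//.
rewrite ge0_integral_subr//.
apply: (@le_trans _ _ ((k b * t `^ b)%:E * (t `^ (a + 1) / (a + 1))%:E +
   (k a * t `^ a)%:E * (t `^ (b + 1) / (b + 1))%:E)).
  by apply: leeD; apply: lee_wpmul2l => //; exact: If.
rewrite -!EFinM -EFinD lee_fin.
have tD e d : (t `^ e * t `^ d = t `^ (e + d))%R.
  by rewrite -powRD// (gt_eqF t0) implybT.
have -> : (k b * t `^ b * (t `^ (a + 1) / (a + 1)) = k b / (a + 1) * t `^ (a + b + 1))%R.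
  have -> : (a + b + 1 = b + (a + 1))%R by ring.
  by rewrite -(tD b); ring.
have -> : (k a * t `^ a * (t `^ (b + 1) / (b + 1)) = k a / (b + 1) * t `^ (a + b + 1))%R.
  have -> : (a + b + 1 = a + (b + 1))%R by ring.
  by rewrite -(tD a); ring.
by rewrite [leRHS]mulrDl.
Qed.

End power_integrals.

(** * Jensen's inequality in the extended reals *)

Section jensen.
Context {R : realType}.
Local Open Scope ereal_scope.

Lemma le_poweR (a : R) (x y : \bar R) : (0 <= a)%R -> 0 <= x -> x <= y ->
  x `^ a <= y `^ a.
Proof.
move=> a0 x0 xy; apply: gt0_ler_poweR => //.
  by rewrite in_itv/= x0 leey.
by rewrite in_itv/= (le_trans x0 xy) leey.
Qed.

(** As a function of [y = x^a], [x] is the concave function [y^(1/a)]; the right side is its tangent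
    at [y = l^a]. The free parameter [l] is optimized in the next lemma. *)
Lemma young_poweR (a l : R) (x : \bar R) : (1 <= a)%R -> (0 < l)%R -> 0 <= x ->
  x <= (a^-1 * l `^ (1 - a))%:E * x `^ a + ((1 - a^-1) * l)%:E.
Proof.
move=> a1 l0; have a0 : (0 < a)%R by rewrite (lt_le_trans ltr01).
case: x => [x| |//]; last first.
  by rewrite poweRyr ?gt_eqF// gt0_muley ?lte_fin ?mulr_gt0 ?invr_gt0 ?powR_gt0.
rewrite lee_fin => x0; rewrite poweR_EFin -EFinM -EFinD lee_fin.
move: a1; rewrite le_eqVlt => /predU1P[<-|a1].
  by rewrite invr1 subrr powRr0 mul0r addr0 powRr1// !mul1r.
have a11 : (0 < a - 1)%R by rewrite subr_gt0.
pose b := (a / (a - 1))%R.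
have b0 : (0 < b)%R by rewrite divr_gt0.
have xl0 : (0 <= x / l)%R by rewrite divr_ge0// ltW.
have := conjugate_powR xl0 ler01 a0 b0.
rewrite mulr1 powR1 => h.
have {}h : (x / l <= (x / l) `^ a / a + 1 / b)%R.
  by apply: h; rewrite /b; field; rewrite !gt_eqF.
have -> : (1 - a^-1 = 1 / b)%R by rewrite /b; field; rewrite !gt_eqF.
rewrite -(ler_pM2r (x := l^-1)) ?invr_gt0// (le_trans h)// le_eqVlt.
apply/orP; left; apply/eqP; rewrite mulrDl mulfK ?gt_eqF//; congr (_ + _)%R.
rewrite powRM ?invr_ge0 ?(ltW l0)//.
rewrite -{1}(powR_inv1 (ltW l0)) -powRrM.
rewrite powRD ?(gt_eqF l0) ?implybT// powRr1 ?(ltW l0)// mulN1r.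
by field; rewrite !gt_eqF.
Qed.

Context d (T : measurableType d) (m : {measure set T -> \bar R}).

(** Jensen's inequality for the measure with density [k], of mass at most [J]: integrate Young's
    inequality against it and choose the best [l]. *)
Lemma poweR_integral_le (k g : T -> \bar R) (J a : R) :
  measurable_fun setT k -> (forall x, 0 <= k x) ->
  measurable_fun setT g -> (forall x, 0 <= g x) ->
  (0 < J)%R -> \int[m]_x k x <= J%:E -> (1 <= a)%R ->
  (\int[m]_x (k x * g x)) `^ a <= (J `^ (a - 1))%:E * \int[m]_x (k x * g x `^ a).
Proof.
move=> mk k0 mg g0 J0 kJ a1; have a0 : (0 < a)%R by rewrite (lt_le_trans ltr01).
have mga : measurable_fun setT (fun x => g x `^ a).
  exact: (measurableT_comp (measurable_poweR a) mg).
set I := \int[m]_x (k x * g x `^ a).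
have I0 : 0 <= I by apply: integral_ge0 => x _; rewrite mule_ge0// poweR_ge0.
have Ja : (0 < J `^ (a - 1))%R by rewrite powR_gt0.
have [->|] := eqVneq I +oo.
  by rewrite gt0_muley ?lte_fin// leey.
rewrite -ltey => Ioo.
have /fineK IE : I \is a fin_num by rewrite ge0_fin_numE.
(* [i] is slightly larger than the integral, so that it is positive and [l] is admissible even when
   the integral vanishes. *)
apply/lee_addgt0Pr => e e0; pose i := (fine I + e / J `^ (a - 1))%R.
have i0 : (0 < i)%R by rewrite ltr_wpDl ?divr_gt0// fine_ge0.
have -> : (J `^ (a - 1))%:E * I + e%:E = (J `^ (a - 1) * i)%:E.
  rewrite -IE -EFinM -EFinD; congr EFin; rewrite /i.
  by rewrite mulrDr [(e / _)%R]mulrC mulrA mulfV ?mul1r// gt_eqF.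
(* The minimizer of the integrated bound satisfies [l^a = i / J]. *)
pose l := ((i / J) `^ a^-1)%R.
have iJ0 : (0 < i / J)%R by rewrite divr_gt0.
have l0 : (0 < l)%R by rewrite powR_gt0.
have la : (l `^ a = i / J)%R.
  by rewrite /l -powRrM mulVf ?gt_eqF// powRr1// ltW.
have l1a : (l `^ (1 - a) * i = l * J)%R.
  have -> : i = (l `^ a * J)%R by rewrite la divfK// gt_eqF.
  by rewrite mulrA -powRD ?(gt_eqF l0) ?implybT// subrK powRr1// ltW.
have b0 : (0 <= 1 - a^-1)%R by rewrite subr_ge0 invf_le1.
have c0 : (0 <= a^-1 * l `^ (1 - a))%R by rewrite mulr_ge0 ?invr_ge0 ?powR_ge0// ltW.
have h : \int[m]_x (k x * g x) <= (l * J)%:E.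
  apply: (@le_trans _ _ (\int[m]_x ((a^-1 * l `^ (1 - a))%:E * (k x * g x `^ a) +
      ((1 - a^-1) * l)%:E * k x))).
    apply: ge0_le_integral => //.
    - by move=> x _; rewrite mule_ge0.
    - exact: emeasurable_funM.
    - apply: emeasurable_funD; apply: emeasurable_funM => //.
      exact: emeasurable_funM.
    - move=> x _; rewrite muleCA [X in _ + X]muleC -ge0_muleDr//; last 2 first.
      + by rewrite mule_ge0 ?lee_fin ?poweR_ge0.
      + by rewrite lee_fin mulr_ge0// ltW.
      by rewrite lee_wpmul2l// young_poweR.
  rewrite ge0_integralD//; last 4 first.
  - by move=> x _; rewrite mule_ge0 ?lee_fin// mule_ge0 ?poweR_ge0.
  - by apply: emeasurable_funM => //; exact: emeasurable_funM.
  - by move=> x _; rewrite mule_ge0 ?lee_fin// mulr_ge0// ltW.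
  - exact: emeasurable_funM.
  have mkg : measurable_fun setT (fun x => k x * g x `^ a) by exact: emeasurable_funM.
  have kg0 x : 0 <= k x * g x `^ a by rewrite mule_ge0// poweR_ge0.
  have cl0 : (0 <= (1 - a^-1) * l)%R by rewrite mulr_ge0// ltW.
  rewrite (ge0_integralZl _ measurableT)// (ge0_integralZl _ measurableT)//.
  rewrite -/I -IE.
  apply: (@le_trans _ _ ((a^-1 * l `^ (1 - a))%:E * i%:E + ((1 - a^-1) * l)%:E * J%:E)).
    apply: leeD; apply: lee_wpmul2l; rewrite ?lee_fin//.
    by rewrite lerDl divr_ge0// ltW.
  have -> : (l * J = a^-1 * l `^ (1 - a) * i + (1 - a^-1) * l * J)%R.
    by rewrite -[X in (X + _)%R]mulrA l1a; ring.
  by rewrite EFinD !EFinM.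
apply: (le_trans (le_poweR (ltW a0) _ h)).
  by apply: integral_ge0 => x _; rewrite mule_ge0.
rewrite poweR_EFin lee_fin powRM ?(ltW l0) ?(ltW J0)// la.
rewrite powRB; last by rewrite (gt_eqF J0) implybT.
rewrite powRr1 ?(ltW J0)// le_eqVlt; apply/orP; left; apply/eqP.
by field; rewrite !gt_eqF.
Qed.

End jensen.

(** * The semigroup on nonnegative functions *)

Section smoothing.
Context {R : realType} {N : nat}.
Local Notation mu := (lebesgue_tuple R N).
Implicit Types x y : N.-tuple R.
Local Open Scope ereal_scope.

(** Extended real values let Tonelli's theorem and Jensen's inequality act on nonnegative data
    before the convolution is known to converge. *)
Definition heat (s t : R) (g : N.-tuple R -> \bar R) x : \bar R :=
  \int[mu]_y ((hk s t (vsub x y))%:E * g y).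

Lemma measurable_hk_vsub s t :
  measurable_fun [set: N.-tuple R * N.-tuple R] (fun z => (hk s t (vsub z.1 z.2))%:E).
Proof.
apply/measurable_EFinP.
apply: measurable_hk_fun; first exact: measurable_cst.
by apply: measurable_vsub; [exact: measurable_fst|exact: measurable_snd].
Qed.

Lemma measurable_hk_vsubr s t x : measurable_fun setT (fun y => (hk s t (vsub x y))%:E).
Proof. exact: (measurableT_comp (measurable_hk_vsub s t) (pair1_measurable x)). Qed.

Lemma hkE_ge0 s t x : 0 <= (hk s t x)%:E :> \bar R.
Proof. by rewrite lee_fin hk_ge0. Qed.

Lemma heat_ge0 s t g x : (forall y, 0 <= g y) -> 0 <= heat s t g x.
Proof. by move=> g0; apply: integral_ge0 => y _; rewrite mule_ge0// hkE_ge0. Qed.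

Lemma measurable_hk_vsubM s t g : measurable_fun setT g ->
  measurable_fun [set: N.-tuple R * N.-tuple R]
    (fun z => (hk s t (vsub z.1 z.2))%:E * g z.2).
Proof.
move=> mg; apply: emeasurable_funM; first exact: measurable_hk_vsub.
exact: (measurableT_comp mg measurable_snd).
Qed.

Lemma measurable_heat s t g : measurable_fun setT g -> (forall y, 0 <= g y) ->
  measurable_fun setT (heat s t g).
Proof.
move=> mg g0.
apply: (measurable_fun_fubini_tonelli_F (fun z => (hk s t (vsub z.1 z.2))%:E * g z.2)).
  exact: measurable_hk_vsubM.
by move=> z; rewrite mule_ge0// hkE_ge0.
Qed.

Variables (s : R) (E : R -> N.-tuple R -> R).
Hypotheses (N0 : (0 < N)%N) (s0 : (0 < s)%R) (kE : is_kernel s E).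
Let theta : R := (N%:R / (2 * s))%R.

Lemma integral_hk_vsubr t x : (0 < t)%R -> \int[mu]_y (hk s t (vsub x y))%:E = 1.
Proof.
move=> t0; rewrite (ge0_integral_vsubr x (f := fun y => (hk s t y)%:E)).
- exact: (integral_hk N0 s0 kE).
- exact: measurable_int (integrable_hk N0 s0 kE t0).
- by move=> y; exact: hkE_ge0.
Qed.

Lemma integral_hk_vsubl t y : (0 < t)%R -> \int[mu]_x (hk s t (vsub x y))%:E = 1.
Proof.
move=> t0; rewrite (ge0_integral_vsubl y (f := fun y => (hk s t y)%:E)).
- exact: (integral_hk N0 s0 kE).
- exact: measurable_int (integrable_hk N0 s0 kE t0).
- by move=> z; exact: hkE_ge0.
Qed.

Lemma integral_heat t g : (0 < t)%R -> measurable_fun setT g -> (forall y, 0 <= g y) ->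
  \int[mu]_x heat s t g x = \int[mu]_x g x.
Proof.
move=> t0 mg g0; rewrite /heat.
rewrite (@fubini_tonelli _ _ _ _ _ mu mu (fun z => (hk s t (vsub z.1 z.2))%:E * g z.2))//=; last 2 first.
- exact: measurable_hk_vsubM.
- by move=> z; rewrite mule_ge0// hkE_ge0.
apply: eq_integral => y _; rewrite ge0_integralZr ?integral_hk_vsubl ?mul1e//.
  exact: (measurableT_comp (measurable_hk_vsub s t) (pair2_measurable y)).
by move=> x _; exact: hkE_ge0.
Qed.

Lemma poweR_heat_le t g (a : R) x : (0 < t)%R -> (1 <= a)%R ->
  measurable_fun setT g -> (forall y, 0 <= g y) ->
  heat s t g x `^ a <= heat s t (fun y => g y `^ a) x.
Proof.
move=> t0 a1 mg g0.
have := @poweR_integral_le R _ _ mu (fun y => (hk s t (vsub x y))%:E) g 1 a.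
rewrite powR1 mul1e integral_hk_vsubr//; apply => //.
  exact: measurable_hk_vsubr.
by move=> y; exact: hkE_ge0.
Qed.

(** The estimate from L^1 to L^a: of the [a] factors of [heat s t g], [a - 1] are bounded by the
    supremum of the kernel times the mass of [g], and the last is integrated using conservation of
    mass. *)
Lemma integral_poweR_heat_le : exists2 C : R, (0 < C)%R &
  forall t (a : R) g, (0 < t)%R -> (1 <= a)%R ->
  measurable_fun setT g -> (forall y, 0 <= g y) ->
  \int[mu]_x (heat s t g x `^ a) <=
    ((C * t `^ (- theta)) `^ (a - 1))%:E * (\int[mu]_x g x) `^ a.
Proof.
have [C C0 hC] := @hk_le R N s N0 s0; exists C => // t a g t0 a1 mg g0.
have a10 : (0 <= a - 1)%R by rewrite subr_ge0.
pose c : R := (C * t `^ (- theta))%R.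
have c0 : (0 < c)%R by rewrite mulr_gt0// powR_gt0.
set I := \int[mu]_x g x; have I0 : 0 <= I by exact: integral_ge0.
have hI x : heat s t g x <= c%:E * I.
  rewrite -ge0_integralZl//; last by rewrite lee_fin ltW.
  apply: ge0_le_integral => //.
  - by move=> y _; rewrite mule_ge0// hkE_ge0.
  - by apply: emeasurable_funM => //; exact: measurable_hk_vsubr.
  - exact: emeasurable_funM.
  - by move=> y _; rewrite lee_wpmul2r// lee_fin hC.
have mh := measurable_heat s t mg g0.
have aE (x : \bar R) : 0 <= x -> x `^ a = x `^ (a - 1) * x.
  move=> x0; rewrite -[in LHS](subrK 1%R a) (@poweRD _ x (a - 1) 1) ?poweRe1//.
  by apply: add_neq0_poweRD_def; rewrite subrK gt_eqF// (lt_le_trans ltr01).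
have k0 : 0 <= (c `^ (a - 1))%:E * I `^ (a - 1).
  by rewrite mule_ge0 ?poweR_ge0// lee_fin powR_ge0.
apply: (@le_trans _ _ (\int[mu]_x ((c `^ (a - 1))%:E * I `^ (a - 1) * heat s t g x))).
  apply: ge0_le_integral => //.
  - by move=> x _; exact: poweR_ge0.
  - exact: (measurableT_comp (measurable_poweR a) mh).
  - exact: emeasurable_funM.
  - move=> x _; rewrite aE ?heat_ge0// lee_wpmul2r ?heat_ge0//.
    rewrite -poweR_EFin -poweRM ?lee_fin ?(ltW c0)//.
    by apply: le_poweR => //; exact: heat_ge0.
rewrite ge0_integralZl//; last by move=> x _; exact: heat_ge0.
by rewrite integral_heat// -muleA -aE.
Qed.

Lemma measurable_enorm_powR (e : R) : measurable_fun setT (fun y => (enorm y `^ e)%:E).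
Proof.
apply/measurable_EFinP.
apply: measurable_powR_fun.
exact: measurable_enorm.
Qed.

End smoothing.

Section weight.
Context {R : realType} {N : nat}.
Local Notation mu := (lebesgue_tuple R N).
Implicit Types x y : N.-tuple R.
Variables (s : R) (E : R -> N.-tuple R -> R).
Hypotheses (N0 : (0 < N)%N) (s0 : (0 < s)%R) (kE : is_kernel s E).
Let theta : R := (N%:R / (2 * s))%R.
Local Open Scope ereal_scope.

(* Where [|y| <= r], every coordinate satisfies [|y_i| <= r] and [|y| >= |y_i|], so [|y|^(-e)]
   is at most the product of the one-dimensional weights [|y_i|^(-e/N)]. *)
Lemma enorm_powRN_le (e r : R) y : (0 <= e)%R -> (0 < r)%R -> (forall i, tnth y i != 0%R) ->
  (enorm y `^ (- e) <= \prod_(i < N) (`|tnth y i| `^ (- (e / N%:R)) * \1_`[(- r)%R, r] (tnth y i))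
     + r `^ (- e))%R.
Proof.
move=> e0 r0 y0; have N0R : (0 < N%:R :> R)%R by rewrite ltr0n.
have yi0 i : (0 < `|tnth y i|)%R by rewrite normr_gt0.
have y_gt0 : (0 < enorm y)%R.
  exact: lt_le_trans (yi0 (Ordinal N0)) (normr_tnth_le_enorm y _).
have eN0 : (0 <= e / N%:R)%R by rewrite divr_ge0// ltW.
have [yr|ry] := leP (enorm y) r.
  rewrite (le_trans (_ : _ <= \prod_(i < N) (`|tnth y i| `^ (- (e / N%:R)) *
      \1_`[(- r)%R, r] (tnth y i)))%R) ?lerDl ?powR_ge0//.
  have -> : (enorm y `^ (- e) = \prod_(i < N) enorm y `^ (- (e / N%:R)))%R.
    rewrite prodr_const card_ord -powR_mulrn ?powR_ge0// -powRrM; congr powR.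
    by rewrite mulNr divfK// gt_eqF.
  apply: ler_prod => i _; rewrite powR_ge0/= indicE mem_setE in_itv/= -ler_norml.
  rewrite (le_trans (normr_tnth_le_enorm y i) yr) mulr1 !powRN.
  rewrite lef_pV2 ?posrE ?powR_gt0// ge0_ler_powR ?nnegrE ?(ltW (yi0 i)) ?(ltW y_gt0)//.
  exact: normr_tnth_le_enorm.
rewrite (le_trans (_ : _ <= r `^ (- e))%R) ?lerDr//; last first.
  by apply: prodr_ge0 => i _; rewrite mulr_ge0// powR_ge0.
rewrite !powRN lef_pV2 ?posrE ?powR_gt0//.
by rewrite ge0_ler_powR ?nnegrE ?(ltW y_gt0) ?(ltW r0) ?(ltW ry).
Qed.

(** The weight is cut at the scale [r = t^(1/(2s))]. Near the origin it is integrable since [e < N],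
    and the kernel is bounded by its supremum; away from it the weight is at most [r^(-e)] and the
    kernel has mass 1. Both parts have size [t^(-e/(2s))]. *)
Lemma heat_weight_le (e : R) : (0 <= e < N%:R)%R -> exists2 C : R, (0 < C)%R &
  forall t x, (0 < t)%R ->
  heat s t (fun y => (enorm y `^ (- e))%:E) x <= (C * t `^ (- (e / (2 * s))))%:E.
Proof.
move=> /andP[e0 eN]; have N0R : (0 < N%:R :> R)%R by rewrite ltr0n.
have eN1 : (-1 < - (e / N%:R))%R by rewrite ltrN2 ltr_pdivrMr ?mul1r.
have [A A0 hA] := @integral_normr_powR_le R _ eN1.
have [B B0 hB] := @hk_le R N s N0 s0.
exists (B * A ^+ N + 1)%R; first by rewrite ltr_wpDl// mulr_ge0 ?exprn_ge0// ltW.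
move=> t x t0; pose r : R := (t `^ (2 * s)^-1)%R.
have r0 : (0 < r)%R by rewrite powR_gt0.
pose f (i : 'I_N) (a : R) : \bar R := (`|a| `^ (- (e / N%:R)) * \1_`[(- r)%R, r] a)%:E.
have mf i : measurable_fun setT (f i).
  apply/measurable_EFinP; apply: measurable_funM; last exact: measurable_indic.
  apply: measurable_powR_fun.
  exact: normr_measurable.
have f0 i a : 0 <= f i a by rewrite lee_fin mulr_ge0// powR_ge0.
have mp : measurable_fun [set: N.-tuple R] (fun y => \prod_(i < N) f i (tnth y i)).
  by apply: measurable_prode => i; exact: (measurableT_comp (mf i) (measurable_tnthT i)).
have p0 y : 0 <= \prod_(i < N) f i (tnth y i) by apply: prode_ge0.
have c0 : (0 <= B * t `^ (- theta))%R by rewrite mulr_ge0 ?powR_ge0// ltW.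
have mh := measurable_hk_vsubr s t x.
have hr : 0 <= (r `^ (- e))%:E by rewrite lee_fin powR_ge0.
apply: (@le_trans _ _ (\int[mu]_y ((B * t `^ (- theta))%:E * (\prod_(i < N) f i (tnth y i)) +
    (r `^ (- e))%:E * (hk s t (vsub x y))%:E))).
  apply: ae_ge0_le_integral => //.
  - by move=> y _; rewrite mule_ge0 ?hkE_ge0// lee_fin powR_ge0.
  - by apply: emeasurable_funM => //; exact: measurable_enorm_powR.
  - by move=> y _; rewrite adde_ge0// mule_ge0 ?hkE_ge0.
  - by apply: emeasurable_funD; exact: emeasurable_funM.
  - apply: filterS (@ae_tnth_neq0 R N) => y y0 _.
    apply: (@le_trans _ _ ((hk s t (vsub x y))%:E * (\prod_(i < N) f i (tnth y i) + (r `^ (- e))%:E))).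
      rewrite lee_wpmul2l ?hkE_ge0// (le_trans (_ : _ <= (\prod_(i < N) (`|tnth y i| `^ (- (e / N%:R))
        * \1_`[(- r)%R, r] (tnth y i)) + r `^ (- e))%R%:E))//.
        by rewrite lee_fin; exact: enorm_powRN_le.
      by rewrite EFinD prodEFin.
    rewrite ge0_muleDr// leeD//; first by rewrite lee_wpmul2r// lee_fin hB.
    by rewrite muleC.
rewrite ge0_integralD//; last 4 first.
- by move=> y _; rewrite mule_ge0.
- exact: emeasurable_funM.
- by move=> y _; rewrite mule_ge0 ?hkE_ge0.
- exact: emeasurable_funM.
rewrite (ge0_integralZl _ measurableT)// (ge0_integralZl _ measurableT)//; last first.
  by move=> y _; exact: hkE_ge0.
rewrite (integral_hk_vsubr N0 s0 kE)// ge0_integral_prod//.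
apply: (@le_trans _ _ ((B * t `^ (- theta))%:E * ((A * r `^ (- (e / N%:R) + 1)) ^+ N)%:E + (r `^ (- e))%:E * 1)).
  apply: leeD => //; apply: lee_wpmul2l => //.
  apply: (@le_trans _ _ (\prod_(i < N) (A * r `^ (- (e / N%:R) + 1))%:E)).
    by apply: lee_prod_ord => i; rewrite integral_ge0//= hA.
  by rewrite prodEFin prodr_const card_ord.
rewrite mule1 -EFinM -EFinD lee_fin.
have rE (c : R) : (r `^ c = t `^ (c / (2 * s)))%R by rewrite /r -powRrM mulrC.
rewrite exprMn -[(r `^ _ ^+ N)%R]powR_mulrn ?powR_ge0// -powRrM !rE mulNr.
rewrite [leRHS]mulrDl mul1r lerD2r le_eqVlt; apply/orP; left; apply/eqP.
rewrite mulrACA; congr (_ * _)%R.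
rewrite -powRD; last by rewrite (gt_eqF t0) implybT.
by congr powR; rewrite /theta; field; rewrite !gt_eqF.
Qed.

(** Jensen's inequality with exponent [r/p], against the kernel multiplied by [|y|^(-b')], bounds
    the term by [heat] of [g^r]; the mass of that measure is controlled by [heat_weight_le], whence
    [b' < N]. The estimate from L^1 to L^p, applied to [g^r], finishes. The constant is an [r]-th
    root because the bound is written as an [r]-th power. *)
Lemma integral_poweR_heat_weight_le (b p r : R) : (0 <= b)%R -> (1 <= p)%R -> (p < r)%R ->
  (b * (r / (r - p)) < N%:R)%R ->
  exists2 C : R, (0 < C)%R & forall t g, (0 < t)%R ->
  measurable_fun setT g -> (forall y, 0 <= g y) ->
  \int[mu]_x (heat s t (fun y => (enorm y `^ (- b))%:E * g y `^ p) x `^ r) <=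
    ((C * t `^ (- (b / (2 * s) + theta * (p - 1) / r))) `^ r)%:E *
    (\int[mu]_x (g x `^ r)) `^ p.
Proof.
move=> b0 p1 pr bN; have p0 : (0 < p)%R by rewrite (lt_le_trans ltr01).
have r0 : (0 < r)%R by rewrite (lt_trans p0).
have rp0 : (0 < r - p)%R by rewrite subr_gt0.
pose b' := (b * (r / (r - p)))%R.
have b'0 : (0 <= b')%R by rewrite mulr_ge0// divr_ge0// ltW.
have q1 : (1 <= r / p)%R by rewrite ler_pdivlMr// mul1r ltW.
have [A A0 hA] := @heat_weight_le b' (introT andP (conj b'0 bN)).
have [B B0 hB] := @integral_poweR_heat_le R N s E N0 s0 kE.
exists ((A `^ (r - p) * B `^ (p - 1)) `^ r^-1)%R.
  by rewrite powR_gt0// mulr_gt0// powR_gt0.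
move=> t g t0 mg g0; pose J : R := (A * t `^ (- (b' / (2 * s))))%R.
have J0 : (0 < J)%R by rewrite mulr_gt0// powR_gt0.
have mgr : measurable_fun setT (fun y => g y `^ r).
  exact: (measurableT_comp (measurable_poweR r) mg).
have gr0 y : 0 <= g y `^ r by exact: poweR_ge0.
pose F y := (enorm y `^ (- b))%:E * g y `^ p.
have mF : measurable_fun setT F.
  apply: emeasurable_funM; first exact: measurable_enorm_powR.
  exact: (measurableT_comp (measurable_poweR p) mg).
have F0 y : 0 <= F y by rewrite mule_ge0 ?poweR_ge0// lee_fin powR_ge0.
have hF x : heat s t F x `^ (r / p) <= (J `^ (r / p - 1))%:E * heat s t (fun y => g y `^ r) x.
  (* [b'] is [b] times the exponent conjugate to [r / p], so that [k G^(r/p)] has no weight left. *)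
  pose k y := (hk s t (vsub x y))%:E * (enorm y `^ (- b'))%:E.
  pose G y := (enorm y `^ (b' - b))%:E * g y `^ p.
  have mk : measurable_fun setT k.
    by apply: emeasurable_funM; [exact: measurable_hk_vsubr|exact: measurable_enorm_powR].
  have k0 y : 0 <= k y by rewrite mule_ge0 ?hkE_ge0// lee_fin powR_ge0.
  have mG : measurable_fun setT G.
    apply: emeasurable_funM; first exact: measurable_enorm_powR.
    exact: (measurableT_comp (measurable_poweR p) mg).
  have G0 y : 0 <= G y by rewrite mule_ge0 ?poweR_ge0// lee_fin powR_ge0.
  have := poweR_integral_le mk k0 mG G0 J0 (hA t x t0) q1.
  have -> : \int[mu]_y (k y * G y) = heat s t F x.
    apply: eq_integral => y _; rewrite /k /G /F -!muleA; congr (_ * _).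
    rewrite muleA -EFinM; congr (_%:E * _).
    (* At the origin the powers cannot be added, but [0^c = 0] for [c != 0] makes both sides vanish
       unless [b = 0], when all the weights equal 1. *)
    have [y0|y0] := eqVneq (enorm y) 0%R; last first.
      by rewrite -powRD ?y0 ?implybT//; congr powR; ring.
    rewrite y0; have [bz|bn0] := eqVneq b 0%R.
      by rewrite /b' bz mul0r subrr oppr0 powRr0 mulr1.
    rewrite [in RHS]powR0 ?oppr_eq0// powR0 ?mul0r// oppr_eq0 /b' mulf_neq0//.
    by rewrite mulf_neq0 ?invr_eq0 ?gt_eqF.
  move/le_trans; apply; rewrite lee_wpmul2l ?lee_fin ?powR_ge0//.
  apply: ge0_le_integral => //.
  - by move=> y _; rewrite mule_ge0 ?poweR_ge0.
  - apply: emeasurable_funM => //.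
    exact: (measurableT_comp (measurable_poweR _) mG).
  - by apply: emeasurable_funM => //; exact: measurable_hk_vsubr.
  - move=> y _; rewrite /k -muleA lee_wpmul2l ?hkE_ge0// /G poweRM ?lee_fin ?poweR_ge0 ?powR_ge0//.
    rewrite -poweRrM (_ : p * (r / p) = r)%R; last by field; rewrite gt_eqF.
    rewrite poweR_EFin muleA -EFinM -[leRHS]mul1e lee_wpmul2r// lee_fin -powRrM.
    have -> : ((b' - b) * (r / p) = b')%R by rewrite /b'; field; rewrite !gt_eqF.
    have [y0|y0] := eqVneq (enorm y) 0%R; last first.
      by rewrite -powRD ?y0 ?implybT// addNr powRr0.
    rewrite y0; have [->|bn0] := eqVneq b' 0%R; first by rewrite oppr0 powRr0 mulr1.
    by rewrite powR0 ?oppr_eq0// mul0r.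
have mHF := measurable_heat s t mF F0.
have mHg := measurable_heat s t mgr gr0.
apply: (@le_trans _ _ (\int[mu]_x ((J `^ (r - p))%:E * heat s t (fun y => g y `^ r) x `^ p))).
  apply: ge0_le_integral => //.
  - by move=> x _; exact: poweR_ge0.
  - exact: (measurableT_comp (measurable_poweR _) mHF).
  - by apply: emeasurable_funM => //; exact: (measurableT_comp (measurable_poweR _) mHg).
  - move=> x _; have -> : (r = r / p * p)%R by field; rewrite gt_eqF.
    rewrite poweRrM; apply: (le_trans (le_poweR (ltW p0) _ (hF x))); first exact: poweR_ge0.
    rewrite poweRM ?lee_fin ?powR_ge0 ?heat_ge0// poweR_EFin -powRrM.
    have -> : ((r / p - 1) * p = r / p * p - p)%R by ring.
    have -> : (r / p * p = r)%R by field; rewrite gt_eqF.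
    by [].
rewrite (ge0_integralZl _ measurableT)//; last 3 first.
- exact: (measurableT_comp (measurable_poweR _) mHg).
- by move=> x _; exact: poweR_ge0.
- by rewrite lee_fin powR_ge0.
apply: (le_trans (lee_wpmul2l _ (hB t p _ t0 p1 mgr gr0))); first by rewrite lee_fin powR_ge0.
rewrite muleA lee_wpmul2r ?poweR_ge0// -EFinM lee_fin le_eqVlt; apply/orP; left; apply/eqP.
rewrite [RHS]powRM ?powR_ge0// -!powRrM mulVf ?gt_eqF// powRr1 ?mulr_ge0 ?powR_ge0//.
rewrite /J !powRM ?powR_ge0 ?(ltW A0) ?(ltW B0)// -!powRrM mulrACA; congr (_ * _)%R.
rewrite -powRD; last by rewrite (gt_eqF t0) implybT.
by congr powR; rewrite /b' /theta; field; rewrite !gt_eqF.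
Qed.

End weight.

Section minkowski.
Context {R : realType}.
Local Open Scope ereal_scope.
Local Notation leb := (@lebesgue_measure R).
Context d (T : measurableType d) (m : {sigma_finite_measure set T -> \bar R}).

(* A weak form of Minkowski's integral inequality: Jensen's inequality for the measure
   [kappa(sigma) d sigma] applied to [G / kappa], followed by Tonelli's theorem. *)
Lemma integral_poweR_integral_le (D : set R) (G : R * T -> \bar R) (kappa : R -> R) (J r : R) :
  measurable D -> measurable_fun setT G -> (forall z, 0 <= G z) ->
  measurable_fun setT kappa -> (forall x, D x -> (0 < kappa x)%R) ->
  (0 < J)%R -> \int[leb]_(x in D) (kappa x)%:E <= J%:E -> (1 <= r)%R ->
  (forall x, D x -> \int[m]_y (G (x, y) `^ r) <= ((kappa x) `^ r)%:E) ->
  \int[m]_y ((\int[leb]_(x in D) G (x, y)) `^ r) <= (J `^ r)%:E.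
Proof.
move=> mD mG G0 mk k0 J0 kJ r1 hG; have r0 : (0 < r)%R by rewrite (lt_le_trans ltr01).
pose k (x : R) : \bar R := (kappa x * \1_D x)%:E.
have mk' : measurable_fun setT k.
  by apply/measurable_EFinP; apply: measurable_funM => //; exact: measurable_indic.
have k'0 x : 0 <= k x.
  rewrite lee_fin indicE; case: (boolP (x \in D)) => [/set_mem/k0/ltW kx|_].
    by rewrite mulr1.
  by rewrite mulr0.
have kE f : \int[leb]_x (k x * f x) = \int[leb]_(x in D) ((kappa x)%:E * f x).
  rewrite [RHS]integral_mkcond; apply: eq_integral => x _; rewrite /k patchE indicE.
  by case: ifP => _; rewrite ?mulr1 ?mulr0 ?mul0e.
have Jk : \int[leb]_x k x <= J%:E.
  by under eq_integral do rewrite -[k _]mule1; rewrite kE; under eq_integral do rewrite mule1.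
pose H (z : R * T) := ((kappa z.1) `^ (-1))%:E * G z.
have mkp e : measurable_fun [set: R * T] (fun z : R * T => ((kappa z.1) `^ e)%:E).
  apply/measurable_EFinP.
  apply: measurable_powR_fun.
  exact: measurableT_comp mk measurable_fst.
have mkH : measurable_fun [set: R * T] (fun z => k z.1).
  exact: measurableT_comp mk' measurable_fst.
have mH : measurable_fun setT H by apply: emeasurable_funM.
have H0 z : 0 <= H z by rewrite mule_ge0// lee_fin powR_ge0.
have mHr : measurable_fun setT (fun z => k z.1 * H z `^ r).
  by apply: emeasurable_funM => //; exact: measurableT_comp (measurable_poweR r) mH.
have GH y : \int[leb]_(x in D) G (x, y) = \int[leb]_x (k x * H (x, y)).
  rewrite kE; apply: eq_integral => x /set_mem Dx; rewrite /H muleA -EFinM.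
  by rewrite /= powR_inv1 ?(ltW (k0 x Dx))// mulfV ?mul1e// gt_eqF// k0.
have mGy : measurable_fun setT (fun y => \int[leb]_(x in D) G (x, y)).
  under eq_fun do rewrite GH.
  apply: (@measurable_fun_fubini_tonelli_G _ _ _ _ _ leb (fun z => k z.1 * H z)).
    exact: emeasurable_funM.
  by move=> z; rewrite mule_ge0.
apply: (@le_trans _ _ (\int[m]_y ((J `^ (r - 1))%:E * \int[leb]_x (k x * H (x, y) `^ r)))).
  apply: ge0_le_integral => //.
  - by move=> y _; exact: poweR_ge0.
  - exact: measurableT_comp (measurable_poweR r) mGy.
  - apply: emeasurable_funM => //.
    apply: (@measurable_fun_fubini_tonelli_G _ _ _ _ _ leb (fun z => k z.1 * H z `^ r)) => //.
    by move=> z; rewrite mule_ge0 ?poweR_ge0.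
  - move=> y _; rewrite GH; apply: poweR_integral_le => //.
    exact: measurableT_comp mH (pair2_measurable y).
rewrite (ge0_integralZl _ measurableT)//; last 3 first.
- apply: (@measurable_fun_fubini_tonelli_G _ _ _ _ _ leb (fun z => k z.1 * H z `^ r)) => //.
  by move=> z; rewrite mule_ge0 ?poweR_ge0.
- by move=> y _; apply: integral_ge0 => x _; rewrite mule_ge0 ?poweR_ge0.
- by rewrite lee_fin powR_ge0.
rewrite -(@fubini_tonelli _ _ _ _ _ leb m (fun z => k z.1 * H z `^ r))//=; last first.
  by move=> z; rewrite mule_ge0 ?poweR_ge0.
have -> : (J `^ r)%:E = (J `^ (r - 1))%:E * J%:E.
  by rewrite -EFinM powRB ?(gt_eqF J0) ?implybT// powRr1 ?(ltW J0)// divfK// gt_eqF.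
rewrite lee_wpmul2l ?lee_fin ?powR_ge0//; apply: le_trans kJ.
rewrite [leRHS]integral_mkcond; apply: ge0_le_integral => //.
- by move=> x _; apply: integral_ge0 => y _; rewrite mule_ge0 ?poweR_ge0.
- apply: (measurable_fun_fubini_tonelli_F (fun z => k z.1 * H z `^ r)) => //.
  by move=> z; rewrite mule_ge0 ?poweR_ge0.
- apply/(measurable_restrictT _ _).1 => //; apply/measurable_EFinP; exact: measurable_funTS.
- move=> x _; rewrite patchE; case: ifPn => [/set_mem Dx|xD]; last first.
    rewrite integral0_eq// => y _; rewrite /k indicE (negbTE xD) mulr0 mul0e//.
  have kx := k0 x Dx.
  rewrite ge0_integralZl//; last 2 first.
  + by apply: measurableT_comp (measurable_poweR r) _; exact: measurableT_comp mH (pair1_measurable x).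
  + by move=> y _; exact: poweR_ge0.
  rewrite /H/=; under eq_integral do rewrite poweRM ?lee_fin ?powR_ge0//.
  rewrite ge0_integralZl//; last 3 first.
  + by apply: measurableT_comp (measurable_poweR r) _; exact: measurableT_comp mG (pair1_measurable x).
  + by move=> y _; exact: poweR_ge0.
  + exact: poweR_ge0.
  apply: (@le_trans _ _ (k x * (((kappa x `^ (-1))%:E `^ r) * ((kappa x) `^ r)%:E))).
    by rewrite !lee_wpmul2l ?poweR_ge0 ?hG.
  rewrite poweR_EFin -EFinM -powRM ?powR_ge0 ?(ltW kx)// powR_inv1 ?(ltW kx)// mulVf ?gt_eqF//.
  by rewrite powR1 indicE mem_set// !mulr1.
Qed.

(** A crude triangle inequality: [(f + g)^r <= 2^r (f^r + g^r)] costs a factor 2, and the sum of two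
    terms [M^r <= (2 M)^r / 2^(r-1)] another one. *)
Lemma integral_poweR_add_le (f g : T -> \bar R) (M r : R) : (1 <= r)%R -> (0 <= M)%R ->
  measurable_fun setT f -> measurable_fun setT g ->
  (forall x, 0 <= f x) -> (forall x, 0 <= g x) ->
  \int[m]_x (f x `^ r) <= (M `^ r)%:E -> \int[m]_x (g x `^ r) <= (M `^ r)%:E ->
  \int[m]_x ((f x + g x) `^ r) <= ((4 * M) `^ r)%:E.
Proof.
move=> r1 M0 mf mg f0 g0 fM gM; have r0 : (0 <= r)%R by rewrite (le_trans ler01).
have mr (h : T -> \bar R) : measurable_fun setT h -> measurable_fun setT (fun x => h x `^ r).
  by move=> mh; exact: measurableT_comp (measurable_poweR r) mh.
apply: (@le_trans _ _ (\int[m]_x ((2 `^ r)%:E * (f x `^ r + g x `^ r)))).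
  apply: ge0_le_integral => //.
  - by move=> x _; exact: poweR_ge0.
  - by apply: mr; exact: emeasurable_funD.
  - by apply: emeasurable_funM => //; apply: emeasurable_funD; exact: mr.
  - move=> x _.
    have step (u v : \bar R) : 0 <= u -> 0 <= v -> u <= v -> (u + v) `^ r <= (2 `^ r)%:E * (u `^ r + v `^ r).
      move=> u0 v0 uv; apply: (@le_trans _ _ ((2%:E * v) `^ r)).
        by apply: le_poweR; rewrite ?adde_ge0// mule_natl mule2n leeD2r.
      rewrite poweRM// poweR_EFin lee_wpmul2l ?lee_fin ?powR_ge0//.
      by rewrite leeDr// poweR_ge0.
    have [fg|/ltW gf] := leP (f x) (g x); first exact: step.
    by rewrite addeC [X in _ <= _ * X]addeC; exact: step.
rewrite (ge0_integralZl _ measurableT)//; last 2 first.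
- by apply: emeasurable_funD; exact: mr.
- by move=> x _; rewrite adde_ge0 ?poweR_ge0.
rewrite ge0_integralD//; last 4 first.
- by move=> x _; exact: poweR_ge0.
- exact: mr.
- by move=> x _; exact: poweR_ge0.
- exact: mr.
apply: (@le_trans _ _ ((2 `^ r)%:E * ((M `^ r)%:E + (M `^ r)%:E))).
  by rewrite lee_wpmul2l ?leeD// lee_fin powR_ge0.
rewrite -EFinD -EFinM lee_fin powRM//.
have -> : (4 = 2 * 2 :> R)%R by rewrite -natrM.
rewrite powRM// -[X in (X + X)%R]mul1r -mulrDl -mulrA ler_wpM2l ?powR_ge0//.
rewrite ler_wpM2r ?powR_ge0// -[leLHS]powRr1//.
by rewrite -[(1 + 1)%R]/(2%:R : R) ler_powR// ler1n.
Qed.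

End minkowski.

Section LqLr.
Context {R : realType} {N : nat}.
Local Notation mu := (lebesgue_tuple R N).
Variables (s : R) (E : R -> N.-tuple R -> R).
Hypotheses (N0 : (0 < N)%N) (s0 : (0 < s)%R) (kE : is_kernel s E).
Local Open Scope ereal_scope.

(** Jensen's inequality moves the power [q] inside the semigroup, which reduces the claim to the
    estimate from L^1 to L^(r/q) for [g^q]. *)
Lemma integral_poweR_heat_LqLr (q r : R) : (1 <= q)%R -> (q <= r)%R ->
  exists2 C : R, (0 < C)%R & forall t g M, (0 < t)%R -> (0 <= M)%R ->
  measurable_fun setT g -> (forall y, 0 <= g y) ->
  \int[mu]_x (g x `^ q) <= (M `^ q)%:E ->
  \int[mu]_x (heat s t g x `^ r) <=
    ((C * t `^ (- (N%:R / (2 * s) * (q^-1 - r^-1))) * M) `^ r)%:E.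
Proof.
move=> q1 qr; have q0 : (0 < q)%R by rewrite (lt_le_trans ltr01).
have r0 : (0 < r)%R by rewrite (lt_le_trans q0).
have [B B0 hB] := @integral_poweR_heat_le R N s E N0 s0 kE.
exists (B `^ (q^-1 - r^-1))%R; first by rewrite powR_gt0.
move=> t g M t0 M0 mg g0 gM.
have mgq : measurable_fun setT (fun y => g y `^ q).
  exact: (measurableT_comp (measurable_poweR q) mg).
have gq0 y : 0 <= g y `^ q by exact: poweR_ge0.
have rq : (r = q * (r / q))%R by field; rewrite gt_eqF.
have rq1 : (1 <= r / q)%R by rewrite ler_pdivlMr// mul1r.
have rq0 : (0 <= r / q)%R by rewrite (le_trans ler01).
apply: (@le_trans _ _ (\int[mu]_x (heat s t (fun y => g y `^ q) x `^ (r / q)))).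
  apply: ge0_le_integral => //.
  - by move=> x _; exact: poweR_ge0.
  - exact: measurableT_comp (measurable_poweR _) (measurable_heat s t mg g0).
  - exact: measurableT_comp (measurable_poweR _) (measurable_heat s t mgq gq0).
  - move=> x _; rewrite [in leLHS]rq poweRrM le_poweR ?poweR_ge0//.
    exact: (poweR_heat_le N0 s0 kE).
apply: (le_trans (hB t (r / q)%R _ t0 rq1 mgq gq0)).
apply: (@le_trans _ _ (((B * t `^ (- (N%:R / (2 * s)))) `^ (r / q - 1))%:E * (M `^ q)%:E `^ (r / q))).
  rewrite lee_wpmul2l ?lee_fin ?powR_ge0//; apply: le_poweR => //.
  exact: integral_ge0.
rewrite poweR_EFin -EFinM lee_fin -powRrM -rq.
rewrite [leRHS]powRM ?mulr_ge0 ?powR_ge0// ler_wpM2r ?powR_ge0//.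
rewrite !powRM ?powR_ge0 ?(ltW B0)// -!powRrM le_eqVlt; apply/orP; left; apply/eqP.
by congr (_ * _)%R; congr powR; field; rewrite !gt_eqF.
Qed.

End LqLr.

(** * The integral equation *)

Section sigma_finite_product.
Context d1 d2 (T1 : measurableType d1) (T2 : measurableType d2) (R : realType).
Variables (m1 : {sigma_finite_measure set T1 -> \bar R})
  (m2 : {sigma_finite_measure set T2 -> \bar R}).

Lemma sigma_finite_product : sigma_finite setT (m1 \x m2)%E.
Proof.
have /sigma_finiteP[F [TF ndF Foo]] := sigma_finiteT m1.
have /sigma_finiteP[G [TG ndG Goo]] := sigma_finiteT m2.
exists (fun n => F n `*` G n) => [|n].
  apply/seteqP; split => // -[x y] _.
  have [i _ Fx] : (\bigcup_i F i) x by rewrite -TF.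
  have [j _ Gy] : (\bigcup_j G j) y by rewrite -TG.
  exists (maxn i j) => //; split.
    by move: x Fx; exact/subsetPset/ndF/leq_maxl.
  by move: y Gy; exact/subsetPset/ndG/leq_maxr.
have [mF Fn] := Foo n; have [mG Gn] := Goo n; split; first exact: measurableX.
by rewrite product_measure1E// lte_mul_pinfty// ge0_fin_numE.
Qed.

(* The instance that the library attaches to [m1 \x m2] only covers subprobabilities. *)
Definition prod_measure : {sigma_finite_measure set (T1 * T2)%type -> \bar R} :=
  HB.pack (m1 \x m2)%E (Measure_isSigmaFinite.Build _ _ _ (m1 \x m2)%E sigma_finite_product).

End sigma_finite_product.

Section duhamel_kernel.
Context {R : realType} {N : nat}.
Local Notation mu := (lebesgue_tuple R N).
Local Notation leb := (@lebesgue_measure R).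
Local Notation zmu := (prod_measure leb mu).
Local Notation Z := (measurableTypeR R * N.-tuple R)%type.

(* The Duhamel term at [z = (t, x)] is the integral over space-time of [dker s h b z] times the
   nonlinearity; the indicator restricts the time variable to [sigma < t]. *)
Definition dker (s : R) (h : R -> R) (b : R) (z w : Z) : R :=
  h w.1 * \1_(`]0, +oo[ : set R) (z.1 - w.1) *
  (hk s (z.1 - w.1) (vsub z.2 w.2) * enorm w.2 `^ (- b)).

Variables (s b : R) (h : R -> R).
Hypotheses (mh : measurable_fun setT h) (h0 : forall x, 0 <= h x).

Lemma dker_ge0 z w : 0 <= dker s h b z w.
Proof. by rewrite !mulr_ge0 ?hk_ge0 ?powR_ge0. Qed.

Lemma measurable_dker : measurable_fun [set: Z * Z] (fun zw => dker s h b zw.1 zw.2).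
Proof.
have m1 : measurable_fun [set: Z * Z] (fun z => z.1.1 : R).
  exact: (measurableT_comp measurable_fst measurable_fst).
have m2 : measurable_fun [set: Z * Z] (fun z => z.2.1 : R).
  exact: (measurableT_comp measurable_fst measurable_snd).
have m3 : measurable_fun [set: Z * Z] (fun z => z.1.2 : N.-tuple R).
  exact: (measurableT_comp measurable_snd measurable_fst).
have m4 : measurable_fun [set: Z * Z] (fun z => z.2.2 : N.-tuple R).
  exact: (measurableT_comp measurable_snd measurable_snd).
have md : measurable_fun [set: Z * Z] (fun z => z.1.1 - z.2.1 : R).
  exact: measurable_funB.
apply: measurable_funM; apply: measurable_funM.
- exact: (measurableT_comp mh m2).
- apply: (@measurableT_comp _ _ _ _ _ _ (\1_(`]0, +oo[ : set R) : R -> R)) => //.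
- by apply: measurable_hk_fun => //; exact: measurable_vsub.
- apply: measurable_powR_fun.
  exact: (measurableT_comp measurable_enorm m4).
Qed.

Hypothesis (hneg : forall x, x <= 0 -> h x = 0).
Local Open Scope ereal_scope.

Lemma measurable_dkerM (g : Z -> \bar R) : measurable_fun setT g ->
  measurable_fun [set: Z * Z] (fun zw => (dker s h b zw.1 zw.2)%:E * g zw.2).
Proof.
move=> mg; apply: emeasurable_funM; first by apply/measurable_EFinP; exact: measurable_dker.
exact: measurableT_comp mg measurable_snd.
Qed.

Lemma measurable_dkerMr (g : Z -> \bar R) z : measurable_fun setT g ->
  measurable_fun [set: Z] (fun w => (dker s h b z w)%:E * g w).
Proof. by move=> mg; exact: (measurableT_comp (measurable_dkerM mg) (pair1_measurable z)). Qed.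

Lemma dkerM_ge0 (g : Z -> \bar R) z w : (forall w, 0 <= g w) -> 0 <= (dker s h b z w)%:E * g w.
Proof. by move=> g0; rewrite mule_ge0// lee_fin dker_ge0. Qed.

Lemma measurable_integral_dker (g : Z -> \bar R) : measurable_fun setT g -> (forall w, 0 <= g w) ->
  measurable_fun [set: Z] (fun z => \int[zmu]_w ((dker s h b z w)%:E * g w)).
Proof.
move=> mg g0.
have f0 zw : 0 <= (dker s h b zw.1 zw.2)%:E * g zw.2 by exact: dkerM_ge0.
exact: (@measurable_fun_fubini_tonelli_F _ _ Z Z R zmu
  (fun zw => (dker s h b zw.1 zw.2)%:E * g zw.2) (measurable_dkerM mg) f0).
Qed.

Lemma integral_dker (g : Z -> \bar R) z : measurable_fun setT g -> (forall w, 0 <= g w) ->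
  \int[zmu]_w ((dker s h b z w)%:E * g w) =
  \int[leb]_(x in `]0%R, z.1[) ((h x)%:E *
    heat s (z.1 - x) (fun y => (enorm y `^ (- b))%:E * g (x, y)) z.2).
Proof.
move=> mg g0; rewrite [zmu]/=; rewrite fubini_tonelli1//; last 2 first.
- exact: measurable_dkerMr.
- by move=> w; exact: dkerM_ge0.
rewrite [RHS]integral_mkcond; apply: eq_integral => x _; rewrite patchE /fubini_F.
case: ifPn => xz.
  have {}xz := set_mem xz; move: (xz); rewrite /= in_itv/= => /andP[x0 xz1].
  rewrite /heat -ge0_integralZl//; last 3 first.
  - apply: emeasurable_funM; first exact: measurable_hk_vsubr.
    apply: emeasurable_funM; first exact: measurable_enorm_powR.
    exact: measurableT_comp mg (pair1_measurable x).
  - by move=> y _; rewrite mule_ge0 ?hkE_ge0// mule_ge0// lee_fin powR_ge0.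
  - by rewrite lee_fin.
  apply: eq_integral => y _; rewrite /dker indicE mem_set/=; last by rewrite in_itv/= subr_gt0 andbT.
  by rewrite mulr1 !EFinM !muleA.
apply: integral0_eq => y _; rewrite /dker.
have [xle|x0] := leP x 0%R; first by rewrite hneg// !mul0r mul0e.
rewrite indicE memNset ?mulr0 ?mul0r ?mul0e//= in_itv/= subr_gt0 andbT => xz1.
by move/negP : xz; apply; apply/mem_set; rewrite /= in_itv/= x0.
Qed.

(** Minkowski's inequality in time with the density [kappa(x) = M C c x^(a-nu) (t-x)^(-eta)], whose
    integral is of beta type; the conditions on [a - nu] and [eta] are its convergence at the two
    endpoints. Applied once to the forcing term, with [nu = 0], and once to the nonlinearity, with
    [nu = beta p]. *)
Lemma integral_poweR_dker_le (E : R -> N.-tuple R -> R) (M a nu eta r C : R) :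
  (0 < M)%R -> (forall x, (0 < x)%R -> h x <= M * x `^ a)%R ->
  (-1 < a - nu)%R -> (eta < 1)%R -> (1 <= r)%R -> (0 < C)%R ->
  exists2 C' : R, (0 < C')%R & forall (g : Z -> \bar R) c, (0 < c)%R ->
  measurable_fun setT g -> (forall w, 0 <= g w) ->
  (forall x t, (0 < x)%R -> (0 < t)%R ->
    \int[mu]_y (heat s t (fun y => (enorm y `^ (- b))%:E * g (x, y)) y `^ r) <=
    ((C * t `^ (- eta) * (c * x `^ (- nu))) `^ r)%:E) ->
  forall t, (0 < t)%R ->
    \int[mu]_y ((\int[zmu]_w ((dker s h b (t, y) w)%:E * g w)) `^ r) <=
    ((C' * c * t `^ (a - nu - eta + 1)) `^ r)%:E.
Proof.
move=> M0 hM a1 eta1 r1 C0; have eta1' : (-1 < - eta)%R by rewrite ltrN2.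
have [B B0 hB] := @integral_beta_le R _ _ a1 eta1'.
exists (M * C * B)%R; first by rewrite !mulr_gt0.
move=> g c c0 mg g0 hg t t0; have r0 : (0 < r)%R by rewrite (lt_le_trans ltr01).
under eq_integral do rewrite integral_dker//=.
pose kappa (x : R) : R := (M * C * c * (x `^ (a - nu) * (t - x) `^ (- eta)))%R.
pose K (zy : R * N.-tuple R * N.-tuple R) : \bar R :=
  (hk s (t - zy.1.1) (vsub zy.1.2 zy.2))%:E *
     ((enorm zy.2 `^ (- b))%:E * g (zy.1.1, zy.2)).
have m11 : measurable_fun [set: R * N.-tuple R * N.-tuple R] (fun z => z.1.1 : R).
  exact: (measurableT_comp measurable_fst measurable_fst).
have m12 : measurable_fun [set: R * N.-tuple R * N.-tuple R] (fun z => z.1.2 : N.-tuple R).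
  exact: (measurableT_comp measurable_snd measurable_fst).
have mK : measurable_fun setT K.
  apply: emeasurable_funM.
    apply/measurable_EFinP.
    apply: measurable_hk_fun; first exact: measurable_funB.
    by apply: measurable_vsub => //; exact: measurable_snd.
  apply: emeasurable_funM.
    exact: measurableT_comp (measurable_enorm_powR (- b)) measurable_snd.
  apply: (measurableT_comp mg (g := fun z : R * N.-tuple R * N.-tuple R => (z.1.1, z.2))).
  by apply: measurable_fun_pair => //; exact: measurable_snd.
have K0 z : 0 <= K z by rewrite mule_ge0 ?hkE_ge0// mule_ge0// lee_fin powR_ge0.
pose G (z : Z) : \bar R := (h z.1)%:E * heat s (t - z.1) (fun y => (enorm y `^ (- b))%:E * g (z.1, y)) z.2.
have mG : measurable_fun setT G.
  apply: emeasurable_funM.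
    by apply/measurable_EFinP; exact: measurableT_comp mh measurable_fst.
  exact: (measurable_fun_fubini_tonelli_F K).
have Wg0 (x : R) y : 0 <= (enorm y `^ (- b))%:E * g (x, y).
  by rewrite mule_ge0// lee_fin powR_ge0.
have G0 z : 0 <= G z by rewrite mule_ge0 ?lee_fin// heat_ge0.
have mWg (x : R) : measurable_fun setT (fun y => (enorm y `^ (- b))%:E * g (x, y)).
  apply: emeasurable_funM; first exact: measurable_enorm_powR.
  exact: measurableT_comp mg (pair1_measurable x).
apply: (@integral_poweR_integral_le R _ _ mu `]0%R, t[ G kappa) => //.
- apply: measurable_funM => //; apply: measurable_funM; first exact: measurable_powRl.
  apply: measurable_powR_fun.
  exact: measurable_funB.
- move=> x /=; rewrite in_itv/= => /andP[x0 xt].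
  by rewrite !mulr_gt0 ?powR_gt0 ?subr_gt0.
- by rewrite !mulr_gt0 ?powR_gt0.
- rewrite /kappa; under eq_integral do rewrite EFinM.
  rewrite ge0_integralZl//; last 3 first.
  + apply/measurable_EFinP; apply: measurable_funM; first exact: measurable_powRl.
    apply: (@measurable_comp _ _ _ _ _ _ setT (fun x : R => x `^ (- eta))%R) => //.
    exact: measurable_funB.
  + by move=> x _; rewrite lee_fin mulr_ge0 ?powR_ge0.
  + by rewrite lee_fin !mulr_ge0// ltW.
  apply: (le_trans (lee_wpmul2l _ (hB t t0))); first by rewrite lee_fin !mulr_ge0// ltW.
  rewrite -EFinM lee_fin le_eqVlt; apply/orP; left; apply/eqP; ring.
- move=> x /=; rewrite in_itv/= => /andP[x0 xt]; have tx0 : (0 < t - x)%R by rewrite subr_gt0.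
  have hh := measurable_heat s (t - x) (mWg x) (Wg0 x).
  rewrite /G/=; under eq_integral do rewrite poweRM ?lee_fin ?heat_ge0//.
  rewrite ge0_integralZl//; last 3 first.
  + exact: measurableT_comp (measurable_poweR r) hh.
  + by move=> y _; exact: poweR_ge0.
  + exact: poweR_ge0.
  apply: (le_trans (lee_wpmul2l _ (hg x (t - x)%R x0 tx0))); first exact: poweR_ge0.
  rewrite poweR_EFin -EFinM lee_fin -powRM ?h0//; last by rewrite !mulr_ge0 ?powR_ge0// ltW.
  rewrite ge0_ler_powR ?nnegrE ?(ltW r0)//.
  + by rewrite !mulr_ge0 ?powR_ge0// ltW.
  + by rewrite !mulr_ge0 ?powR_ge0// ltW.
  rewrite /kappa (le_trans (ler_wpM2r _ (hM x x0)))//; first by rewrite !mulr_ge0 ?powR_ge0// ltW.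
  rewrite powRD ?(gt_eqF x0) ?implybT// le_eqVlt; apply/orP; left; apply/eqP; ring.
Qed.

End duhamel_kernel.

(** * Convexity of powers *)

Section power_increments.
Context {R : realType}.
Implicit Types x y p : R.

(** Both [y] and [x + t] are convex combinations of [x] and [y + t], with the weights [c] and
    [1 - c] interchanged; adding the two convexity inequalities gives the claim. *)
Lemma powR_increment_le p x y t : 1 <= p -> 0 <= x -> x <= y -> 0 <= t ->
  (x + t) `^ p - x `^ p <= (y + t) `^ p - y `^ p.
Proof.
move=> p1 x0; rewrite le_eqVlt => /predU1P[->//|xy] t0.
have S0 : 0 < y + t - x by rewrite subr_gt0 (lt_le_trans xy)// lerDl.
have convex (c a : R) : 0 <= c <= 1 -> a = c * x + (1 - c) * (y + t) ->
    a `^ p <= c * x `^ p + (1 - c) * (y + t) `^ p.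
  move=> /andP[c0 c1] ->.
  have := @convex_powR R p p1 (Itv01 c0 c1) x (y + t).
  rewrite !inE /= !in_itv/= !andbT.
  rewrite x0 => /(_ isT); rewrite addr_ge0 ?(le_trans x0 (ltW xy))// => /(_ isT).
  by rewrite !convRE.
pose c := t / (y + t - x).
have c01 : 0 <= c <= 1.
  rewrite divr_ge0 ?(ltW S0)//= ler_pdivrMr// mul1r; lra.
have h1 := convex c y c01.
have h2 := convex (1 - c) (x + t).
have {}h1 : y `^ p <= c * x `^ p + (1 - c) * (y + t) `^ p.
  by apply: h1; rewrite /c; field; rewrite gt_eqF.
have {}h2 : (x + t) `^ p <= (1 - c) * x `^ p + (1 - (1 - c)) * (y + t) `^ p.
  by apply: h2; [case/andP: c01 => c0 c1; apply/andP; split; lra|rewrite /c; field; rewrite gt_eqF].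
by move: h1 h2; nra.
Qed.

(** This is what transports the domination of increments through the nonlinearity: the increment of
    a convex power is largest when it starts from the larger base [Y] and has the full length
    [X - Y]. *)
Lemma normr_powR_sub_le p (x y X Y : R) : 1 <= p -> 0 <= Y ->
  `|x| <= X -> `|y| <= Y -> `|x - y| <= X - Y ->
  `| `|x| `^ p - `|y| `^ p| <= X `^ p - Y `^ p.
Proof.
move=> p1 Y0 xX yY xy; have p0 : 0 <= p by rewrite (le_trans ler01).
have XY : 0 <= X - Y by exact: le_trans (normr_ge0 _) xy.
have inc (a b : R) : 0 <= b -> b <= a -> b <= Y -> a <= b + (X - Y) ->
    a `^ p - b `^ p <= X `^ p - Y `^ p.
  move=> b0 ba bY ab; have := powR_increment_le p1 b0 bY XY.
  rewrite [Y + _]addrC subrK; apply: le_trans; rewrite lerD2r.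
  by rewrite ge0_ler_powR// nnegrE ?(le_trans b0 ba)// addr_ge0.
have h : `| `|x| - `|y| | <= X - Y := le_trans (ler_dist_dist _ _) xy.
rewrite ler_norml in h; case/andP: h => h1 h2.
have [xly|/ltW ylx] := leP `|x| `|y|.
  rewrite ler0_norm ?opprB; last by rewrite subr_le0 ge0_ler_powR ?nnegrE.
  by apply: inc => //; [exact: le_trans yY|lra].
rewrite ger0_norm; last by rewrite subr_ge0 ge0_ler_powR ?nnegrE.
by apply: inc => //; lra.
Qed.

Lemma cvg_powR_ge0 p (u : R^nat) (l : R) : 1 <= p -> (forall n, 0 <= u n) ->
  u @ \oo --> l -> (u n `^ p) @[n --> \oo] --> l `^ p.
Proof.
move=> p1 u0 ul; have l0 : 0 <= l.
  by rewrite -(cvg_lim _ ul)//; apply: limr_ge; [apply/cvg_ex; exists l|exact: nearW].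
move: l0; rewrite le_eqVlt => /predU1P[l0|l0]; last first.
  have cl : {for l, continuous (fun x : R => x `^ p)}.
    apply: differentiable_continuous; apply/derivable1_diffP.
    by case: (is_derive1_powR p l0).
  exact: (cvg_comp u (fun x : R => x `^ p) ul cl).
rewrite -l0 powR0 ?gt_eqF ?(lt_le_trans ltr01)//.
move: ul; rewrite -l0 => ul.
(* The power is differentiated only at positive points, so the limit 0 is treated apart: once
   [u n <= 1], the power lies between 0 and [u n]. *)
apply: (@squeeze_cvgr _ _ _ _ (fun=> 0) u) => //; last exact: cvg_cst.
have : \forall n \near \oo, `|0 - u n| < 1 by move/cvgrPdist_lt : ul; apply.
apply: filterS => n; rewrite sub0r normrN ger0_norm// => un1; rewrite powR_ge0/=.
have := u0 n; rewrite le_eqVlt => /predU1P[<-|un0].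
  by rewrite powR0 ?gt_eqF ?(lt_le_trans ltr01).
by rewrite ge1r_powR// un0 ltW.
Qed.

End power_increments.

(** * Suprema of increasing sequences and the monotone iteration *)

Section majorant.
Context {R : realType}.
Local Open Scope ereal_scope.

Definition esup (u : (\bar R)^nat) : \bar R := ereal_sup (range u).

Lemma le_esup (u : (\bar R)^nat) n : u n <= esup u.
Proof. by apply: ereal_sup_ubound; exists n. Qed.

Lemma esup_le (u : (\bar R)^nat) M : (forall n, u n <= M) -> esup u <= M.
Proof. by move=> uM; apply: ge_ereal_sup => _ [n _ <-]; exact: uM. Qed.

Lemma poweR_esup_le (a : R) (u : (\bar R)^nat) : (0 < a)%R -> (forall n, 0 <= u n) ->
  esup u `^ a <= esup (fun n => u n `^ a).
Proof.
move=> a0 u0; set M := esup (fun n => u n `^ a).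
have M0 : 0 <= M by apply: le_trans (le_esup _ 0%N); exact: poweR_ge0.
have -> : M = (M `^ a^-1) `^ a by rewrite -poweRrM mulVf ?gt_eqF// poweRe1.
apply: le_poweR; [exact: ltW|exact: le_trans (u0 0%N) (le_esup _ _)|].
apply: esup_le => n.
rewrite -[leLHS](poweRe1 (u0 n)) -[X in _ `^ X](mulfV (x := a)) ?gt_eqF// poweRrM.
apply: le_poweR; [by rewrite invr_ge0 ltW|exact: poweR_ge0|].
exact: (le_esup (fun n => u n `^ a)).
Qed.

Context d (T : measurableType d) (m : {measure set T -> \bar R}).

Lemma measurable_esup (v : nat -> T -> \bar R) : (forall n, measurable_fun setT (v n)) ->
  (forall x, {homo v^~ x : i j / (i <= j)%N >-> i <= j}) ->
  measurable_fun setT (fun x => esup (v^~ x)).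
Proof.
move=> mv hv; apply: (emeasurable_fun_cvg v) => // x _.
by apply: ereal_nondecreasing_cvgn; exact: hv.
Qed.

Lemma integral_esup (v : nat -> T -> \bar R) : (forall n, measurable_fun setT (v n)) ->
  (forall n x, 0 <= v n x) -> (forall x, {homo v^~ x : i j / (i <= j)%N >-> i <= j}) ->
  \int[m]_x esup (v^~ x) = esup (fun n => \int[m]_x v n x).
Proof.
move=> mv v0 hv.
have h := cvg_monotone_convergence (mu := m) measurableT mv (fun n x _ => v0 n x) (fun x _ => hv x).
have h2 : {homo (fun n => \int[m]_x v n x) : i j / (i <= j)%N >-> i <= j}.
  by move=> i j ij; apply: ge0_le_integral => // x _; exact: hv.
have -> : \int[m]_x esup (v^~ x) = \int[m]_x limn (v^~ x).
  apply: eq_integral => x _; apply/esym/cvg_lim => //.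
  by apply: ereal_nondecreasing_cvgn; exact: hv.
by rewrite -(cvg_lim _ h)//; apply: cvg_lim => //; exact: ereal_nondecreasing_cvgn.
Qed.

Lemma integral_poweR_esup_le (k : T -> \bar R) (v : nat -> T -> \bar R) (a : R) M : (0 < a)%R ->
  measurable_fun setT k -> (forall x, 0 <= k x) ->
  (forall n, measurable_fun setT (v n)) ->
  (forall n x, 0 <= v n x) -> (forall x, {homo v^~ x : i j / (i <= j)%N >-> i <= j}) ->
  (forall n, \int[m]_x (k x * v n x `^ a) <= M) -> \int[m]_x (k x * esup (v^~ x) `^ a) <= M.
Proof.
move=> a0 mk k0 mv v0 hv hM.
have mva n : measurable_fun setT (fun x => k x * v n x `^ a).
  by apply: emeasurable_funM => //; exact: measurableT_comp (measurable_poweR a) (mv n).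
have va0 n x : 0 <= k x * v n x `^ a by rewrite mule_ge0// poweR_ge0.
have hva x : {homo (fun n => k x * v n x `^ a) : i j / (i <= j)%N >-> i <= j}.
  by move=> i j ij; rewrite lee_wpmul2l// le_poweR ?(ltW a0)//; exact: hv.
apply: le_trans (esup_le hM); rewrite -integral_esup//.
apply: ge0_le_integral => //.
- by move=> x _; rewrite mule_ge0// poweR_ge0.
- apply: emeasurable_funM => //; apply: measurableT_comp (measurable_poweR a) _.
  exact: measurable_esup.
- exact: measurable_esup.
- move=> x _; apply: (@le_trans _ _ (k x * esup (fun n => v n x `^ a))).
    by rewrite lee_wpmul2l// poweR_esup_le.
  have hv' : {homo (fun n => v n x `^ a) : i j / (i <= j)%N >-> i <= j}.
    by move=> i j ij; rewrite le_poweR ?(ltW a0)//; exact: hv.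
  have s0 : 0 <= esup (fun n => v n x `^ a).
    by apply: le_trans (le_esup _ 0%N); exact: poweR_ge0.
  (* Pulling the factor [k x] out of a supremum is a division when it is positive and finite; the
     values 0 and infinity are checked by hand. *)
  have := k0 x; rewrite le_eqVlt => /predU1P[<-|kx0].
    by rewrite mul0e; apply: le_trans (le_esup _ 0%N); rewrite mul0e.
  case kE : (k x) kx0 => [c| |//]; last first.
    move=> _; have := s0; rewrite le_eqVlt => /predU1P[<-|s1].
      by rewrite mule0; apply: le_trans (le_esup _ 0%N); rewrite mule_ge0 ?poweR_ge0.
    have [n] : exists n, 0 < v n x `^ a.
      apply: contrapT => /forallNP h; move: s1; apply/negP; rewrite -leNgt.
      by apply: esup_le => n; rewrite leNgt; exact/negP/h.
    move=> vn; rewrite (gt0_mulye s1).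
    by apply: le_trans (le_esup (fun n => +oo * v n x `^ a) n); rewrite gt0_mulye.
  rewrite lte_fin => c0; rewrite muleC -lee_pdivlMr//.
  apply: esup_le => n; rewrite lee_pdivlMr// muleC.
  exact: (le_esup (fun n => c%:E * v n x `^ a)).
Qed.

End majorant.

Section majorant_iteration.
Context {R : realType} d (Z : measurableType d) (m : {sigma_finite_measure set Z -> \bar R}).
Variables (k : Z -> Z -> \bar R) (L : Z -> \bar R) (p : R).
Hypotheses (mk : measurable_fun setT (fun z => k z.1 z.2)) (k0 : forall z w, (0 <= k z w)%E).
Hypotheses (mL : measurable_fun setT L) (L0 : forall z, (0 <= L z)%E) (p0 : 0 < p).
Local Open Scope ereal_scope.

Definition majorant (n : nat) : Z -> \bar R :=
  iter n (fun v z => L z + \int[m]_w (k z w * v w `^ p)) (fun=> 0).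

Lemma majorantS n z : majorant n.+1 z = L z + \int[m]_w (k z w * majorant n w `^ p).
Proof. by []. Qed.

Lemma majorant_ge0 n z : 0 <= majorant n z.
Proof.
case: n => // n; rewrite majorantS adde_ge0//.
by apply: integral_ge0 => w _; rewrite mule_ge0// poweR_ge0.
Qed.

Lemma measurable_kernelM (v : Z -> \bar R) : measurable_fun setT v ->
  measurable_fun [set: Z * Z] (fun zw => k zw.1 zw.2 * v zw.2 `^ p).
Proof.
move=> mv; apply: emeasurable_funM => //.
by apply: measurableT_comp (measurable_poweR p) _; exact: measurableT_comp mv measurable_snd.
Qed.

Lemma measurable_majorant n : measurable_fun setT (majorant n).
Proof.
elim: n => [|n ih]; first exact: measurable_cst.
apply: emeasurable_funD => //.
apply: (@measurable_fun_fubini_tonelli_F _ _ Z Z R m (fun zw => k zw.1 zw.2 * majorant n zw.2 `^ p)).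
  exact: measurable_kernelM.
by move=> z; rewrite mule_ge0// poweR_ge0.
Qed.

Lemma measurable_kernelr z : measurable_fun setT (k z).
Proof. exact: (measurableT_comp mk (pair1_measurable z)). Qed.

Lemma measurable_majorantr n z : measurable_fun setT (fun w => k z w * majorant n w `^ p).
Proof. exact: (measurableT_comp (measurable_kernelM (measurable_majorant n)) (pair1_measurable z)). Qed.

Lemma majorant_nondecreasing z : {homo majorant^~ z : i j / (i <= j)%N >-> i <= j}.
Proof.
apply: homo_leq => [//|x y w|n]; first exact: le_trans.
elim: n z => [|n ih] z; first exact: majorant_ge0.
rewrite !majorantS leeD2l//; apply: ge0_le_integral => //.
- by move=> w _; rewrite mule_ge0// poweR_ge0.
- exact: measurable_majorantr.
- exact: (measurable_majorantr n.+1).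
- by move=> w _; rewrite lee_wpmul2l// le_poweR ?majorant_ge0// ltW.
Qed.

Definition majorant_lim z := esup (majorant^~ z).

Lemma measurable_majorant_lim : measurable_fun setT majorant_lim.
Proof.
by apply: measurable_esup => [n|z]; [exact: measurable_majorant|exact: majorant_nondecreasing].
Qed.

Lemma majorant_lim_ge0 z : 0 <= majorant_lim z.
Proof. by apply: le_trans (le_esup _ 0%N). Qed.

(** Where the limit is infinite there is nothing to prove. Elsewhere [L z] is finite, so it can be
    subtracted, and monotone convergence bounds the integral that remains. *)
Lemma majorant_lim_supersolution z :
  L z + \int[m]_w (k z w * majorant_lim w `^ p) <= majorant_lim z.
Proof.
have LV : L z <= majorant_lim z.
  apply: le_trans (le_esup _ 1%N); rewrite majorantS leeDl//.
  by apply: integral_ge0 => w _; rewrite mule_ge0// poweR_ge0.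
have [Vy|Vfin] := eqVneq (majorant_lim z) +oo; first by rewrite Vy leey.
have Lfin : L z \is a fin_num.
  by rewrite ge0_fin_numE// (le_lt_trans LV)// ltey.
rewrite -leeBrDl//; apply: integral_poweR_esup_le => //.
- exact: measurable_kernelr.
- exact: measurable_majorant.
- exact: majorant_ge0.
- exact: majorant_nondecreasing.
- by move=> n; rewrite leeBrDl// -majorantS; exact: (le_esup (majorant^~ z)).
Qed.

End majorant_iteration.

(** * Signed Picard iteration below a supersolution *)

Section signed_solution.
Context {R : realType} d (Z : measurableType d) (m : {sigma_finite_measure set Z -> \bar R}).
Variables (k : Z -> Z -> R) (a V : Z -> R) (D : set Z) (p : R).
Hypotheses (mk : measurable_fun setT (fun z => k z.1 z.2)) (k0 : forall z w, 0 <= k z w).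
Hypotheses (ma : measurable_fun setT a) (mV : measurable_fun setT V) (V0 : forall z, 0 <= V z).
Hypotheses (mD : measurable D) (p1 : 1 <= p).
Hypothesis aV : forall z, D z ->
  (`|a z|%:E + \int[m]_w (k z w * V w `^ p)%:E <= (V z)%:E)%E.

Let p0 : 0 <= p. Proof. exact: le_trans p1. Qed.

Lemma measurable_normr_powR (f : Z -> R) : measurable_fun setT f ->
  measurable_fun setT (fun w => `|f w| `^ p).
Proof.
move=> mf; apply: measurable_powR_fun.
exact: measurableT_comp.
Qed.

Lemma measurable_kernel_powR z (f : Z -> R) : measurable_fun setT f ->
  measurable_fun setT (fun w => k z w * `|f w| `^ p).
Proof.
move=> mf; apply: measurable_funM; last exact: measurable_normr_powR.
exact: (measurableT_comp mk (pair1_measurable z)).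
Qed.

Lemma integrable_kernel_majorant z : D z ->
  m.-integrable setT (EFin \o (fun w => k z w * V w `^ p)).
Proof.
move=> Dz; apply/integrableP; split.
  apply/measurable_EFinP; have := measurable_kernel_powR z mV.
  by under eq_fun do rewrite ger0_norm//.
under eq_integral do rewrite /= ger0_norm ?mulr_ge0 ?powR_ge0//.
apply: (@le_lt_trans _ _ (V z)%:E); last exact: ltry.
by apply: le_trans (aV Dz); rewrite leeDr.
Qed.

Lemma integrable_kernel_powR z (f : Z -> R) : D z -> measurable_fun setT f ->
  (forall w, `|f w| <= V w) ->
  m.-integrable setT (EFin \o (fun w => k z w * `|f w| `^ p)).
Proof.
move=> Dz mf fV; apply: le_integrable (integrable_kernel_majorant Dz) => //.
  by apply/measurable_EFinP; exact: measurable_kernel_powR.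
move=> w _; rewrite lee_fin ger0_norm ?mulr_ge0 ?powR_ge0//.
rewrite [leRHS]ger0_norm ?mulr_ge0 ?powR_ge0//.
by rewrite ler_wpM2l// ge0_ler_powR ?nnegrE.
Qed.

Definition picard (c f : Z -> R) (z : Z) : R :=
  \1_D z * (c z + \int[m]_w (k z w * `|f w| `^ p)).

Let u n : Z -> R := iter n (picard a) (fun=> 0).
Let w n : Z -> R := iter n (picard (fun z => `|a z|)) (fun=> 0).

Lemma measurable_picard c f : measurable_fun setT c -> measurable_fun setT f ->
  measurable_fun setT (picard c f).
Proof.
move=> mc mf; apply: measurable_funM; first exact: measurable_indic.
apply: measurable_funD => //.
apply: (measurable_Rintegral_param m (F := fun zw => k zw.1 zw.2 * `|f zw.2| `^ p)).
apply: measurable_funM => //.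
exact: measurableT_comp (measurable_normr_powR mf) measurable_snd.
Qed.

Lemma picardD c f z : D z -> picard c f z = c z + \int[m]_w (k z w * `|f w| `^ p).
Proof. by move=> Dz; rewrite /picard indicE mem_set// mul1r. Qed.

Lemma picardND c f z : ~ D z -> picard c f z = 0.
Proof. by move=> Dz; rewrite /picard indicE memNset// mul0r. Qed.

Lemma picard_le (f : Z -> R) z : measurable_fun setT f -> (forall w, `|f w| <= V w) ->
  picard (fun z => `|a z|) f z <= V z.
Proof.
move=> mf fV; have [Dz|nDz] := pselect (D z); last by rewrite picardND.
rewrite picardD// -lee_fin EFinD; apply: le_trans (aV Dz).
rewrite leeD2l// /Rintegral fineK; last exact: (integrable_fin_num measurableT (integrable_kernel_powR Dz mf fV)).
apply: ge0_le_integral => //.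
- by move=> x _; rewrite lee_fin mulr_ge0 ?powR_ge0.
- by apply/measurable_EFinP; exact: measurable_kernel_powR.
- exact: measurable_int (integrable_kernel_majorant Dz).
- by move=> x _; rewrite lee_fin ler_wpM2l// ge0_ler_powR ?nnegrE.
Qed.

(** The source [a], respectively its absolute value, cancels in each difference, and the kernel is
    nonnegative, so the pointwise estimate [normr_powR_sub_le] can be integrated. *)
Lemma picard_increment (f f' g g' : Z -> R) z :
  measurable_fun setT f -> measurable_fun setT f' ->
  measurable_fun setT g -> measurable_fun setT g' ->
  (forall x, `|f x| <= g x) -> (forall x, `|f' x| <= g' x) ->
  (forall x, g x <= V x) -> (forall x, g' x <= V x) ->
  (forall x, `|f' x - f x| <= g' x - g x) ->
  `|picard a f' z - picard a f z| <= picard (fun z => `|a z|) g' z - picard (fun z => `|a z|) g z.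
Proof.
move=> mf mf' mg mg' fg fg' gV gV' ffgg.
have [Dz|nDz] := pselect (D z); last by rewrite !picardND// subrr normr0.
have g0 x : 0 <= g x by exact: le_trans (fg x).
have g0' x : 0 <= g' x by exact: le_trans (fg' x).
have if_ : m.-integrable setT (EFin \o (fun x => k z x * `|f x| `^ p)).
  by apply: integrable_kernel_powR => // x; exact: le_trans (fg x) (gV x).
have if' : m.-integrable setT (EFin \o (fun x => k z x * `|f' x| `^ p)).
  by apply: integrable_kernel_powR => // x; exact: le_trans (fg' x) (gV' x).
have ig : m.-integrable setT (EFin \o (fun x => k z x * `|g x| `^ p)).
  by apply: integrable_kernel_powR => // x; rewrite ger0_norm.
have ig' : m.-integrable setT (EFin \o (fun x => k z x * `|g' x| `^ p)).
  by apply: integrable_kernel_powR => // x; rewrite ger0_norm.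
have addKA (A B C : R) : A + B - (A + C) = B - C by ring.
rewrite !(picardD _ _ Dz) !addKA -(RintegralB measurableT if' if_) -(RintegralB measurableT ig' ig).
have iu := integrable_EFinB if' if_.
apply: (le_trans (le_normr_Rintegral measurableT iu)).
apply: (le_Rintegral measurableT (integrable_norm iu) (integrable_EFinB ig' ig)).
move=> x _; rewrite /= -!mulrBr normrM (ger0_norm (k0 z x)) ler_wpM2l//.
rewrite (ger0_norm (g0 x)) (ger0_norm (g0' x)).
exact: normr_powR_sub_le.
Qed.

(** The bounds feed each other: domination of one increment extends [|u n| <= w n] to the next
    index, and these bounds together with those by [V] allow [picard_increment] to be applied
    again. *)
Let picard_iter n :
  [/\ measurable_fun setT (u n), measurable_fun setT (w n),
      (forall z, `|u n z| <= w n z), (forall z, w n z <= V z) &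
      (forall z, w n.+1 z <= V z) /\ (forall z, `|u n.+1 z - u n z| <= w n.+1 z - w n z)].
Proof.
have uS i : u i.+1 = picard a (u i) by [].
have wS i : w i.+1 = picard (fun z => `|a z|) (w i) by [].
have u0 z : u 0 z = 0 by [].
have w0 z : w 0 z = 0 by [].
have m0 : measurable_fun [set: Z] (fun=> (0 : R)) by exact: measurable_cst.
have mu0 : measurable_fun setT (u 0) by [].
have mw0 : measurable_fun setT (w 0) by [].
have uSS i : u i.+2 = picard a (u i.+1) by [].
have wSS i : w i.+2 = picard (fun z => `|a z|) (w i.+1) by [].
clearbody u w.
elim: n => [|n [mu mw uw wV [wV1 uuww]]].
  have w0V z : w 0 z <= V z by rewrite w0.
  split; [exact: mu0|exact: mw0|by move=> z; rewrite u0 w0 normr0|exact: w0V|split => z].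
    rewrite wS; apply: picard_le; first exact: mw0.
    by move=> x; rewrite w0 normr0.
  rewrite u0 w0 !subr0 uS wS.
  have [Dz|nDz] := pselect (D z); last by rewrite !picardND// normr0.
  rewrite !picardD// (le_trans (ler_normD _ _))// lerD2l.
  under [in leRHS]eq_Rintegral do rewrite w0.
  under eq_Rintegral do rewrite u0.
  rewrite ger0_norm//.
  by apply: Rintegral_ge0 => x _; rewrite mulr_ge0 ?powR_ge0.
have mu1 : measurable_fun setT (u n.+1) by rewrite uS; exact: measurable_picard.
have mw1 : measurable_fun setT (w n.+1).
  by rewrite wS; apply: measurable_picard => //; exact: measurableT_comp.
have uw1 z : `|u n.+1 z| <= w n.+1 z.
  by have := uw z; have := uuww z; have := ler_normD (u n.+1 z - u n z) (u n z);
    rewrite subrK; lra.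
split; [exact: mu1|exact: mw1|exact: uw1|exact: wV1|split => z].
  rewrite wSS; apply: picard_le; first exact: mw1.
  by move=> x; rewrite ger0_norm ?wV1//; exact: le_trans (uw1 x).
by rewrite uSS wSS [in u n.+1 z]uS [in w n.+1 z]wS picard_increment.
Qed.

Lemma signed_solution : exists u : Z -> R,
  [/\ measurable_fun setT u, forall z, `|u z| <= V z &
      forall z, D z -> u z = a z + \int[m]_w (k z w * `|u w| `^ p)].
Proof.
have wcv z : cvgn (w^~ z).
  apply: nondecreasing_is_cvgn.
    apply: homo_leq => [//|x y t|n]; first exact: le_trans.
    have [_ _ _ _ [_ /(_ z) h]] := picard_iter n.
    by rewrite -subr_ge0 (le_trans _ h).
  by exists (V z) => _ [n _ <-]; have [_ _ _ + _] := picard_iter n; apply.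
(* Since the increments of [u] are dominated by those of [w], the sequence [u + w] is nondecreasing,
   and it is bounded by [2 V]. Subtracting the limit of [w] yields the limit of [u] without summing
   a series. *)
have uwcv z : cvgn (fun n => u n z + w n z).
  apply: nondecreasing_is_cvgn.
    apply: homo_leq => [//|x y t|n]; first exact: le_trans.
    have [_ _ _ _ [_ /(_ z)]] := picard_iter n; rewrite ler_norml => /andP[]; lra.
  exists (V z + V z) => _ [n _ <-]; have [_ _ /(_ z) h /(_ z) h' _] := picard_iter n.
  by have := ler_norm (u n z); lra.
pose ul z : R := lim ((u n z + w n z) @[n --> \oo]) - lim (w n z @[n --> \oo]).
have ucv z : u n z @[n --> \oo] --> ul z.
  have -> : (u^~ z) = (fun n => u n z + w n z - w n z) by apply/funext => n; rewrite addrK.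
  by apply: cvgB; [exact: uwcv|exact: wcv].
have uV n z : `|u n z| <= V z.
  by have [_ _ /(_ z) h /(_ z) h' _] := picard_iter n; exact: le_trans h'.
have mun n : measurable_fun setT (u n) by have [] := picard_iter n.
have ulV z : `|ul z| <= V z.
  have h : `|u n z| @[n --> \oo] --> `|ul z| by apply: cvg_norm; exact: ucv.
  rewrite -(cvg_lim _ h)//; apply: limr_le; first by apply/cvg_ex; exists `|ul z|.
  exact: nearW.
have mul : measurable_fun setT ul by apply: (measurable_fun_cvg mun) => z _; exact: ucv.
exists ul; split=> //.
- move=> z Dz.
  have ipu n := integrable_kernel_powR Dz (mun n) (uV n).
  have h : (\int[m]_x (k z x * `|u n x| `^ p)%:E)%E @[n --> \oo] -->
      (\int[m]_x (k z x * `|ul x| `^ p)%:E)%E.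
    apply: (@dominated_cvg _ _ _ m setT measurableT (fun n x => (k z x * `|u n x| `^ p)%:E)
      (fun x => (k z x * `|ul x| `^ p)%:E) (EFin \o (fun w => k z w * V w `^ p))) => //.
    + by move=> n; exact: measurable_int (ipu n).
    + move=> x _; apply: cvg_EFin; first exact: nearW.
      apply: cvgM; first exact: cvg_cst.
      by apply: cvg_powR_ge0 => //; by apply: cvg_norm; exact: ucv.
    + exact: integrable_kernel_majorant.
    + move=> n x _; rewrite lee_fin ger0_norm ?mulr_ge0 ?powR_ge0//.
      by rewrite ler_wpM2l// ge0_ler_powR ?nnegrE.
  have h2 : u n.+1 z @[n --> \oo] --> a z + \int[m]_w (k z w * `|ul w| `^ p).
    have -> : (fun n => u n.+1 z) = (fun n => a z + \int[m]_w (k z w * `|u n w| `^ p)).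
      by apply/funext => n; rewrite [LHS]picardD.
    apply: cvgD; first exact: cvg_cst.
    apply: fine_cvg; rewrite fineK//.
    have := integrable_kernel_powR Dz mul ulV.
    exact: integrable_fin_num.
  have h3 : u n.+1 z @[n --> \oo] --> ul z by rewrite (cvg_shiftS (u^~ z)); exact: ucv.
  by rewrite -(cvg_lim _ h3)// -(cvg_lim _ h2).
Qed.

End signed_solution.

(** * Existence of mild solutions *)

Section exponents.
Context {R : realType} (N : nat) (s gamma rho b p : R).
Local Notation theta := (N%:R / (2 * s)).
Local Notation pc := (p_crit N s gamma b p).
Local Notation qc := (q_crit N s gamma rho b p).

(** In the unknown [x = 1/r] every condition is linear. The upper bounds on [x] express [p_c <= r]
    and the integrability of the weight, [b r/(r-p) < N]; the lower bounds express [r < oo],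
    [beta p < 1 + gamma] and [beta + rho < 0], the last two being convergence conditions for the
    time integrals. *)
Lemma exists_exponent :
  0 < s < 1 -> -1 < gamma <= 0 -> -1 < rho < 0 ->
  0 <= b / (1 + gamma) -> b / (1 + gamma) < 2 * s -> 2 * s < N%:R ->
  p_star N s gamma rho b < p ->
  exists r beta : R,
  [/\ 0 <= b, 1 < p, p < r & b * (r / (r - p)) < N%:R] /\
  [/\ 1 <= pc, pc <= r, 1 <= qc & qc <= r] /\
  [/\ theta * (pc^-1 - r^-1) = beta, theta * (qc^-1 - r^-1) = beta + rho + 1 &
      beta + rho + 1 < 1] /\
  [/\ -1 < gamma - beta * p, b / (2 * s) + theta * (p - 1) / r < 1 &
      gamma - beta * p - (b / (2 * s) + theta * (p - 1) / r) + 1 = - beta].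
Proof.
move=> /andP[s0 s1] /andP[g1 g0] /andP[r1 r0] b0 bs sN pp.
have G0 : 0 < 1 + gamma by lra.
have NR0 : 0 < N%:R :> R by lra.
have {}b0 : 0 <= b by have := mulr_ge0 b0 (ltW G0); rewrite divfK// gt_eqF.
have {}bs : b < 2 * s * (1 + gamma) by rewrite -ltr_pdivrMr.
set n : R := N%:R in sN NR0 *.
pose th := n / (2 * s).
have th1 : 1 < th by rewrite ltr_pdivlMr; lra.
have th0 : 0 < th by lra.
pose c := b / (2 * s).
have c0 : 0 <= c by rewrite divr_ge0//; lra.
have cG : c < 1 + gamma by rewrite ltr_pdivrMr; lra.
have bE : b = 2 * s * c by rewrite /c mulrC divfK// gt_eqF//; lra.
have nE : n = 2 * s * th by rewrite /th mulrC divfK// gt_eqF//; lra.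
have {}pp : th - c - (rho - gamma) < p * (th - (rho + 1)).
  move: pp; rewrite /p_star -/n.
  have d0 : 0 < n - 2 * s * (rho + 1) by nra.
  by rewrite ltr_pdivrMr// nE bE => h; rewrite -(ltr_pM2l (x := 2 * s)); lra.
(* If [p <= 1], the inequality [p > p^*] would force [c > 1 + gamma], against
   [b < 2 s (1 + gamma)]. *)
have p1 : 1 < p by rewrite ltNge; apply/negP => ple; nra.
have p0 : 0 < p by lra.
(* [A] is the reciprocal of [p_c]. *)
pose A := (1 + gamma - c) / (th * (p - 1)).
have thp0 : 0 < th * (p - 1) by rewrite mulr_gt0//; lra.
have A0 : 0 < A by rewrite divr_gt0//; lra.
have AE : A * (th * (p - 1)) = 1 + gamma - c by rewrite /A divfK// gt_eqF.
(* The reciprocal of [q_c] is [A + (rho + 1)/th], so this reads [q_c > 1]; it is equivalent to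
   [p > p^*]. *)
have A1 : th * A + rho + 1 < th.
  rewrite -(ltr_pM2r (x := p - 1)); [nra|lra].
(* The admissible values of [1/r] are those between [lo] and [up]. *)
pose lo := Num.max 0 (Num.max (A - (1 + gamma) / (p * th)) (A + rho / th)).
pose up := Num.min A ((1 - c / th) / p).
have pth0 : 0 < p * th by rewrite mulr_gt0.
have lu : lo < up.
  have E1 : (1 + gamma) / (p * th) * (p * th) = 1 + gamma by rewrite divfK// gt_eqF.
  have E2 : rho / th * th = rho by rewrite divfK// gt_eqF.
  have E3 : (1 - c / th) / p * (p * th) = th - c by field; rewrite !gt_eqF.
  have mulp (x y : R) : x * (p * th) < y * (p * th) -> x < y by rewrite ltr_pM2r.
  rewrite /lo /up !gt_max !lt_min; apply/andP; split; apply/andP; split.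
  - by [].
  - by apply: mulp; rewrite E3; lra.
  - apply/andP; split; apply: mulp; rewrite ?mulrBl ?E1 ?E3; nra.
  - apply/andP; split; apply: mulp; rewrite ?E3; nra.
have [x /andP[lox xup]] : exists x, lo < x < up.
  by exists ((lo + up) / 2); apply/andP; split; lra.
move: lox xup; rewrite /lo /up !gt_max !lt_min.
move=> /andP[x0 /andP[xA1 xA2]] /andP[xA xc].
have x1 : p * x < 1 - c / th by rewrite mulrC -ltr_pdivlMr.
have cth : 0 <= c / th by rewrite divr_ge0// ltW.
pose r := x^-1; pose beta := th * (A - x).
have rE : r^-1 = x by rewrite invrK.
have rgt0 : 0 < r by rewrite invr_gt0.
have pcE : pc^-1 = A.
  rewrite /p_crit -/n nE bE /A; field.
  by rewrite !gt_eqF//=; nra.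
have pc0 : 0 < pc by rewrite -invr_gt0 pcE.
have qcE : qc^-1 = A + (rho + 1) / th.
  have pcA : pc = A^-1 by rewrite -pcE invrK.
  rewrite /q_crit -/n pcA nE; field.
  by rewrite !gt_eqF//=; nra.
have qc_gt0 : 0 < qc^-1 by rewrite qcE addr_gt0// divr_gt0//; lra.
have qc0 : 0 < qc by rewrite -invr_gt0.
have A1lt : A < 1 by rewrite -(ltr_pM2l th0); lra.
have A1' : A + (rho + 1) / th < 1.
  rewrite -(ltr_pM2l th0) mulrDr mulr1 (_ : th * ((rho + 1) / th) = rho + 1); first lra.
  by field; rewrite gt_eqF.
have rth : 0 < (rho + 1) / th by rewrite divr_gt0//; lra.
have thx : th * (p - 1) / r = th * (p - 1) * x by rewrite rE.
have xA1' : th * p * (A - x) < 1 + gamma.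
  have : A - x < (1 + gamma) / (p * th) by lra.
  by rewrite ltr_pdivlMr// => h; lra.
have xA2' : th * (A - x) < - rho.
  have : A - x < - rho / th by rewrite mulNr; lra.
  by rewrite ltr_pdivlMr// => h; lra.
move: pcE pc0 qcE qc_gt0 qc0.
move: (p_crit N s gamma b p) (q_crit N s gamma rho b p) => P Q pcE pc0 qcE qc_gt0 qc0.
exists r, beta; rewrite -/th -/c; split; [split|split; [split|split; split]] => //.
- by rewrite -ltf_pV2 ?posrE// rE -(ltr_pM2l p0) mulfV ?gt_eqF//; lra.
- have xp : 0 < 1 - p * x by lra.
  have -> : r / (r - p) = (1 - p * x)^-1.
    by rewrite /r; field; rewrite !gt_eqF//=; lra.
  have h : c < (1 - p * x) * th by rewrite -ltr_pdivrMr//; lra.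
  have s2 : 0 < 2 * s by lra.
  have nx : n * (1 - p * x) = 2 * s * ((1 - p * x) * th) by rewrite [X in X * _]nE; ring.
  by rewrite ltr_pdivrMr// nx [X in X < _]bE ltr_pM2l.
- by rewrite -(invf_le1 pc0) pcE ltW.
- by rewrite -lef_pV2 ?posrE// pcE rE ltW.
- by rewrite -(invf_le1 qc0) qcE ltW.
- by rewrite -lef_pV2 ?posrE// rE qcE ltW// (lt_le_trans xA)// lerDl ltW.
- by rewrite pcE rE.
- by rewrite qcE rE /beta; field; rewrite gt_eqF.
- by rewrite /beta; lra.
- by rewrite /beta; lra.
- have : th * (p - 1) * x < A * (th * (p - 1)) by rewrite [ltRHS]mulrC ltr_pM2l.
  by rewrite thx AE; lra.
- by rewrite thx /beta; lra.
Qed.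

End exponents.

(** * Uniform bounds for the monotone iteration with small data *)

Section mild_majorant.
Context {R : realType} {N : nat}.
Local Notation mu := (lebesgue_tuple R N).
Local Notation leb := (@lebesgue_measure R).
Local Notation zmu := (prod_measure leb mu).
Local Notation Z := (measurableTypeR R * N.-tuple R)%type.
Variable s : R.
Local Notation theta := (N%:R / (2 * s)).
Variables (gamma rho b p pc qc r beta M : R) (E : R -> N.-tuple R -> R) (h0 h1 : R -> R).
Hypotheses (N0 : (0 < N)%N) (s0 : 0 < s) (kE : is_kernel s E).
Hypotheses (mh0 : measurable_fun setT h0) (h00 : forall x, 0 <= h0 x)
  (h0neg : forall x, x <= 0 -> h0 x = 0) (M0 : 0 < M)
  (h0M : forall x, 0 < x -> h0 x <= M * x `^ gamma).
Hypotheses (mh1 : measurable_fun setT h1) (h10 : forall x, 0 <= h1 x)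
  (h1neg : forall x, x <= 0 -> h1 x = 0)
  (h1M : forall x, 0 < x -> h1 x <= x `^ rho).
Hypotheses (rho1 : -1 < rho).
Hypotheses (b0 : 0 <= b) (p1 : 1 < p) (pr : p < r) (brN : b * (r / (r - p)) < N%:R).
Hypotheses (pc1 : 1 <= pc) (pcr : pc <= r) (qc1 : 1 <= qc) (qcr : qc <= r).
Hypotheses (betaE : theta * (pc^-1 - r^-1) = beta) (deltaE : theta * (qc^-1 - r^-1) = beta + rho + 1)
  (delta1 : beta + rho + 1 < 1).
Hypotheses (gb : -1 < gamma - beta * p) (eta1 : b / (2 * s) + theta * (p - 1) / r < 1)
  (etaE : gamma - beta * p - (b / (2 * s) + theta * (p - 1) / r) + 1 = - beta).
Local Open Scope ereal_scope.

Lemma measurable_heat_spacetime (g : N.-tuple R -> \bar R) : measurable_fun setT g ->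
  (forall y, 0 <= g y) -> measurable_fun [set: Z] (fun z => heat s z.1 g z.2).
Proof.
move=> mg g0.
apply: (measurable_fun_fubini_tonelli_F
  (fun zy : Z * N.-tuple R => (hk s zy.1.1 (vsub zy.1.2 zy.2))%:E * g zy.2)); last first.
  by move=> z; rewrite mule_ge0// hkE_ge0.
apply: emeasurable_funM; last exact: measurableT_comp mg measurable_snd.
apply/measurable_EFinP.
apply: measurable_hk_fun; first exact: (measurableT_comp measurable_fst measurable_fst).
apply: measurable_vsub; last exact: measurable_snd.
exact: (measurableT_comp measurable_snd measurable_fst).
Qed.

Lemma exists_mild_majorant : exists2 eps : R, (0 < eps)%R &
  forall u0 w : N.-tuple R -> R, measurable_fun setT u0 -> measurable_fun setT w ->
  \int[mu]_x (`|u0 x|%:E `^ pc) <= (eps `^ pc)%:E ->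
  \int[mu]_x (`|w x|%:E `^ qc) <= (eps `^ qc)%:E ->
  exists V : Z -> \bar R,
  [/\ measurable_fun setT V, forall z, 0 <= V z,
      forall t, (0 < t)%R -> \int[mu]_y (V (t, y) `^ r) < +oo &
      forall z, heat s z.1 (fun y => `|u0 y|%:E) z.2 +
        \int[zmu]_x ((dker s h1 0 z x)%:E * `|w x.2|%:E) +
        \int[zmu]_x ((dker s h0 b z x)%:E * V x `^ p) <= V z].
Proof.
have r1 : (1 <= r)%R by rewrite (le_trans pc1).
have r0 : (0 < r)%R by rewrite (lt_le_trans ltr01).
have p0 : (0 < p)%R by rewrite (lt_trans ltr01).
have [C1 C10 hC1] := @integral_poweR_heat_LqLr R N s E N0 s0 kE pc r pc1 pcr.
have [C2' C2'0 hC2'] := @integral_poweR_heat_LqLr R N s E N0 s0 kE qc r qc1 qcr.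
have rho10 : (-1 < rho - 0)%R by rewrite subr0.
have h1M' x : (0 < x)%R -> (h1 x <= 1 * x `^ rho)%R by rewrite mul1r; exact: h1M.
have [C2 C20 hC2] := @integral_poweR_dker_le R N s 0 h1 mh1 h10 h1neg E 1 rho 0
  (beta + rho + 1) r C2' ltr01 h1M' rho10 delta1 r1 C2'0.
have [K K0 hK] := @integral_poweR_heat_weight_le R N s E N0 s0 kE b p r b0 (ltW p1) pr brN.
have [K2 K20 hK2] := @integral_poweR_dker_le R N s b h0 mh0 h00 h0neg E M gamma (beta * p)
  (b / (2 * s) + theta * (p - 1) / r) r K M0 h0M gb eta1 r1 K0.
(* The radius of the ball solves [K2 B^p = B / 4], so that the nonlinear term uses one quarter of
   it; the factor 4 is lost in [integral_poweR_add_le]. *)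
pose B : R := ((4 * K2) `^ (- (p - 1)^-1))%R.
have K24 : (0 < 4 * K2)%R by rewrite mulr_gt0.
have B0 : (0 < B)%R by rewrite powR_gt0.
have BE : (K2 * B `^ p = B / 4)%R.
  rewrite -(mulr_powRB1 (ltW B0) p0) /B -powRrM mulNr mulVf ?gt_eqF ?subr_gt0//.
  by rewrite powR_inv1 ?(ltW K24)//; field; rewrite gt_eqF.
(* Each of the two data terms then has size at most [B / 16]; adding them costs a factor 4 and gives
   [B / 4], and adding the nonlinear term costs another and gives [B]. *)
pose eps : R := (B / (16 * (C1 + C2)))%R.
have C120 : (0 < C1 + C2)%R by rewrite addr_gt0.
have eps0 : (0 < eps)%R by rewrite divr_gt0// mulr_gt0.
have epsE : ((C1 + C2) * eps = B / 16)%R.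
  by rewrite /eps; field; rewrite gt_eqF.
have eps1 : (C1 * eps <= B / 16)%R by rewrite -epsE ler_wpM2r ?(ltW eps0)// lerDl ltW.
have eps2 : (C2 * eps <= B / 16)%R by rewrite -epsE ler_wpM2r ?(ltW eps0)// lerDr ltW.
exists eps => // u0 w mu0 mw hu0 hw.
have mu0' : measurable_fun setT (fun y => `|u0 y|%:E).
  by apply/measurable_EFinP; exact: measurableT_comp.
have mw' : measurable_fun setT (fun y => `|w y|%:E).
  by apply/measurable_EFinP; exact: measurableT_comp.
have n0 (f : N.-tuple R -> R) y : 0 <= `|f y|%:E by rewrite lee_fin.
have mwz : measurable_fun [set: Z] (fun z => `|w z.2|%:E) by exact: measurableT_comp mw' measurable_snd.
have wz0 (z : Z) : 0 <= `|w z.2|%:E by [].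
pose L1 (z : Z) := heat s z.1 (fun y => `|u0 y|%:E) z.2.
pose L2 (z : Z) := \int[zmu]_x ((dker s h1 0 z x)%:E * `|w x.2|%:E).
pose L z := L1 z + L2 z.
pose k (z x : Z) := (dker s h0 b z x)%:E.
have mL1 : measurable_fun setT L1 by exact: measurable_heat_spacetime.
have mL2 : measurable_fun setT L2 by exact: measurable_integral_dker.
have mL : measurable_fun setT L by exact: emeasurable_funD.
have L10 z : 0 <= L1 z by exact: heat_ge0.
have L20 z : 0 <= L2 z by apply: integral_ge0 => x _; rewrite mule_ge0// lee_fin dker_ge0.
have L0 z : 0 <= L z by rewrite adde_ge0.
have mk : measurable_fun [set: Z * Z] (fun z => k z.1 z.2).
  by apply/measurable_EFinP; exact: measurable_dker.
have k0 z x : 0 <= k z x by rewrite lee_fin dker_ge0.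
pose v := majorant zmu k L p.
have mv n : measurable_fun setT (v n) by exact: measurable_majorant.
have v0 n z : 0 <= v n z by exact: majorant_ge0.
have le_scale (c c' t : R) : (0 <= c)%R -> (c <= c')%R ->
    ((c * t `^ (- beta)) `^ r)%:E <= ((c' * t `^ (- beta)) `^ r)%:E :> \bar R.
  move=> c0 cc'; rewrite lee_fin ge0_ler_powR ?(ltW r0)// ?nnegrE ?mulr_ge0 ?powR_ge0//.
    exact: le_trans cc'.
  by rewrite ler_wpM2r ?powR_ge0.
have mr (g : Z -> \bar R) t : measurable_fun setT g -> measurable_fun setT (fun y => g (t, y)).
  by move=> mg; exact: measurableT_comp mg (pair1_measurable t).
have B16 : (0 <= B / 16)%R by rewrite divr_ge0// ltW.
have bL1 t : (0 < t)%R -> \int[mu]_y (L1 (t, y) `^ r) <= (((B / 16) * t `^ (- beta)) `^ r)%:E.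
  move=> t0; apply: (le_trans (hC1 t _ eps t0 (ltW eps0) mu0' (n0 u0) hu0)).
  rewrite betaE -mulrA [(t `^ _ * _)%R]mulrC mulrA; apply: le_scale => //.
  by rewrite mulr_ge0// ltW.
have bL2 t : (0 < t)%R -> \int[mu]_y (L2 (t, y) `^ r) <= (((B / 16) * t `^ (- beta)) `^ r)%:E.
  move=> t0; apply: (@le_trans _ _ ((C2 * eps * t `^ (- beta)) `^ r)%:E); last first.
    by apply: le_scale => //; rewrite mulr_ge0// ltW.
  have <- : (rho - 0 - (beta + rho + 1) + 1 = - beta)%R by ring.
  apply: hC2 => // x u x0 u0'.
  have -> : (fun y : N.-tuple R => (enorm y `^ (- 0))%:E * `|w y|%:E) = (fun y => `|w y|%:E).
    by apply/funext => y; rewrite oppr0 powRr0 mul1e.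
  rewrite oppr0 powRr0 mulr1.
  have := hC2' u _ eps u0' (ltW eps0) mw' (n0 w) hw.
  by rewrite deltaE.
have bL t : (0 < t)%R -> \int[mu]_y (L (t, y) `^ r) <= (((B / 4) * t `^ (- beta)) `^ r)%:E.
  move=> t0; have -> : (B / 4 * t `^ (- beta) = 4 * (B / 16 * t `^ (- beta)))%R by field.
  have B160 : (0 <= B / 16 * t `^ (- beta))%R by rewrite mulr_ge0 ?powR_ge0.
  exact: (integral_poweR_add_le r1 B160 (mr _ t mL1) (mr _ t mL2)
    (fun y => L10 (t, y)) (fun y => L20 (t, y)) (bL1 t t0) (bL2 t t0)).
have bv n t : (0 < t)%R -> \int[mu]_y (v n (t, y) `^ r) <= ((B * t `^ (- beta)) `^ r)%:E.
  elim: n t => [|n ih] t t0.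
    have v00 z : v 0%N z = 0 by [].
    under eq_integral do rewrite v00 (poweR0r (lt0r_neq0 r0)).
    by rewrite integral0 lee_fin powR_ge0.
  have -> : (B * t `^ (- beta) = 4 * (B / 4 * t `^ (- beta)))%R by field.
  have mvp : measurable_fun setT (fun z => v n z `^ p).
    exact: measurableT_comp (measurable_poweR p) (mv n).
  have vp0 z : 0 <= v n z `^ p by exact: poweR_ge0.
  have B40 : (0 <= B / 4 * t `^ (- beta))%R by rewrite mulr_ge0 ?powR_ge0// divr_ge0// ltW.
  have mI := mr (fun z => \int[zmu]_x (k z x * v n x `^ p)) t
    (measurable_integral_dker s b mh0 h00 mvp vp0).
  have I0 y : 0 <= \int[zmu]_x (k (t, y) x * v n x `^ p).
    by apply: integral_ge0 => x _; rewrite mule_ge0.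
  apply: (integral_poweR_add_le r1 B40 (mr _ t mL) mI (fun y => L0 (t, y)) I0 (bL t t0)).
  (* The critical scaling enters here: by [etaE] the time exponent produced by the Duhamel map is
     again [- beta]. *)
  rewrite -BE -etaE; apply: hK2 => //; first by rewrite powR_gt0.
  move=> x u x0 u0'; have mvx := mr _ x (mv n).
  apply: (le_trans (hK u (fun y => v n (x, y)) u0' mvx (fun y => v0 n (x, y)))).
  rewrite [in leRHS]powRM ?mulr_ge0 ?powR_ge0 ?(ltW K0)// EFinM.
  rewrite lee_wpmul2l ?lee_fin ?powR_ge0//.
  apply: (@le_trans _ _ (((B * x `^ (- beta)) `^ r)%:E `^ p)).
    apply: le_poweR (ih x x0); first exact: ltW.
    by apply: integral_ge0 => y _; exact: poweR_ge0.
  rewrite poweR_EFin lee_fin -powRrM [(r * p)%R]mulrC powRrM (powRM _ (ltW B0) (powR_ge0 _ _)).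
  by rewrite -[X in ((_ * X) `^ _)%R]powRrM mulNr.
exists (majorant_lim zmu k L p); split.
- exact: measurable_majorant_lim.
- exact: majorant_lim_ge0.
- move=> t t0; apply: (@le_lt_trans _ _ ((B * t `^ (- beta)) `^ r)%:E); last exact: ltry.
  have -> : \int[mu]_y (majorant_lim zmu k L p (t, y) `^ r) =
      \int[mu]_y (1 * esup (fun n => v n (t, y)) `^ r).
    by apply: eq_integral => y _; rewrite mul1e.
  apply: (@integral_poweR_esup_le R _ _ mu (fun=> 1) (fun n y => v n (t, y))) => //.
  + by move=> n; exact: mr.
  + by move=> y; exact: majorant_nondecreasing.
  + by move=> n; under eq_integral do rewrite mul1e; exact: bv.
- by move=> z; exact: majorant_lim_supersolution.
Qed.

End mild_majorant.

(** * From the space-time integral to the Duhamel formula *)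

Section duhamel_dker.
Context {R : realType} {N : nat}.
Local Notation mu := (lebesgue_tuple R N).
Local Notation leb := (@lebesgue_measure R).
Local Notation zmu := (prod_measure leb mu).
Local Notation Z := (measurableTypeR R * N.-tuple R)%type.
Variables (s b : R) (E : R -> N.-tuple R -> R) (h0 h : R -> R).
Hypotheses (N0 : (0 < N)%N) (s0 : 0 < s) (kE : is_kernel s E).
Hypotheses (mh0 : measurable_fun setT h0) (h00 : forall x, 0 <= h0 x)
  (h0neg : forall x, x <= 0 -> h0 x = 0) (h0pos : forall x, 0 < x -> 0 < h0 x)
  (h0h : forall x, 0 < x -> h0 x = h x).

(** Absolute convergence of the one space-time integral yields by Fubini's theorem all that is
    asked: convolvability for almost every time, integrability in time, and equality with the
    iterated integral. *)
Lemma duhamel_dker (F : Z -> R) t x : 0 < t -> measurable_fun setT F ->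
  zmu.-integrable setT (fun w => (dker s h0 b (t, x) w * F w)%:E) ->
  let G sigma y := enorm y `^ (- b) * F (sigma, y) in
  duhamel_defined E h G t x /\
  duhamel E h G t x = \int[zmu]_w (dker s h0 b (t, x) w * F w).
Proof.
move=> t0 mF iF G.
pose f (w : Z) := (dker s h0 b (t, x) w * F w)%:E.
have mG sigma : measurable_fun setT (G sigma).
  apply: measurable_funM; last exact: measurableT_comp mF (pair1_measurable sigma).
  apply: measurable_powR_fun.
  exact: measurable_enorm.
have fE sigma y : 0 < sigma < t ->
    f (sigma, y) = (h0 sigma * (hk s (t - sigma) (vsub x y) * G sigma y))%:E.
  move=> /andP[sg0 st]; rewrite /f /dker /= indicE mem_set/=; last by rewrite in_itv/= subr_gt0 st.
  by rewrite mulr1 /G !mulrA.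
have f0 sigma y : ~ (0 < sigma < t) -> f (sigma, y) = 0%E.
  move=> nst; rewrite /f /dker /=; have [sg0|sg0] := leP sigma 0; first by rewrite h0neg// !mul0r.
  rewrite indicE memNset ?mulr0 ?mul0r//= in_itv/= subr_gt0 andbT => st.
  by apply: nst; rewrite sg0.
pose H sigma y := hk s (t - sigma) (vsub x y) * G sigma y.
have fH sigma : 0 < sigma < t -> mu.-integrable setT (fun y => f (sigma, y)) ->
    mu.-integrable setT (EFin \o H sigma).
  move=> st iy; have /andP[/h0pos h0s _] := st.
  (* Positivity of [h0 sigma] allows the time factor to be divided out. *)
  have -> : EFin \o H sigma = (fun y => ((h0 sigma)^-1)%:E * f (sigma, y))%E.
    by apply/funext => y; rewrite fE// -EFinM mulKf ?gt_eqF.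
  exact: integrableZl.
pose C sigma := h0 sigma * \int[mu]_y H sigma y.
have CE sigma : 0 < sigma < t -> h sigma * convolution (E (t - sigma)) (G sigma) x = C sigma.
  move=> /andP[sg0 sgt].
  by rewrite (convolution_hk N0 s0 kE x _ (mG sigma)) ?subr_gt0// -h0h.
pose I : set R := `]0, t[%classic.
have mI : measurable I by exact: measurable_itv.
have IE sigma : (sigma \in I) = (0 < sigma < t) by rewrite mem_setE in_itv.
(* Outside []0, t[] the slices of [f] vanish while [C] need not; the restriction by 0 agrees with
   the inner integral at almost every time of the whole line. *)
pose pC : R -> R := C \_ I.
have mH : measurable_fun [set: measurableTypeR R * N.-tuple R] (fun z => H z.1 z.2).
  apply: measurable_funM; last first.
    apply: measurable_funM; last by rewrite (_ : (fun z => _) = F)//; apply/funext => -[].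
    apply: measurable_powR_fun.
    exact: measurableT_comp measurable_enorm measurable_snd.
  apply: measurable_hk_fun; first exact: measurable_funB.
  by apply: measurable_vsub => //; exact: measurable_snd.
have mC : measurable_fun setT C.
  apply: measurable_funM => //.
  exact: (measurable_Rintegral_param mu (F := fun z => H z.1 z.2)).
have mpC : measurable_fun setT pC.
  by apply/(measurable_restrictT C mI); exact: measurable_funTS.
have aei : {ae leb, forall sigma, mu.-integrable setT (fun y => f (sigma, y))}.
  exact: (@ae_integrable1 _ _ _ _ _ leb mu f iF).
have aeC : {ae leb, forall sigma, (pC sigma)%:E = fubini_F mu f sigma}.
  have [A [mA A0 hA]] := aei; exists A; split => // sigma nsigma; apply: hA => /= iy.
  apply: nsigma => /=; rewrite /fubini_F /pC patchE IE; case: ifPn => [st|/negP nst]; last first.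
    by rewrite integral0_eq// => y _; exact: f0.
  have iH := fH _ st iy.
  rewrite /C /Rintegral -[X in (_ * X)%R]/(fine _) EFinM fineK; last exact: (integrable_fin_num measurableT iH).
  rewrite -(integralZl measurableT iH); apply: eq_integral => y _.
  by rewrite fE.
have iFub : leb.-integrable setT (fubini_F mu f) by exact: integrable_fubini_F.
have mF' : measurable_fun setT (fubini_F mu f) by exact: measurable_int iFub.
have mpC' : measurable_fun setT (EFin \o pC) by exact/measurable_EFinP.
have aeC' : ae_eq leb setT (EFin \o pC) (fubini_F mu f).
  have [A [mA A0 hA]] := aeC; exists A; split => // sigma nsigma; apply: hA => /= ps.
  by apply: nsigma => _.
have ipC : leb.-integrable setT (EFin \o pC).
  apply/integrableP; split => //; case/integrableP : iFub => _; apply: le_lt_trans.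
  rewrite le_eqVlt; apply/orP; left; apply/eqP; apply: ae_eq_integral => //.
  - exact: measurableT_comp.
  - exact: measurableT_comp.
  - have [A [mA A0 hA]] := aeC; exists A; split => // sigma nsigma; apply: hA => /= ps.
    by apply: nsigma => /= _; rewrite -ps.
have pCE : EFin \o pC = (EFin \o C) \_ I.
  by apply/funext => sigma; rewrite /= patchE /pC patchE; case: ifP => sI; rewrite ?sI.
split; first split.
- have [A [mA A0 hA]] := aei; exists A; split => // sigma nsigma; apply: hA => /= iy.
  apply: nsigma => /= st; have /andP[sg0 sgt] := st.
  apply: (convolvable_hk N0 s0 kE _ (mG sigma)); first by rewrite subr_gt0.
  exact: fH st iy.
- apply: (@eq_integrable _ _ _ leb I _ (EFin \o C)) => //.
    by move=> sigma; rewrite IE => st; rewrite /= CE.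
  by rewrite pCE in ipC; apply: (@integrable_mkcond _ _ _ leb I (EFin \o C) mI).2.
- rewrite /duhamel (@eq_Rintegral _ _ _ leb I C) => [|sigma]; last by rewrite IE => /CE.
  rewrite /Rintegral; congr fine; rewrite integral_mkcond -[X in integral _ _ X]pCE.
  rewrite (ae_eq_integral (fubini_F mu f) (EFin \o pC) measurableT mpC' mF' aeC').
  exact: (@integral12_prod_meas1 _ _ _ _ _ leb mu f iF).
Qed.

End duhamel_dker.

Section assembly.
Context {R : realType} {N : nat}.
Local Notation mu := (lebesgue_tuple R N).

Lemma integral_poweR_Lnorm_le (f : N.-tuple R -> R) (q eps : R) : 1 <= q ->
  ('N[mu]_(q%:E)[EFin \o f] <= eps%:E)%E ->
  (\int[mu]_x (`|f x|%:E `^ q) <= (eps `^ q)%:E)%E.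
Proof.
move=> q1 fe; have q0 : 0 < q by rewrite (lt_le_trans ltr01).
have -> : (\int[mu]_x (`|f x|%:E `^ q) = 'N[mu]_(q%:E)[EFin \o f] `^ q)%E.
  by rewrite poweR_Lnorm// gt_eqF.
by rewrite -poweR_EFin; apply: le_poweR => //; [exact: ltW|exact: Lnorm_ge0].
Qed.

Lemma ae_fin_of_integral_poweR (V : N.-tuple R -> \bar R) (r : R) : 0 < r ->
  measurable_fun setT V -> (forall x, 0 <= V x)%E ->
  (\int[mu]_x (V x `^ r) < +oo)%E -> {ae mu, forall x, (V x < +oo)%E}.
Proof.
move=> r0 mV V0 Voo.
have iV : mu.-integrable setT (fun x => V x `^ r)%E.
  apply/integrableP; split; first exact: measurableT_comp (measurable_poweR r) mV.
  by under eq_integral do rewrite gee0_abs ?poweR_ge0//.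
have := integrable_ae measurableT iV; apply: filterS => x /(_ I).
by rewrite ge0_fin_numE ?poweR_ge0// => /(lty_poweRy (lt0r_neq0 r0)).
Qed.

End assembly.

Theorem theorem1p6 (R : realType) (N : nat) (s gamma rho b p : R) (l : R -> R)
    (E : R -> N.-tuple R -> R) :
  (1 <= N)%N ->
  0 < s < 1 ->
  is_kernel s E ->
  -1 < gamma <= 0 ->
  {in `]0, +oo[, continuous l} ->
  (exists M : R, forall t, 0 < t -> `|l t| <= M) ->
  slowly_varying l ->
  -1 < rho < 0 ->
  0 <= b / (1 + gamma) ->
  b / (1 + gamma) < 2 * s ->
  2 * s < N%:R ->
  p_star N s gamma rho b < p ->
  exists2 eps : R, 0 < eps &
    forall u0 w : N.-tuple R -> R,
    measurable_fun [set: N.-tuple R] u0 ->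
    measurable_fun [set: N.-tuple R] w ->
    ('N[lebesgue_tuple R N]_((p_crit N s gamma b p)%:E)[EFin \o u0] +
     'N[lebesgue_tuple R N]_((q_crit N s gamma rho b p)%:E)[EFin \o w]
       <= eps%:E)%E ->
    exists u : R -> N.-tuple R -> R,
      global_mild_solution E (fun t => t `^ gamma * l t) b p rho u0 w u.
Proof.
move=> N0 s01 kE gamma01 _ [M hM] [ml lpos _] rho01 b0 bs sN pstar.
have [r [beta [[b0' p1 pr brN] [[pc1 pcr qc1 qcr] [[betaE deltaE delta1] [gb eta1 etaE]]]]]] :=
  @exists_exponent R N s gamma rho b p s01 gamma01 rho01 b0 bs sN pstar.
have s0 : 0 < s by case/andP: s01.
have r0 : 0 < r by rewrite (lt_trans _ pr)// (lt_trans ltr01).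
(* The bound is positive because it dominates [l 1 > 0]. *)
have M0 : 0 < M by rewrite (lt_le_trans (lpos 1 ltr01))// (le_trans (ler_norm _))// hM.
pose h t := t `^ gamma * l t.
pose P : set R := `]0, +oo[%classic.
have mP : measurable P by exact: measurable_itv.
have PE t : (t \in P) = (0 < t) by rewrite mem_setE in_itv/= andbT.
(* The time factors are extended by 0 to nonpositive times, so that integration over all of
   space-time starts at time 0. *)
pose h0 := h \_ P.
pose h1 := (fun t : R => t `^ rho) \_ P.
have h0E t : 0 < t -> h0 t = h t by move=> t0; rewrite /h0 patchE PE t0.
have h1E t : 0 < t -> h1 t = t `^ rho by move=> t0; rewrite /h1 patchE PE t0.
have h0neg t : t <= 0 -> h0 t = 0 by move=> t0; rewrite /h0 patchE PE ltNge t0.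
have h1neg t : t <= 0 -> h1 t = 0 by move=> t0; rewrite /h1 patchE PE ltNge t0.
have h0pos t : 0 < t -> 0 < h0 t by move=> t0; rewrite h0E// mulr_gt0 ?powR_gt0 ?lpos.
have h1pos t : 0 < t -> 0 < h1 t by move=> t0; rewrite h1E// powR_gt0.
have h00 t : 0 <= h0 t by have [t0|/h0pos/ltW//] := leP t 0; rewrite h0neg.
have h10 t : 0 <= h1 t by have [t0|/h1pos/ltW//] := leP t 0; rewrite h1neg.
have mh0 : measurable_fun setT h0.
  apply/(measurable_restrictT h mP); apply: measurable_funM; first exact: measurable_powRl.
  by rewrite (_ : P = [set t | 0 < t])//; apply/seteqP; split => t; rewrite /P /= in_itv/= andbT.
have mh1 : measurable_fun setT h1.
  by apply/(measurable_restrictT (fun t : R => t `^ rho) mP); exact: measurable_powRl.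
have h0M t : 0 < t -> h0 t <= M * t `^ gamma.
  by move=> t0; rewrite h0E// /h mulrC ler_wpM2r ?powR_ge0// (le_trans (ler_norm _))// hM.
have h1M t : 0 < t -> h1 t <= t `^ rho by move=> t0; rewrite h1E.
have rho1 : -1 < rho by case/andP: rho01.
have [eps eps0 heps] := @exists_mild_majorant R N s gamma rho b p _ _ r beta M E h0 h1
  N0 s0 kE mh0 h00 h0neg M0 h0M mh1 h10 h1neg h1M rho1 b0' p1 pr brN pc1 pcr qc1 qcr
  betaE deltaE delta1 gb eta1 etaE.
exists eps => // u0 w mu0 mw hu0w.
pose mu := lebesgue_tuple R N.
pose zmu := prod_measure (@lebesgue_measure R) mu.
pose Z := (measurableTypeR R * N.-tuple R)%type.
have hu0 : (\int[mu]_x (`|u0 x|%:E `^ p_crit N s gamma b p) <= (eps `^ p_crit N s gamma b p)%:E)%E.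
  by apply: integral_poweR_Lnorm_le => //; apply: le_trans hu0w; rewrite leeDl// Lnorm_ge0.
have hw : (\int[mu]_x (`|w x|%:E `^ q_crit N s gamma rho b p) <= (eps `^ q_crit N s gamma rho b p)%:E)%E.
  by apply: integral_poweR_Lnorm_le => //; apply: le_trans hu0w; rewrite leeDr// Lnorm_ge0.
have [V [mV V0 Vr hV]] := heps u0 w mu0 mw hu0 hw.
have p0 : 0 < p by rewrite (lt_trans ltr01).
pose D : set Z := [set z | (V z < +oo)%E].
have mD : measurable D.
  have := emeasurable_fun_infty_o measurableT mV +oo%E; by rewrite setTI.
have DE z : (z \in D) = (V z < +oo)%E.
  by apply/idP/idP => [/set_mem|Vz]; [|exact/mem_set].
(* A real-valued version of the majorant, set to 0 where it is infinite. It stays below [V], so the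
   nonlinear term only decreases and the supersolution inequality persists on [D]. *)
pose VR : Z -> R := (fine \o V) \_ D.
have VRE z : D z -> (VR z)%:E = V z.
  move=> Dz; rewrite /VR patchE DE Dz /= fineK// ge0_fin_numE//; exact: V0.
have VRV z : ((VR z)%:E <= V z)%E.
  have [Dz|nDz] := pselect (D z); first by rewrite VRE.
  by rewrite /VR patchE memNset.
have VR0 z : 0 <= VR z by rewrite /VR patchE; case: ifP => // _; rewrite fine_ge0.
have mVR : measurable_fun setT VR.
  apply/(measurable_restrictT (fine \o V) mD); apply: measurable_funTS.
  by apply: measurableT_comp => //; exact: fine_measurable.
pose H (z : Z) y := hk s z.1 (vsub z.2 y) * u0 y.
pose a1 z := \int[mu]_y H z y.
pose a2 z := \int[zmu]_x (dker s h1 0 z x * w x.2).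
have mH : measurable_fun [set: Z * N.-tuple R] (fun zy => H zy.1 zy.2).
  apply: measurable_funM; last exact: measurableT_comp mu0 measurable_snd.
  apply: measurable_hk_fun; first exact: (measurableT_comp measurable_fst measurable_fst).
  apply: measurable_vsub; last exact: measurable_snd.
  exact: (measurableT_comp measurable_snd measurable_fst).
have mHw : measurable_fun [set: Z * Z] (fun zx => dker s h1 0 zx.1 zx.2 * w zx.2.2).
  apply: measurable_funM; first exact: measurable_dker.
  apply: (measurableT_comp mw (g := fun zx : Z * Z => zx.2.2)).
  exact: (measurableT_comp measurable_snd measurable_snd).
have ma : measurable_fun setT (fun z => a1 z + a2 z).
  apply: measurable_funD.
    exact: (measurable_Rintegral_param mu (F := fun zy : Z * N.-tuple R => H zy.1 zy.2)).
  exact: (measurable_Rintegral_param zmu (F := fun zx : Z * Z => dker s h1 0 zx.1 zx.2 * w zx.2.2)).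
pose L1 (z : Z) := heat s z.1 (fun y => `|u0 y|%:E) z.2.
pose L2 (z : Z) := (\int[zmu]_x ((dker s h1 0 z x)%:E * `|w x.2|%:E))%E.
pose K (z : Z) := (\int[zmu]_x ((dker s h0 b z x)%:E * V x `^ p))%E.
have {}hV z : (L1 z + L2 z + K z <= V z)%E := hV z.
have L10 z : (0 <= L1 z)%E by apply: heat_ge0 => y; rewrite lee_fin.
have L20 z : (0 <= L2 z)%E.
  by apply: integral_ge0 => x _; rewrite mule_ge0// lee_fin ?dker_ge0.
have K0 z : (0 <= K z)%E.
  by apply: integral_ge0 => x _; rewrite mule_ge0 ?poweR_ge0// lee_fin dker_ge0.
have L1E z : (\int[mu]_y `|(H z y)%:E| = L1 z)%E.
  by apply: eq_integral => y _; rewrite /= normrM (ger0_norm (hk_ge0 _ _ _)) EFinM.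
have L2E z : (\int[zmu]_x `|(dker s h1 0 z x * w x.2)%:E| = L2 z)%E.
  apply: eq_integral => x _; rewrite /= normrM ger0_norm ?EFinM//.
  exact: (dker_ge0 s 0 h10).
have mHz z : measurable_fun setT (fun y => (H z y)%:E).
  by apply/measurable_EFinP; exact: (measurableT_comp mH (pair1_measurable z)).
have mHwz z : measurable_fun setT (fun x => (dker s h1 0 z x * w x.2)%:E).
  by apply/measurable_EFinP; exact: (measurableT_comp mHw (pair1_measurable z)).
have iH z : D z -> mu.-integrable setT (fun y => (H z y)%:E).
  move=> Dz; apply/integrableP; split => //; rewrite L1E; apply: le_lt_trans Dz.
  by apply: le_trans (hV z); rewrite -addeA leeDl//; exact: adde_ge0 (L20 z) (K0 z).
have iHw z : D z -> zmu.-integrable setT (fun x => (dker s h1 0 z x * w x.2)%:E).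
  move=> Dz; apply/integrableP; split => //; rewrite L2E; apply: le_lt_trans Dz.
  by apply: le_trans (hV z); rewrite addeAC leeDr//; exact: adde_ge0 (L10 z) (K0 z).
have ale z : D z -> (`|a1 z + a2 z|%:E <= L1 z + L2 z)%E.
  move=> Dz; apply: (@le_trans _ _ (`|a1 z|%:E + `|a2 z|%:E)%E).
    by rewrite -EFinD lee_fin ler_normD.
  apply: leeD.
    rewrite -L1E -abse_EFin /a1 /Rintegral fineK; last exact: integrable_fin_num (iH z Dz).
    exact: le_abse_integral.
  rewrite -L2E -abse_EFin /a2 /Rintegral fineK; last exact: integrable_fin_num (iHw z Dz).
  exact: le_abse_integral.
have aVR z : D z ->
    (`|a1 z + a2 z|%:E + \int[zmu]_x (dker s h0 b z x * VR x `^ p)%:E <= (VR z)%:E)%E.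
  move=> Dz; rewrite VRE//; apply: le_trans (hV z); apply: leeD; first exact: ale.
  apply: ge0_le_integral => //.
  - by move=> x _; rewrite lee_fin mulr_ge0 ?powR_ge0 ?dker_ge0.
  - apply/measurable_EFinP; apply: measurable_funM.
      exact: (measurableT_comp (measurable_dker s b mh0) (pair1_measurable z)).
    by apply: measurable_powR_fun.
  - apply: measurable_dkerMr => //; exact: measurableT_comp (measurable_poweR p) mV.
  - move=> x _; rewrite EFinM lee_wpmul2l ?lee_fin ?dker_ge0// -poweR_EFin.
    by apply: le_poweR => //; rewrite ?lee_fin//; exact: ltW.
have [u [mu_ uVR uE]] := @signed_solution R _ Z zmu (dker s h0 b) (fun z => a1 z + a2 z) VR D p
  (measurable_dker s b mh0) (dker_ge0 s b h00) ma mVR VR0 mD (ltW p1) aVR.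
exists (fun t x => u (t, x)); split.
  apply: measurable_funTS; rewrite (_ : (fun z => _) = u)//.
  by apply/funext => -[].
move=> t t0.
have mVt : measurable_fun setT (fun x => V (t, x)).
  exact: measurableT_comp mV (pair1_measurable t).
(* The bound in L^r at this particular [t] puts almost every [(t, x)] in [D], where the fixed-point
   equation holds. *)
have := ae_fin_of_integral_poweR r0 mVt (fun x => V0 (t, x)) (Vr t t0).
apply: filterS => x Vx; have Dz : D (t, x) by [].
have cH : convolvable (hk s t) u0 x by exact: iH Dz.
have iK : zmu.-integrable setT (fun y => (dker s h0 b (t, x) y * `|u y| `^ p)%:E).
  exact: (integrable_kernel_powR (measurable_dker s b mh0) (dker_ge0 s b h00) mVR VR0 (ltW p1) aVR Dz mu_ uVR).
have mup : measurable_fun setT (fun z : Z => `|u z| `^ p) by exact: measurable_normr_powR.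
have [dK dKE] := duhamel_dker N0 s0 kE mh0 h0neg h0pos h0E t0 mup iK.
have mw2 : measurable_fun [set: Z] (fun z : Z => w z.2) by exact: measurableT_comp mw measurable_snd.
have [dW dWE] := duhamel_dker N0 s0 kE mh1 h1neg h1pos h1E t0 mw2 (iHw _ Dz).
(* The forcing term is the Duhamel term with weight exponent 0; since [0^0 = 1], the weight is 1
   also at the origin. *)
have wE : (fun (sigma : R) (y : N.-tuple R) => enorm y `^ (- 0) * w y) = (fun=> w).
  by apply/funext => sigma; apply/funext => y; rewrite oppr0 powRr0 mul1r.
split.
- exact: (convolvable_hk N0 s0 kE t0 mu0 cH).
- exact: dK.
- by rewrite -wE; exact: dW.
- rewrite (convolution_hk N0 s0 kE x t0 mu0) -wE [X in _ = _ + X]dWE [X in _ = _ + X + _]dKE.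
  by rewrite uE// addrAC.
Qed.
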